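(* There exists a hyperbolic group with Kazhdan's property (T) which possesses finite simple quotients of arbitrarily large rank.
   Context: ''Hyperbolic'' means Gromov-hyperbolic. For an integer $d$, let $\mathscr S_d$ be the collection of those finite simple groups that contain an isomorphic copy of the alternating group $\mathrm{Alt}(d)$. A group is said to have finite simple quotients of arbitrarily large rank if, for every $d$, it admits a quotient group belonging to $\mathscr S_d$. *)

(* Defs.v *)
From HB Require Import structures.
From mathcomp Require Import all_boot all_order all_algebra.
From mathcomp Require Import all_fingroup all_solvable complex.
From mathcomp Require Import boolp reals normedtype.

Set Implicit Arguments.
Unset Strict Implicit.
Unset Printing Implicit Defensive.

Import Order.TTheory GRing.Theory Num.Theory.

Local Open Scope ring_scope.

Section WordMetric.
Variables (G : groupType) (S : seq G).

Definition letter (x : G) : bool := (x \in S) || (x^-1 \in S)%g.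

Definition spelled_in (g : G) (n : nat) : bool :=
  `[< exists w : n.-tuple G, all letter w /\ (\prod_(x <- w) x)%g = g >].

Definition generates : Prop := forall g : G, exists n : nat, spelled_in g n.

Definition word_length (genS : generates) (g : G) : nat := ex_minn (genS g).

Definition word_metric (R : realType) (genS : generates) (g h : G) : R :=
  (word_length genS (g^-1 * h)%g)%:R.

End WordMetric.

Section GromovHyperbolic.
Variables (R : realType) (T : Type) (dist : T -> T -> R).

Definition gromov_product (w x y : T) : R :=
  (dist x w + dist y w - dist x y) / 2.

Definition gromov_hyperbolic_space : Prop :=
  exists delta : R, forall w x y z : T,
    Num.min (gromov_product w x y) (gromov_product w y z) - delta
      <= gromov_product w x z.

End GromovHyperbolic.

(* The Cayley graph enters through its vertex set with the word metric, which
   is at bounded Hausdorff distance from its geometric realization. *)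
Definition hyperbolic_group (R : realType) (G : groupType) : Prop :=
  exists (S : seq G) (genS : generates S),
    gromov_hyperbolic_space (word_metric R genS).

(* A complex Hilbert space is a complete normed space H over R[i] together
   with an inner product inducing the norm of H. *)
Definition induces_norm (R : realType) (H : completeNormedModType R[i])
    (ip : {dot H for Num.conj}) : Prop :=
  forall v : H, `|v| ^+ 2 = ip v v.

Definition unitary_representation (R : realType) (G : groupType)
    (H : completeNormedModType R[i]) (ip : {dot H for Num.conj})
    (pi : G -> {linear H -> H}) : Prop :=
  [/\ forall v, pi 1%g v = v,
      forall g h v, pi (g * h)%g v = pi g (pi h v)
    & forall g u v, ip (pi g u) (pi g v) = ip u v].

(* Existence of a Kazhdan pair (Q, eps), for G with the discrete topology:
   compact subsets are finite and every representation is continuous. *)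
Definition kazhdan_property_T (R : realType) (G : groupType) : Prop :=
  exists (Q : seq G) (eps : R), 0 < eps /\
    forall (H : completeNormedModType R[i]) (ip : {dot H for Num.conj})
           (pi : G -> {linear H -> H}),
      induces_norm ip -> unitary_representation ip pi ->
      (exists2 v : H, v != 0 &
         forall g, g \in Q -> `|pi g v - v| < eps%:C%C * `|v|) ->
      exists2 v : H, v != 0 & forall g, pi g v = v.

Definition in_simple_class (d : nat) (gT : finGroupType) : Prop :=
  simple [set: gT] /\ exists K : {group gT}, 'Alt_('I_d)%g \isog K.

(* By the first isomorphism theorem, the quotients of G are, up to
   isomorphism, the targets of surjective homomorphisms from G. *)
Definition is_quotient (G Q : groupType) : Prop :=
  exists f : {multiplicative G -> Q}, forall y, exists x, f x = y.

Definition simple_quotients_of_large_rank (G : groupType) : Prop :=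
  forall d : nat, exists gT : finGroupType,
    in_simple_class d gT /\ is_quotient G gT.

(* Main.v *)
Require Import Defs.
From HB Require Import structures.
From mathcomp Require Import boolp classical_sets topology normedtype sequences.
From mathcomp Require Import all_boot all_algebra reals.
From mathcomp Require Import all_order all_fingroup all_solvable complex zify ring lra.
From mathcomp Require Import generic_quotient.

Set Implicit Arguments.
Unset Strict Implicit.
Unset Printing Implicit Defensive.

Import Order.TTheory GRing.Theory Num.Theory.

(* The group is the colimit of a triangle of finite p-groups: its edge groups are
   [F], [F] and [F^3] for [F] the field with 103 elements, and its vertex groups are
   the unipotent groups generated by two of them, with links of girth 8.

   Hyperbolicity: the Cayley graph is quasi-isometric to the graph of cosets of the
   vertex groups. Seen from any base vertex, the lower neighbours of a vertex are
   adjacent or equal, an edge joining vertices of the same level has a common lower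
   neighbour, and at one of its ends this is the only lower neighbour. It follows
   that a geodesic recedes from the base vertex at unit speed up to a bounded
   error, which is the four-point condition.

   Property (T): in each vertex group the subspaces of invariants of the two edge
   groups meet at an angle of cosine at most 1/3 < 1/2, because [F] is large. So
   alternating projections onto the invariants of the vertex groups converge
   geometrically to an invariant vector.

   Quotients: sending the letters to the elementary matrices [e_01(t)], [e_12(t)] and
   [e_20(t_0 + t_1 r + t_2 s)], with [r], [s] generating the matrix algebra [M_n(F)],
   maps the group onto the elementary group [EL_3(M_n(F))]. It contains the
   alternating group of degree [n] in its first diagonal block, and any nontrivial
   element of that group normally generates it. A quotient by a maximal normal
   subgroup is therefore simple and still contains the alternating group. *)

(** * Graphs with narrow balls *)

(** One group has to map onto [EL_3(M_n(F))] for all [n], so it may only satisfy relations that hold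
    over every [F]-algebra generated by two elements. There the root groups of two consecutive
    indices generate a Heisenberg group, whose coset graph has circuits of length 6: a triangle gets
    three angles pi/3, which is Euclidean and not hyperbolic. The vertex groups are therefore
    larger, of nilpotency class 3 and modelled on the maximal unipotent subgroup of [Sp_4], whose
    coset graph has girth 8. The angles become pi/4, the triangles are negatively curved, and the
    Heisenberg groups survive as quotients. The curvature is used combinatorially. The complex of
    cosets is rebuilt from a base vertex as an inductive type of normal forms on which the group
    acts; this shows at once that no unexpected identifications occur and what the lower neighbours
    of a vertex are. *)

Section ThinGraph.
Variables (T : Type) (d : T -> T -> nat).
Hypothesis dC : forall x y, d x y = d y x.
Hypothesis d_tri : forall x y z, d x z <= d x y + d y z.
Hypothesis lower_close : forall o v u u', d u v = 1 -> d u' v = 1 ->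
  (d o u).+1 = d o v -> (d o u').+1 = d o v -> d u u' <= 1.
Hypothesis flat_apex : forall o v v', d v v' = 1 -> d o v = d o v' ->
  exists u, [/\ d u v = 1, d u v' = 1 & (d o u).+1 = d o v].
Hypothesis flat_narrow_end : forall o v v' u u0 u2, d v v' = 1 -> d o v = d o v' ->
  d u v = 1 -> d u v' = 1 -> d u0 v = 1 -> d u2 v' = 1 ->
  (d o u).+1 = d o v -> (d o u0).+1 = d o v -> (d o u2).+1 = d o v ->
  d u0 u = 0 \/ d u2 u = 0.

Definition geodesic (z : nat -> T) (L : nat) : Prop :=
  forall i j, i <= j <= L -> d (z i) (z j) = j - i.

Section Base.
Variable o : T.
Let f := d o.

(* From [v], a step that does not leave the ball around [o] does not lead away
   from [a]. *)
Definition shadowed (a v : T) : Prop :=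
  forall w, d w v = 1 -> f w <= f v -> d a w <= d a v.

Lemma d_step x y : d x y = 1 -> f y <= (f x).+1 /\ f x <= (f y).+1.
Proof.
move=> e; have := d_tri o x y; have := d_tri o y x.
by rewrite (dC y x) e /f; lia.
Qed.

(** A neighbour [w] of [v'] that is not higher is either within distance 1 of [v], or shares with
    [v'] a lower neighbour [y]. In the second case [y] is within distance 1 of [v], and if it
    differs from [v] it is no farther from [a], because [v] is shadowed. *)
Lemma shadowed_up a v v' : shadowed a v -> d v v' = 1 -> f v' = (f v).+1 ->
  d a v' = (d a v).+1 -> shadowed a v'.
Proof.
move=> sh vv' fv' dv' w wv' fw.
have [fw'|fw'] : f w = f v' \/ (f w).+1 = f v' by have := d_step wv'; lia.
- have [y [yw yv' fy]] := flat_apex wv' fw'.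
  have /orP[/eqP e|] : (d y v == 0) || (d y v == 1).
  + by have := @lower_close o v' y v yv' vv'; rewrite -/(f _); rewrite /f in fw' fv' *; lia.
  + have h1 := d_tri a v y; have h2 := d_tri a y w.
    by rewrite (dC v y) e in h1; lia.
  + move=> /eqP yv; have h1 : d a y <= d a v.
      by apply: sh => //; rewrite /f in fw' fv' *; lia.
    by have h2 := d_tri a y w; lia.
- have h : d w v <= 1 by apply: (lower_close (o := o) wv' vv'); rewrite /f in fw' fv' *; lia.
  by have := d_tri a v w; rewrite (dC v w); lia.
Qed.

Section Ray.
Variables (z : nat -> T) (L : nat).
Hypothesis gz : geodesic z L.
Hypothesis fmin : forall j, j <= L -> f (z 0) <= f (z j).

Let zS j : j < L -> d (z j) (z j.+1) = 1.
Proof. by move=> jL; rewrite gz; lia. Qed.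

(** Over a flat run of five edges take common lower neighbours [u0], ..., [u4] of consecutive
    vertices. Successive ones are at distance at most 1, and the narrow ends make enough of them
    coincide for the route through them to be shorter than the run. *)
Lemma flat_run_le4 j : (forall i, i <= j -> f (z i) = f (z 0)) -> j <= L ->
  j <= 4.
Proof.
move=> flat jL; rewrite leqNgt; apply/negP => j5.
have fl i : i <= 5 -> d o (z i) = d o (z 0) by move=> i5; apply: flat; lia.
have com i : i < 5 -> exists u, [/\ d u (z i) = 1, d u (z i.+1) = 1 &
    (d o u).+1 = d o (z 0)].
  move=> i5; have iL : i < L by lia.
  have [|u [u1 u2 fu]] := flat_apex (o := o) (zS iL); first by rewrite !fl //; lia.
  by exists u; split=> //; rewrite fu fl //; lia.
have [u0 [a0 b0 l0]] := com 0 isT; have [u1 [a1 b1 l1]] := com 1 isT.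
have [u2 [a2 b2 l2]] := com 2 isT; have [u3 [a3 b3 l3]] := com 3 isT.
have [u4 [a4 b4 l4]] := com 4 isT.
have far u v a b : d u (z a) = 1 -> d v (z b) = 1 -> d u v + 2 < b - a ->
    b <= 5 -> False.
  move=> ua vb uv b5; have := d_tri (z a) u (z b); have := d_tri u v (z b).
  by rewrite (dC (z a) u) ua vb gz; lia.
have low u v i : d u (z i) = 1 -> d v (z i) = 1 -> i <= 5 ->
    (d o u).+1 = d o (z 0) -> (d o v).+1 = d o (z 0) -> d u v <= 1.
  by move=> ui vi i5 lu lv; apply: (lower_close (o := o) ui vi); rewrite fl.
have z1 : d (z 1) (z 2) = 1 by apply: zS; lia.
have z2 : d (z 2) (z 3) = 1 by apply: zS; lia.
have z3 : d (z 3) (z 4) = 1 by apply: zS; lia.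
have e1 : d u0 u1 = 0 \/ d u2 u1 = 0 by apply: (flat_narrow_end (o:=o) z1); rewrite ?fl.
have e2 : d u1 u2 = 0 \/ d u3 u2 = 0 by apply: (flat_narrow_end (o:=o) z2); rewrite ?fl.
have e3 : d u2 u3 = 0 \/ d u4 u3 = 0 by apply: (flat_narrow_end (o:=o) z3); rewrite ?fl.
have h01 : d u0 u1 <= 1 by apply: (low _ _ 1).
have h12 : d u1 u2 <= 1 by apply: (low _ _ 2).
have h23 : d u2 u3 <= 1 by apply: (low _ _ 3).
have := d_tri u0 u1 u2; have := d_tri u1 u2 u3; have := d_tri u0 u1 u3.
have := d_tri u0 u3 u4; rewrite (dC u3 u4).
rewrite (dC u2 u1) in e1; rewrite (dC u3 u2) in e2.
case: e1 => e1 t4 t3 t2 t1.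
  case: e2 => e2; first by apply: (far _ _ _ _ a0 b2) => //; lia.
  by apply: (far _ _ _ _ a0 b3) => //; lia.
case: e3 => e3; first by apply: (far _ _ _ _ a1 b3) => //; lia.
by apply: (far _ _ _ _ a0 b4) => //; lia.
Qed.

(** Both [z j] and the apex [u] of the flat edge are lower neighbours of [z j.+1], and they differ
    because [z j] is at distance 2 from [z j.+2]. So the narrow end is [z j.+2]: its neighbours that
    are not higher are [u] or adjacent to [u], which is adjacent to [z j]. *)
Lemma shadowed_flat_step j : j.+2 <= L -> f (z j.+1) = (f (z j)).+1 ->
  f (z j.+2) = f (z j.+1) -> shadowed (z j) (z j.+2).
Proof.
move=> jL f1 f2 w wv fw; rewrite gz; last by lia.
have d01 : d (z j) (z j.+1) = 1 by apply: zS; lia.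
have d12 : d (z j.+1) (z j.+2) = 1 by apply: zS; lia.
have [u [u1 u2 fu]] := flat_apex d12 (esym f2).
have d02 : d (z j) (z j.+2) = 2 by rewrite gz; lia.
have nu : d (z j) u <> 0 by have := d_tri (z j) u (z j.+2); lia.
have zju : d (z j) u <= 1 by apply: (lower_close (o := o) d01 u1); rewrite -/f.
have uniq_low x : d x (z j.+2) = 1 -> (f x).+1 = f (z j.+2) -> d x u = 0.
  move=> x2 fx; have h1 : (d o x).+1 = d o (z j.+1) by rewrite -/f fx f2.
  by have [] := flat_narrow_end (o := o) d12 (esym f2) u1 u2 d01 x2 fu (esym f1) h1.
have := d_tri (z j) u w.
have [e|fw'] : (f w).+1 = f (z j.+2) \/ f w = f (z j.+2).
- by have := d_step wv; lia.
- by rewrite (dC u w) (uniq_low w wv e); lia.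
have [y [yw y2 fy]] := flat_apex (o := o) wv fw'.
have ey : d y u = 0 by apply: uniq_low => //; rewrite -fw'.
by have := d_tri u y w; rewrite (dC u y) ey yw; lia.
Qed.

(** At most 4 steps are lost on an initial flat run and 1 on a later flat step. After the latter the
    ray is shadowed by an earlier vertex, and every further step must go up, since otherwise it
    would not lead away from that vertex. *)
Lemma ray_climbs j : j <= L -> j + f (z 0) <= f (z j) + 5.
Proof.
move=> jL; pose P j := [\/ forall i, i <= j -> f (z i) = f (z 0),
  [/\ 0 < j, f (z j) = (f (z j.-1)).+1 & j + f (z 0) <= f (z j) + 4] |
  (exists2 i, i < j & shadowed (z i) (z j)) /\ j + f (z 0) <= f (z j) + 5].
suff: P j by case=> [fl|[_ _]|[_]]; [have := flat_run_le4 fl jL; rewrite fl| |]; lia.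
elim: j jL => [|j IH] jL; first by constructor 1 => i; case: i.
have sj := zS jL; have [s1 s2] := d_step sj.
have {IH} IH := IH (ltnW jL).
have [up|nup] : f (z j.+1) = (f (z j)).+1 \/ f (z j.+1) <= f (z j) by lia.
- case: IH => [fl|[j0 up' h]|[[i ij sh] h]].
  + constructor 2; rewrite /= up; have := flat_run_le4 fl (ltnW jL).
    by rewrite fl //; split=> //; lia.
  + by constructor 2; rewrite /= up; split=> //; lia.
  + constructor 3; split; last by lia.
    exists i; first by lia.
    by apply: (shadowed_up sh) => //; rewrite !gz; lia.
- case: IH => [fl|[j0 up' h]|[[i ij sh] h]].
  + have e : f (z j.+1) = f (z 0).
      by have := fmin jL; have := fl j (leqnn j); lia.
    constructor 1 => i; rewrite leq_eqVlt => /orP[/eqP ->//|]; exact: fl.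
  + have [e|e] : f (z j.+1) = f (z j) \/ (f (z j.+1)).+1 = f (z j) by lia.
    * constructor 3; split; last by lia.
      exists j.-1; first by lia.
      by case: j j0 jL up' e {sj s1 s2 nup h} => // j _ jL up' e; apply: shadowed_flat_step.
    (* Going down right after going up would make [z j] and [z j.+2] lower neighbours of one vertex,
       hence adjacent or equal. *)
    * case: j j0 jL up' e sj {s1 s2 nup h} => // j _ jL /= up' e sj.
      have : d (z j) (z j.+2) <= 1.
        apply: (lower_close (o := o) (v := z j.+1)); rewrite -/f ?e ?up' //.
          by apply: zS; lia.
        by rewrite dC.
      by rewrite gz; lia.
  + have := sh (z j.+1); rewrite dC => /(_ sj nup); rewrite !gz; lia.
Qed.
End Ray.

(** The lowest vertex of the geodesic cuts it into two rays that climb away from it, one of them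
    read backwards. *)
Lemma near_point_on_geodesic (z : nat -> T) (L : nat) : geodesic z L ->
  exists2 t, t <= L & t + d o (z t) <= d o (z 0) + 5 /\
                      (L - t) + d o (z t) <= d o (z L) + 5.
Proof.
move=> gz.
have [t tL tmin] : exists2 t, t <= L & forall j, j <= L -> f (z t) <= f (z j).
  elim: L {gz} => [|K [t tK tm]]; first by exists 0 => // -[].
  case: (leqP (f (z t)) (f (z K.+1))) => h; last first.
    exists K.+1 => // j; rewrite leq_eqVlt => /orP[/eqP ->//|jK].
    by apply: leq_trans (ltnW h) (tm _ _).
  exists t; first by lia.
  by move=> j; rewrite leq_eqVlt => /orP[/eqP ->//|]; apply: tm.
exists t => //; split.
- have g1 : geodesic (fun i => z (t - i)) t by move=> i j h; rewrite dC gz; lia.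
  have := ray_climbs g1 _ (leqnn t); rewrite subnn subn0; apply=> j jt.
  by apply: tmin; lia.
- have g1 : geodesic (fun i => z (t + i)) (L - t) by move=> i j h; rewrite gz; lia.
  have := ray_climbs g1 _ (leqnn (L - t)); rewrite addn0 subnKC //; apply=> j jt.
  by apply: tmin; lia.
Qed.
End Base.

Hypothesis geo : forall x y, exists z, [/\ geodesic z (d x y), z 0 = x & d (z (d x y)) y = 0].

(** As in a tree: the order on a geodesic from [x] to [w] of its points near [o] and near [y]
    decides which alternative holds. Each use of a near point costs 5. *)
Lemma four_point o x y w :
  d x o + d y o + d x w <= d x o + d w o + d x y + 15 \/
  d y o + d w o + d x w <= d x o + d w o + d y w + 15.
Proof.
have [z [gz z0 zL]] := geo x w; set L := d x w in gz zL *.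
have [p pL []] := near_point_on_geodesic o gz; rewrite z0 => p1 p2.
have [t tL []] := near_point_on_geodesic y gz; rewrite z0 => t1 t2.
have dzx : d x (z p) = p by rewrite -z0 gz ?leq0n //; lia.
have dzw : d (z p) (z L) = L - p by rewrite gz ?pL //; lia.
have := d_tri (z p) (z L) w; have := d_tri o w (z L); have := d_tri y w (z L).
have := d_tri o (z p) x; have := d_tri o (z p) w; have := d_tri o (z p) y.
have := d_tri x (z p) w; rewrite -/L.
rewrite (dC x o) (dC y o) (dC w o) (dC (z p) x) (dC (z p) y) (dC w (z L)).
case: (leqP p t) => pt.
- have : d (z p) (z t) = t - p by rewrite gz; lia.
  by have := d_tri y (z t) (z p); rewrite (dC (z t) (z p)) (dC x y); lia.
- have : d (z t) (z p) = p - t by rewrite gz; lia.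
  by have := d_tri y (z t) (z p); lia.
Qed.
End ThinGraph.

(** * Triangles of groups *)

Lemma succ_neq (i : 'I_3) : i != (i + 1)%R.
Proof. by rewrite eq_sym -subr_eq0 addrC addKr. Qed.

Lemma other_index (i : 'I_3) : exists k, i != k.
Proof. by exists (i + 1)%R; apply: succ_neq. Qed.

Definition third (i k : 'I_3) : 'I_3 := (- (i + k))%R.

Lemma thirdC i k : third i k = third k i.
Proof. by rewrite /third addrC. Qed.

Lemma thirdK i k : third i (third i k) = k.
Proof. by rewrite /third opprD opprK addKr. Qed.

Lemma thirdKr i k : third k (third i k) = i.
Proof. by rewrite (thirdC i) thirdK. Qed.

Lemma thirdKl i k : third (third i k) k = i.
Proof. by rewrite thirdC thirdKr. Qed.

Lemma third_neql i k : i != k -> third i k != i.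
Proof. by move: i k => [[|[|[|//]]] ?] [[|[|[|//]]] ?]. Qed.

Lemma third_neqr i k : i != k -> third i k != k.
Proof. by rewrite thirdC eq_sym; apply: third_neql. Qed.

Lemma third_uniq i j k : i != k -> j != k -> i != j -> j = third i k.
Proof.
by move: i j k => [[|[|[|//]]] ?] [[|[|[|//]]] ?] [[|[|[|//]]] ?] // _ _ _; apply: val_inj.
Qed.

Section Vertices.
Local Open Scope group_scope.

(* The edge group [A i] lies in the two vertex groups [X k] with [k != i].
   [tri_girth] says that the links have girth at least 8; [tri_generation] and
   [tri_action] characterize the colimit, the latter through actions that need
   only be defined on the part [W] of [Y]. *)
Record triangle_of_groups (G : groupType) (A X : 'I_3 -> G -> Prop) : Prop := {
  tri_A1 : forall i, A i 1;
  tri_AM : forall i x y, A i x -> A i y -> A i (x * y);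
  tri_AV : forall i x, A i x -> A i x^-1;
  tri_XM : forall k x y, X k x -> X k y -> X k (x * y);
  tri_XV : forall k x, X k x -> X k x^-1;
  tri_AX : forall i k x, i != k -> A i x -> X k x;
  tri_nontrivial : forall i, exists2 x, A i x & x != 1;
  tri_disjoint : forall i j x, i != j -> A i x -> A j x -> x = 1;
  tri_girth : forall i j a b a' b' c b'', i != j ->
    A i a -> A j b -> A i a' -> A j b' -> A i c -> A j b'' ->
    a * b * a' = b' * c * b'' -> [\/ a = 1, b = 1 | a' = 1];
  tri_generation : forall P : G -> Prop, P 1 ->
    (forall g k x, P g -> X k x -> P (g * x)) -> forall g, P g;
  tri_action : forall (Y : Type) (W : Y -> Prop) (act : 'I_3 -> Y -> G -> Y),
    (forall k y x, W y -> X k x -> W (act k y x)) ->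
    (forall k y, W y -> act k y 1 = y) ->
    (forall k y x x', W y -> X k x -> X k x' -> act k (act k y x) x' = act k y (x * x')) ->
    (forall i k k' y a, W y -> i != k -> i != k' -> A i a -> act k y a = act k' y a) ->
    forall y0, W y0 -> exists F : G -> Y,
      F 1 = y0 /\ forall g k x, X k x -> F (g * x) = act k (F g) x
}.

Variables (G : groupType) (X : 'I_3 -> G -> Prop).

(* A vertex is a coset [g X_k], given by the pair [(k, g)]. *)
Definition same_vertex (u v : 'I_3 * G) : Prop := u.1 = v.1 /\ X u.1 (u.2^-1 * v.2).
Definition joined (u v : 'I_3 * G) : Prop :=
  exists c, X u.1 (u.2^-1 * c) /\ X v.1 (v.2^-1 * c).

(** The first five fields make [level] the distance from [(k0, 1)]; the last three are the
    hypotheses of [ThinGraph], stated for cosets. *)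
Record level_function (k0 : 'I_3) (level : 'I_3 * G -> nat) : Prop := {
  level_same : forall u v, same_vertex u v -> level u = level v;
  level_lip : forall u v, joined u v -> level v <= (level u).+1;
  level0 : forall v, level v = 0 -> same_vertex (k0, 1) v;
  level_base : level (k0, 1) = 0;
  level_down : forall v, 0 < level v -> exists2 u, joined u v & (level u).+1 = level v;
  lower_joined : forall u u' v, joined u v -> joined u' v ->
    (level u).+1 = level v -> (level u').+1 = level v -> joined u u';
  flat_lower : forall v v', joined v v' -> ~ same_vertex v v' -> level v = level v' ->
    exists u, [/\ joined u v, joined u v' & (level u).+1 = level v];
  flat_narrow : forall v v' u u0 u2, joined v v' -> ~ same_vertex v v' -> level v = level v' ->
    joined u v -> joined u v' -> joined u0 v -> joined u2 v' ->
    (level u).+1 = level v -> (level u0).+1 = level v -> (level u2).+1 = level v ->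
    same_vertex u0 u \/ same_vertex u2 u
}.
End Vertices.

(** * Unfolding the complex of cosets from a base vertex *)

Section Development.
Local Open Scope group_scope.
Variables (G : groupType) (A X : 'I_3 -> G -> Prop).
Hypothesis tri : triangle_of_groups A X.
Let A1 := tri_A1 tri.
Let AM := tri_AM tri.
Let AV := tri_AV tri.
Let XM := tri_XM tri.
Let XV := tri_XV tri.
Let AX := tri_AX tri.
Let A_disj := tri_disjoint tri.
Let girth := tri_girth tri.
Let A_nontrivial := tri_nontrivial tri.
Let generation := tri_generation tri.
Local Notation same := (same_vertex X).
Local Notation joined := (joined X).

(** The case of a circuit of length 4, obtained from [girth] with two trivial letters. *)
Lemma girth4 i j a b b' a' : i != j -> A i a -> A j b -> A j b' -> A i a' ->
  a * b = b' * a' -> a = 1 \/ b = 1.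
Proof.
move=> ij Aa Ab Ab' Aa' e; have [a1|a1] := eqVneq a' 1.
  left; apply: (A_disj ij Aa); have -> : a = b' * b^-1.
    by rewrite -(mulgK b a) e a1 mulg1.
  by apply: AM => //; apply: AV.
have e0 : a * b * a'^-1 = b' * 1 * 1 by rewrite e !mulg1 mulgK.
have [e1|e1|e1] := girth ij Aa Ab (AV Aa') Ab' (A1 i) (A1 j) e0; [by left|by right|].
by move: a1; rewrite -(invgK a') e1 invg1 eqxx.
Qed.

Variable k0 : 'I_3.

(* The vertices of the development, built level by level from [Base]: to a vertex
   [T], [Panel T C i] is attached along the edge given by the coset [C] of [A i],
   and [Tip T g a] is attached along two edges, with [T] two levels below it. *)
Inductive node := Base | Panel of node & (G -> Prop) & 'I_3 | Tip of node & G & G.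

Fixpoint ty N : 'I_3 :=
  match N with Base => k0 | Panel T _ i => third i (ty T) | Tip T _ _ => ty T end.

Definition side N i q : Prop :=
  match N with
  | Base => False
  | Panel _ C i' => i = i' /\ C q
  | Tip T g a => [/\ i != ty T, A i ((g * a)^-1 * q) & q != g * a]
  end.

Definition center N q : Prop :=
  match N with Tip T g a => q = g * a | _ => False end.

Definition residue N h : Prop :=
  match N with
  | Base => X k0 h
  | Panel T C i => exists2 c, C c & X (third i (ty T)) (c^-1 * h)
  | Tip T g a => X (ty T) ((g * a)^-1 * h)
  end.

(** For a well-formed [N] these are the chambers of which [N] is not the unique lowest vertex: they
    contain a lower edge, or share an edge at [N] with a chamber that does. *)
Definition touched N h : Prop :=
  (exists i q b, [/\ side N i q, A (third i (ty N)) b & h = q * b]) \/ center N h.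

Definition free N h : Prop := residue N h /\ ~ touched N h.

Definition near U i g (qb : G * G) : Prop :=
  [/\ side U i qb.1, A (third i (ty U)) qb.2, qb.2 != 1 & A i ((qb.1 * qb.2)^-1 * g)].

(** Across the edge of [g] lies a new [Panel], unless the edge also contains a touched chamber; then
    it is the third vertex of that chamber, a [Tip] over the parent of [U]. The parent is the
    argument [V], because [par] itself calls [child_of]. *)
Definition child_of U V i g : node :=
  if pselect (exists qb, near U i g qb) is left ex
  then Tip V (sval (cid ex)).1 (sval (cid ex)).2
  else Panel U (fun h => A i (g^-1 * h)) i.

Fixpoint par N i : node :=
  match N with
  | Base => Base
  | Panel T _ _ => T
  | Tip T g _ => child_of T (par T i) i g
  end.

Definition child U i g := child_of U (par U i) i g.

Fixpoint wf N : Prop :=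
  match N with
  | Base => True
  | Panel T C i => [/\ wf T, i != ty T & exists c,
      [/\ C = (fun h => A i (c^-1 * h)), free T c & forall qb, ~ near T i c qb]]
  | Tip T g a => [/\ wf T, free T g, A (ty T) a & a != 1]
  end.

Lemma A_sym i x y : A i (x^-1 * y) -> A i (y^-1 * x).
Proof. by move=> /AV; rewrite invMg invgK. Qed.

Lemma A_trans i x y z : A i (x^-1 * y) -> A i (y^-1 * z) -> A i (x^-1 * z).
Proof. by move=> h1 h2; have := AM h1 h2; rewrite -mulgA mulKVg. Qed.

Lemma residueM N i h a : i != ty N -> A i a -> residue N h -> residue N (h * a).
Proof.
case: N => [|T C j|T g b] /= iN Aa.
- by move=> Xh; apply: XM => //; apply: AX Aa.
- by move=> [c Cc Xc]; exists c => //; rewrite mulgA; apply: XM => //; apply: AX Aa.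
- by move=> Xc; rewrite mulgA; apply: XM => //; apply: AX Aa.
Qed.

Lemma side_neq N i q : wf N -> side N i q -> i != ty N.
Proof.
case: N => [//|T C j|T g b] /=.
- by case=> _ jT _ [-> _]; rewrite eq_sym third_neql.
- by move=> _ [].
Qed.

Lemma side_residue N i q : wf N -> side N i q -> residue N q.
Proof.
move=> wN; case: N wN => [//|T C j|T g b] /= wN.
- move=> [_ Cq]; exists q => //; rewrite mulVg.
  case: wN => _ jT _; apply: (@AX j); first by rewrite eq_sym third_neql.
  exact: A1.
- by move=> [iT Aq _]; apply: AX Aq.
Qed.

Lemma side_coset N i q q' : wf N -> side N i q -> side N i q' -> A i (q^-1 * q').
Proof.
case: N => [//|T C j|T g b] /= wN.
- by case: wN => _ _ [c [-> _ _]] [-> h1] [_ h2]; apply: A_trans h2; apply: A_sym.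
- by move=> [_ h1 _] [_ h2 _]; apply: A_trans h2; apply: A_sym.
Qed.

Lemma side_pair N i j q q' : wf N -> side N i q -> side N j q' -> i != j ->
  exists d x y, [/\ center N d, A i x, A j y, q = d * x & q' = d * y].
Proof.
case: N => [//|T C k|T g b] /= wN.
- by move=> [-> _] [-> _]; rewrite eqxx.
- move=> [_ h1 _] [_ h2 _] _; exists (g * b), ((g * b)^-1 * q), ((g * b)^-1 * q').
  by rewrite !mulKVg.
Qed.

Lemma sideM N i q a : wf N -> side N i q -> A i a -> side N i (q * a) \/ center N (q * a).
Proof.
case: N => [//|T C k|T g b] /= wN.
- case: wN => _ _ [c [-> _ _]] [-> h1] h2; left; split=> //.
  by rewrite mulgA; apply: AM.
- move=> [iT h1 _] h2; have [e|ne] := eqVneq (q * a) (g * b); first by right.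
  by left; split=> //; rewrite mulgA; apply: AM.
Qed.

Lemma centerM N i d x : wf N -> i != ty N -> center N d -> A i x -> x != 1 ->
  side N i (d * x).
Proof.
case: N => [//|//|T g b] /= wN iN -> Ax x1; split=> //; first by rewrite mulKg.
by apply: contraNneq x1 => e; rewrite -(mulKg (g * b) x) e mulVg.
Qed.

Lemma center_side N i d q : center N d -> side N i q ->
  exists x, [/\ A i x, x != 1 & q = d * x].
Proof.
case: N => [//|//|T g b] /= -> [_ h ne]; exists ((g * b)^-1 * q); split=> //.
  by apply: contraNneq ne => e; rewrite -(mulKVg (g * b) q) e mulg1.
by rewrite mulKVg.
Qed.

(** Two such touched chambers on one edge would close a circuit of length 4 in the link. *)
Lemma near_uniq U i g qb qb' : wf U -> near U i g qb -> near U i g qb' -> qb = qb'.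
Proof.
case: qb qb' => [q b] [q' b'] wU [/= s Ab b1 h] [/= s' Ab' b1' h'].
have iU := side_neq wU s; have it : i != third i (ty U) by rewrite eq_sym third_neql.
have Ax := side_coset wU s s'; set x := q^-1 * q' in Ax.
have e' : q' = q * x by rewrite mulKVg.
have Ay : A i ((q * b)^-1 * (q' * b')) by apply: A_trans h (A_sym h').
have e : x * b' = b * ((q * b)^-1 * (q' * b')).
  by rewrite e' invMg -!mulgA mulKg mulKVg.
have [x1|/eqP] := girth4 it Ax Ab' Ab Ay e; last by rewrite (negPf b1').
rewrite e' x1 mulg1; congr (_, _).
have : b^-1 * b' = 1.
  apply: (A_disj it).
    by move: Ay; rewrite e' x1 mulg1 invMg -mulgA mulKg.
  by apply: AM => //; apply: AV.
by move=> bb; rewrite -[b]mulg1 -bb mulKVg.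
Qed.

Lemma child_near U i g q b : wf U -> near U i g (q, b) -> child U i g = Tip (par U i) q b.
Proof.
move=> wU n; rewrite /child /child_of; case: pselect => [ex|]; last by case; exists (q, b).
by case: (cid ex) => qb n' /=; rewrite (near_uniq wU n' n).
Qed.

Lemma child_far U i g : (forall qb, ~ near U i g qb) ->
  child U i g = Panel U (fun h => A i (g^-1 * h)) i.
Proof.
by move=> far; rewrite /child /child_of; case: pselect => // ex; case: ex (far) => qb n /(_ qb).
Qed.

Lemma near_or_far U i g : (exists q b, near U i g (q, b)) \/ forall qb, ~ near U i g qb.
Proof.
have [[[q b] n]|h] := pselect (exists qb, near U i g qb); first by left; exists q, b.
by right=> qb n; apply: h; exists qb.
Qed.

Lemma nearM U i g a qb : A i a -> near U i (g * a) qb -> near U i g qb.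
Proof.
move=> Aa [s Ab b1 h]; split=> //; apply: A_trans h _.
by rewrite invMg -mulgA mulVg mulg1; apply: AV.
Qed.

(* If the panel through [c] is far from the gate of [T], it consists of free
   chambers. *)
Lemma far_free T i c a : wf T -> i != ty T -> free T c -> (forall qb, ~ near T i c qb) ->
  A i a -> free T (c * a).
Proof.
move=> wT iT [rc nt] far Aa; split; first exact: (residueM iT Aa rc).
move=> [[j [q [b [s Ab e]]]]|ce].
- have ec : c = q * b * a^-1 by rewrite -e mulgK.
  have [ij|ij] := eqVneq j i; last first.
    have jT := side_neq wT s; have e3 := third_uniq jT iT ij.
    apply: nt; left; exists j, q, (b * a^-1); split=> //; last by rewrite mulgA.
    by rewrite -e3 in Ab *; apply: AM => //; apply: AV.
  rewrite {}ij in s Ab; have [b1|b1] := eqVneq b 1.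
    move: ec; rewrite b1 mulg1 => ec; have [s'|c'] := sideM wT s (AV Aa).
      by apply: nt; left; exists i, (q * a^-1), 1; rewrite mulg1.
    by apply: nt; right; rewrite ec.
  by apply: (far (q, b)); split=> //=; rewrite ec mulKg; apply: AV.
- have [a1|a1] := eqVneq a 1; first by apply: nt; right; move: ce; rewrite a1 mulg1.
  apply: nt; left; exists i, c, 1; split; rewrite ?mulg1 //.
  rewrite -(mulgK a c); apply: centerM => //; first exact: AV.
  by rewrite invg_eq1.
Qed.

(** Going down by [par] and up by [child] are inverse operations. Both halves come from one
    induction: [child_spec U] follows from [parent_spec U], and [parent_spec] of a tip over [T] uses
    [child_spec T]. *)
Definition parent_spec N := forall i q, side N i q ->
  [/\ wf (par N i), ty (par N i) = third i (ty N), free (par N i) q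
    & child (par N i) i q = N].

Definition child_spec U := forall g i, free U g -> i != ty U ->
  [/\ wf (child U i g), ty (child U i g) = third i (ty U),
      par (child U i g) i = U & side (child U i g) i g].

Lemma parent_child U : wf U -> parent_spec U -> child_spec U.
Proof.
move=> wU pU g i fg iU; have [[q [b n]]|far] := near_or_far U i g; last first.
  rewrite child_far //; split=> //=; last by split=> //; rewrite mulVg.
  by split=> //; exists g.
rewrite (child_near wU n); have [/= s Ab b1 h] := n.
have [wV tV fq cq] := pU _ _ s; split=> //=.
- by split=> //; rewrite tV.
- split=> //; first by rewrite tV eq_sym third_neql.
  apply/eqP => e; case: fg => _; apply; left; exists i, q, b; split=> //.
Qed.

Lemma wf_parent N : wf N -> parent_spec N.
Proof.
elim: N => [//|T IH C i0|T IH g a] wN i q s.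
- case: (wN) => wT i0T [c [eC fc far]]; case: s => ei; rewrite {}ei /= eC => Aq.
  have fq : free T q by rewrite -(mulKVg c q); apply: (far_free wT i0T fc far Aq).
  have far' qb : ~ near T i0 q qb.
    by rewrite -(mulKVg c q) => /(nearM Aq) /far.
  split=> //; first by rewrite thirdK.
  (* The edge is stored as a predicate, so another representative of the coset gives an equal
     node. *)
  rewrite child_far //; congr Panel; apply/funext => h; apply/propext; split.
    by apply: A_trans.
  by apply: A_trans; apply: A_sym.
- have [wT fg Aa a1] := wN; have iT := side_neq wN s; rewrite /= in iT.
  have [wV tV pV sV] := parent_child wT (IH wT) fg iT.
  have -> : par (Tip T g a) i = child T i g by [].
  set V := child T i g in wV tV pV sV *.
  have [_ Ax ne] := s; set x := (g * a)^-1 * q in Ax.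
  have eq : q = g * a * x by rewrite mulKVg.
  clearbody x; have x1 : x != 1 by apply: contraNneq ne => x1; rewrite eq x1 mulg1.
  have ik : i != third i (ty T) by rewrite eq_sym third_neql.
  split=> //; last first.
    by rewrite (@child_near _ _ _ g a) ?pV //; split=> //=; [rewrite tV thirdK|rewrite eq mulKg].
  split.
    have iV : i != ty V by rewrite tV.
    have kV : ty T != ty V by rewrite tV eq_sym third_neqr.
    rewrite eq; apply: (residueM iV Ax); apply: (residueM kV Aa).
    exact: side_residue sV.
  (* If [q = g * a * x] were touched at [V], the lower edge responsible and the one through [g]
     would close a circuit of length at most 6 in the link. *)
  move=> [[j [q' [b [s' Ab e]]]]|ce]; last first.
    have [y [Ay y1 ey]] := center_side ce sV.
    have : a * x = y^-1.
      by apply: (mulgI g); rewrite mulgA -eq ey mulgK.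
    move=> eay; case/eqP: a1; apply: (A_disj iT); last exact: Aa.
    have -> : a = y^-1 * x^-1 by rewrite -eay mulgK.
    by apply: AM; apply: AV.
  have jV := side_neq wV s'; have [ij|ij] := eqVneq j i.
    rewrite {}ij in s' Ab; rewrite tV thirdK in Ab.
    have Az := side_coset wV sV s'.
    have : a * x = (g^-1 * q') * b.
      by apply: (mulgI g); rewrite mulgA -eq mulgA mulKVg.
    rewrite eq_sym in iT; case/(girth4 iT Aa Ax Az Ab) => /eqP; exact/negP.
  have [d [y [w [cd Ay Aw eg eq']]]] : exists d x y, [/\ center V d, A i x, A j y, g = d * x & q' = d * y].
    by apply: side_pair => //; rewrite eq_sym.
  have y1 : y != 1.
    have [y' [_ y1' ey']] := center_side cd sV.
    by apply: contraNneq y1' => y1; move: ey'; rewrite eg y1 => /mulgI <-.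
  have iV : i != ty V by rewrite tV.
  have ej : ty T = j by rewrite -(thirdK i (ty T)) -tV; apply/esym/third_uniq; rewrite // eq_sym.
  have ei : third j (ty V) = i by apply/esym/third_uniq.
  rewrite ei in Ab.
  have : y * a * x = w * b * 1.
    by apply: (mulgI d); rewrite mulg1 !mulgA -eg -eq -eq'.
  rewrite ej in iT Aa; case/(girth iT Ay Aa Ax Aw Ab (A1 j)) => /eqP; exact/negP.
Qed.

Lemma wf_child U g i : wf U -> free U g -> i != ty U ->
  [/\ wf (child U i g), ty (child U i g) = third i (ty U),
      par (child U i g) i = U & side (child U i g) i g].
Proof. by move=> wU fg iU; exact: (parent_child wU (wf_parent wU) fg iU). Qed.

Fixpoint lev N : nat :=
  match N with Base => 0 | Panel T _ _ => (lev T).+1 | Tip T _ _ => (lev T).+2 end.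

Lemma lev_par N i q : wf N -> side N i q -> lev N = (lev (par N i)).+1.
Proof.
elim: N i q => [//|//|T IH g a] i q wN s.
have [wT fg Aa a1] := wN; have iT : i != ty T by case: s.
have -> : par (Tip T g a) i = child T i g by [].
(* A near child lies two levels above [par T i], which is one level below [T]. *)
have [[q' [b n]]|far] := near_or_far T i g; last by rewrite child_far.
by rewrite (child_near wT n) /=; have [/= s' _ _ _] := n; rewrite (IH _ _ wT s').
Qed.

Lemma lev_child U i g : wf U -> free U g -> i != ty U -> lev (child U i g) = (lev U).+1.
Proof.
by move=> wU fg iU; have [wV _ pV sV] := wf_child wU fg iU; rewrite (lev_par wV sV) pV.
Qed.

(* [(U, g, a)] is the chamber [g * a]; the panel of cotype [ty U] that contains it
   has [(U, g, 1)] as its chamber of lowest level. *)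
Definition chamber := (node * G * G)%type.

Definition wfc (y : chamber) : Prop := [/\ wf y.1.1, free y.1.1 y.1.2 & A (ty y.1.1) y.2].

Definition place (y : chamber) : G := y.1.2 * y.2.

Definition node_of (y : chamber) (t : 'I_3) : node :=
  let: (U, g, a) := y in
  if t == ty U then (if a == 1 then U else Tip U g a) else child U (third t (ty U)) g.

Definition split_side N h (s : 'I_3 * G * G) : Prop :=
  [/\ side N s.1.1 s.1.2, A (third s.1.1 (ty N)) s.2 & h = s.1.2 * s.2].

Definition chamber_at N h : chamber :=
  if pselect (exists s, split_side N h s) is left ex
  then (par N (sval (cid ex)).1.1, (sval (cid ex)).1.2, (sval (cid ex)).2)
  else match N with
       | Tip T g a => if h == g * a then (T, g, a) else (N, h, 1)
       | _ => (N, h, 1)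
       end.

(** On the same side the edge groups involved meet trivially; on the two sides of a tip the center
    cancels and a circuit of length 4 remains. *)
Lemma side_split_uniq N i j q q' b b' : wf N -> side N i q -> side N j q' ->
  A (third i (ty N)) b -> A (third j (ty N)) b' -> q * b = q' * b' ->
  [/\ i = j, q = q' & b = b'].
Proof.
move=> wN s s' Ab Ab' e; have iN := side_neq wN s; have jN := side_neq wN s'.
have [ij|ij] := eqVneq i j.
  rewrite -{}ij in s' Ab' jN *; have Ax := side_coset wN s s'.
  have x1 : q^-1 * q' = 1.
    apply: (A_disj _ Ax); first by rewrite eq_sym; apply: third_neql iN.
    have -> : q^-1 * q' = b * b'^-1 by apply: (mulgI q); rewrite mulKVg mulgA e mulgK.
    by apply: AM => //; apply: AV.
  have eq : q = q' by rewrite -(mulKVg q q') x1 mulg1.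
  by split=> //; apply: (mulgI q); rewrite e eq.
have [d [x [y [cd Ax Ay eq eq']]]] := side_pair wN s s' ij.
have [x' [_ x1 ex]] := center_side cd s; have [y' [_ y1 ey]] := center_side cd s'.
move: ex ey e; rewrite eq eq' -!mulgA => /mulgI ex /mulgI ey /mulgI.
subst x' y'.
have eij : third i (ty N) = j by rewrite -(@third_uniq i j) // eq_sym.
have eji : third j (ty N) = i by rewrite -(@third_uniq j i) // eq_sym.
rewrite eij in Ab; rewrite eji in Ab' => e.
have e' : x * b = y * b' by [].
have [|b1] := girth4 ij Ax Ab Ay Ab' e'; first by move/eqP; rewrite (negPf x1).
have ji : j != i by rewrite eq_sym.
case: (girth4 ji Ay Ab' Ax Ab (esym e')) => [/eqP|b'1]; first by rewrite (negPf y1).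
case/eqP: x1; apply: (A_disj ij Ax).
by move: e'; rewrite b1 b'1 !mulg1 => ->.
Qed.

Lemma center_not_side N i q b : wf N -> side N i q -> A (third i (ty N)) b ->
  ~ center N (q * b).
Proof.
move=> wN s Ab cd; have iN := side_neq wN s; have [x [Ax x1 ex]] := center_side cd s.
have ni : i != third i (ty N) by rewrite eq_sym third_neql.
case/eqP: x1; apply: (A_disj ni Ax).
have -> : x = b^-1 by apply: (mulgI (q * b)); rewrite -ex mulgK.
exact: AV.
Qed.

Lemma chamber_at_side N i q b : wf N -> side N i q -> A (third i (ty N)) b ->
  chamber_at N (q * b) = (par N i, q, b).
Proof.
move=> wN s Ab; rewrite /chamber_at; case: pselect => [ex|]; last by case; exists (i, q, b).
case: (cid ex) => -[[j q'] b'] [/= s' Ab' e] /=.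
by have [-> -> ->] := side_split_uniq wN s s' Ab Ab' e.
Qed.

Lemma chamber_at_center T g a : wf (Tip T g a) -> chamber_at (Tip T g a) (g * a) = (T, g, a).
Proof.
move=> wN; rewrite /chamber_at; case: pselect => [ex|_]; last by rewrite eqxx.
case: (ex) => -[[i q] b] [/= s Ab e].
by case: (center_not_side wN s Ab); rewrite /= e.
Qed.

Lemma chamber_at_free N h : free N h -> chamber_at N h = (N, h, 1).
Proof.
move=> [_ nt]; rewrite /chamber_at; case: pselect => [ex|_].
  by case: ex nt => -[[i q] b] /= s []; left; exists i, q, b.
by case: N nt => // T g a nt; case: eqP => // e; case: nt; right.
Qed.

Variant place_spec N h : Prop :=
  | AtSide i q b of side N i q & A (third i (ty N)) b & h = q * b
  | AtCenter T g a of N = Tip T g a & h = g * a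
  | AtFree of free N h.

Lemma placeP N h : residue N h -> place_spec N h.
Proof.
move=> rh; have [[[i [q [b [s Ab e]]]]|]|nt] := pselect (touched N h).
- exact: AtSide s Ab e.
- by case: N rh => //= T g a _ e; apply: (AtCenter (N := Tip T g a) erefl e).
- by apply: AtFree.
Qed.

Lemma chamber_atP N h : wf N -> residue N h ->
  [/\ wfc (chamber_at N h), place (chamber_at N h) = h & node_of (chamber_at N h) (ty N) = N].
Proof.
move=> wN rh; case: (placeP rh) => [i q b s Ab e|T g a eN e|fh].
- rewrite e (chamber_at_side wN s Ab); have iN := side_neq wN s.
  have [wV tV fq cq] := wf_parent wN s; split=> //; first by split=> //; rewrite tV.
  rewrite /node_of /= tV eq_sym (negPf (third_neqr iN)).
  by rewrite thirdKr.
- rewrite e eN in wN *; rewrite chamber_at_center //; have [wT fg Aa a1] := wN.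
  by split=> //; rewrite /node_of /= eqxx (negPf a1).
- rewrite chamber_at_free //; split; first by split.
    by rewrite /place mulg1.
  by rewrite /node_of !eqxx.
Qed.

Lemma node_ofP y t : wfc y ->
  [/\ wf (node_of y t), ty (node_of y t) = t, residue (node_of y t) (place y)
    & chamber_at (node_of y t) (place y) = y].
Proof.
case: y => [[U g] a] [/= wU fg Aa]; rewrite /place /=.
case: eqP => [->|/eqP tU].
  case: eqP => [->|/eqP a1]; first by rewrite mulg1 chamber_at_free //; case: fg.
  have wN : wf (Tip U g a) by [].
  rewrite chamber_at_center //; split=> //=.
  have [i +] := other_index (ty U); rewrite eq_sym => iU.
  by rewrite mulVg; apply: (AX iU); apply: A1.
have iU : third t (ty U) != ty U by rewrite third_neqr.
have [wV tV pV sV] := wf_child wU fg iU.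
have tV' : ty (child U (third t (ty U)) g) = t by rewrite tV thirdKl.
have e3 : third (third t (ty U)) (ty (child U (third t (ty U)) g)) = ty U.
  by rewrite tV' thirdC thirdK.
split=> //.
  apply: (@residueM _ (ty U)) => //; first by rewrite tV' eq_sym.
  exact: side_residue sV.
by rewrite (chamber_at_side wV sV) ?e3 // pV.
Qed.

(** By [chamber_atP] and [node_ofP] a chamber amounts to its vertex of type [k] together with an
    element of the residue there; [X k] moves the second and keeps the first. *)
Definition act (k : 'I_3) (y : chamber) (x : G) : chamber := chamber_at (node_of y k) (place y * x).

Lemma residueX N h x : X (ty N) x -> residue N h -> residue N (h * x).
Proof.
case: N => [|T C i|T g a] /= Xx.
- by move=> Xh; apply: XM.
- by move=> [c Cc Xc]; exists c => //; rewrite mulgA; apply: XM.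
- by move=> Xc; rewrite mulgA; apply: XM.
Qed.

Lemma actP k y x : wfc y -> X k x ->
  [/\ wfc (act k y x), place (act k y x) = place y * x & node_of (act k y x) k = node_of y k].
Proof.
move=> wy Xx; have [wN tN rN cN] := node_ofP k wy.
have rN' : residue (node_of y k) (place y * x) by apply: residueX; rewrite ?tN.
by have [h1 h2 h3] := chamber_atP wN rN'; split=> //; rewrite -[RHS]h3 tN.
Qed.

Lemma act1 k y : wfc y -> act k y 1 = y.
Proof. by move=> wy; have [_ _ _ cN] := node_ofP k wy; rewrite /act mulg1. Qed.

Lemma actM k y x x' : wfc y -> X k x -> act k (act k y x) x' = act k y (x * x').
Proof. by move=> wy Xx; have [_ p n] := actP wy Xx; rewrite /act n p mulgA. Qed.

Lemma act_panel k i y a : wfc y -> i != k -> A i a -> i = ty y.1.1 ->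
  act k y a = (y.1.1, y.1.2, y.2 * a).
Proof.
case: y => [[U g] b] [/= wU fg Ab] ik Aa ei; rewrite /act /node_of.
rewrite eq_sym -ei (negPf ik) /place /= -mulgA ei.
have iU : third k (ty U) != ty U by rewrite third_neqr // -ei eq_sym.
have [wV tV pV sV] := wf_child wU fg iU.
have e3 : third (third k (ty U)) (ty (child U (third k (ty U)) g)) = ty U.
  by rewrite tV thirdK.
rewrite (chamber_at_side wV sV) ?e3 ?pV //; apply: AM => //; by rewrite -ei.
Qed.

(** The case of [act_agree] that needs the geometry: the edge of cotype [i] has [U], or the tip over
    it if [b] is not 1, as one end, and its two ends describe the moved chamber by different
    nodes. *)
Lemma act_agree_low U g b i a : wfc (U, g, b) -> i != ty U -> A i a ->
  act (ty U) (U, g, b) a = act (third i (ty U)) (U, g, b) a.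
Proof.
move=> wy iU Aa; have [a1|a1] := eqVneq a 1; first by rewrite a1 !act1.
have [/= wU fg Ab] := wy; rewrite /act /node_of eqxx (negPf (third_neqr iU)).
have -> : third (third i (ty U)) (ty U) = i by rewrite thirdKl.
have [wV tV pV sV] := wf_child wU fg iU; rewrite /place /=.
have [b1|b1] := eqVneq b 1; last first.
  have wN : wf (Tip U g b) by [].
  have s : side (Tip U g b) i (g * b * a) by apply: centerM.
  have [_ _ fr _] := wf_parent wN s.
  rewrite -[X in chamber_at (Tip _ _ _) X]mulg1 (chamber_at_side wN s) //.
  by rewrite chamber_at_free.
rewrite b1 mulg1; have [s|ce] := sideM wV sV Aa.
  have [_ _ fr _] := wf_parent wV s; rewrite pV in fr.
  by rewrite -[X in _ = chamber_at _ X]mulg1 (chamber_at_side wV s) // pV chamber_at_free.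
(* Here the moved chamber is the center of the tip [V] and a touched chamber of [U]. *)
have [[q [b' n]]|far] := near_or_far U i g; last by move: ce; rewrite child_far.
move: ce wV; rewrite (child_near wU n) => /= -> wV.
by have [/= sq Ab' _ _] := n; rewrite chamber_at_center // (chamber_at_side wU sq Ab').
Qed.

Lemma act_agree i k k' y a : wfc y -> i != k -> i != k' -> A i a -> act k y a = act k' y a.
Proof.
move=> wy ik ik' Aa; have [->//|kk'] := eqVneq k k'.
have [ei|ni] := eqVneq i (ty y.1.1).
  by rewrite (act_panel wy ik) // (act_panel wy ik').
case: y wy ni => [[U g] b] wy /= ni.
have low t : i != t -> t != ty U -> t = third i (ty U).
  by move=> it tU; apply: third_uniq.
have [e|n] := eqVneq k (ty U); have [e'|n'] := eqVneq k' (ty U).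
- by rewrite e e'.
- by rewrite (low k') // e; apply: act_agree_low.
- by rewrite (low k) // e'; apply/esym/act_agree_low.
- by rewrite (low k) // (low k').
Qed.

Section Unfolding.
Variable F : G -> chamber.
Hypothesis F_1 : F 1 = (Base, 1, 1).
Hypothesis F_X : forall g k x, X k x -> F (g * x) = act k (F g) x.

Lemma F_place g : wfc (F g) /\ place (F g) = g.
Proof.
elim/generation: g => [|g k x [wy py] Xx].
  rewrite F_1 /place /= mulg1; split=> //; split=> //=.
  split=> /=; last by case=> [[i [q [b []]]]|].
  have [i +] := other_index k0; rewrite eq_sym => ik.
  by apply: (AX ik).
by rewrite (F_X _ Xx); have [h1 h2 _] := actP wy Xx; rewrite h2 py.
Qed.

Lemma wfF g : wfc (F g). Proof. by have [] := F_place g. Qed.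
Lemma placeF g : place (F g) = g. Proof. by have [] := F_place g. Qed.

Definition nd (t : 'I_3) g := node_of (F g) t.

Lemma ndP t g : [/\ wf (nd t g), ty (nd t g) = t & residue (nd t g) g].
Proof. by have [h1 h2 h3 _] := node_ofP t (wfF g); rewrite placeF in h3. Qed.

Lemma ndX t g x : X t x -> nd t (g * x) = nd t g.
Proof. by move=> Xx; rewrite /nd (F_X _ Xx); have [_ _ ->] := actP (wfF g) Xx. Qed.

Lemma residue_coset N g h : wf N -> residue N g -> residue N h -> X (ty N) (g^-1 * h).
Proof.
have tr k d x y : X k (d^-1 * x) -> X k (d^-1 * y) -> X k (x^-1 * y).
  by move=> /XV h1 h2; have := XM h1 h2; rewrite invMg invgK -mulgA mulKVg.
case: N => [|T C i|T a b] /=.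
- by move=> _ /XV h1 h2; apply: XM.
- move=> [_ iT [c [-> _ _]]] [d Ad Xd] [e Ae Xe]; apply: (tr _ c).
    by have := XM (AX _ Ad) Xd; rewrite -mulgA mulKVg; apply; rewrite eq_sym third_neql.
  by have := XM (AX _ Ae) Xe; rewrite -mulgA mulKVg; apply; rewrite eq_sym third_neql.
- by move=> _; apply: tr.
Qed.

Lemma nd_inj t g h : nd t g = nd t h -> X t (g^-1 * h).
Proof.
move=> e; have [w1 t1 r1] := ndP t g; have [w2 t2 r2] := ndP t h.
by rewrite -{1}t1; apply: residue_coset => //; rewrite e.
Qed.

Lemma has_side N : wf N -> N <> Base -> exists i q, side N i q.
Proof.
case: N => [//|T C i|T g a] /= wN _.
- by case: wN => _ _ [c [-> _ _]]; exists i, c; split=> //; rewrite mulVg.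
- have [i +] := other_index (ty T); rewrite eq_sym => iT.
  have [x Ax x1] := A_nontrivial i; exists i, (g * a * x).
  by apply: (@centerM (Tip T g a)).
Qed.

(** By induction on the level, since a side of [N] belongs to a lower vertex as well. So labels
    determine chambers, and the unfolding is the complex of cosets itself. *)
Lemma F_residue N h : wf N -> residue N h -> F h = chamber_at N h.
Proof.
have [n] := ubnP (lev N); elim: n => // n IH in N h *; rewrite ltnS => lN wN rh.
have [eN|neN] := pselect (N = Base).
  rewrite eN /= in rh *; rewrite -{1}(mul1g h) (F_X _ rh) F_1 /act /place /node_of /=.
  by rewrite !eqxx !mul1g.
have [i [q s]] := has_side wN neN; have iN := side_neq wN s.
have [wV tV fq cq] := wf_parent wN s.
have Fq : F q = (par N i, q, 1).
  rewrite (IH (par N i)) ?chamber_at_free //; last by case: fq.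
  by rewrite -(lev_par wN s).
rewrite -(mulKVg q h) (@F_X _ (ty N)); last first.
  by apply: residue_coset => //; apply: side_residue s.
by rewrite Fq /act /node_of tV eq_sym (negPf (third_neqr iN)) thirdKr cq /place /= mulg1.
Qed.

Lemma F_chamber y : wfc y -> F (place y) = y.
Proof.
move=> wy; have [wN tN rN cN] := node_ofP k0 wy.
by rewrite (F_residue wN rN).
Qed.

Definition level (u : 'I_3 * G) := lev (nd u.1 u.2).

Lemma nd_chamber u c : X u.1 (u.2^-1 * c) -> nd u.1 u.2 = nd u.1 c.
Proof. by move=> Xc; rewrite -[in RHS](mulKVg u.2 c) ndX. Qed.

Lemma lev_nd g : exists U h a, [/\ F g = (U, h, a), wf U, free U h &
   forall t, lev (nd t g) = if t == ty U then (if a == 1 then lev U else (lev U).+2) else (lev U).+1].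
Proof.
case e: (F g) (wfF g) => [[U h] a] [/= wU fU Aa]; exists U, h, a; split=> // t.
rewrite /nd e /node_of; case: eqP => [_|/eqP tU]; first by case: eqP.
by rewrite lev_child // third_neqr.
Qed.

Lemma level_coset u v : same u v -> level u = level v.
Proof. by move=> [e Xuv]; rewrite /level (nd_chamber Xuv) e. Qed.

Lemma level_step u v : joined u v -> level v <= (level u).+1.
Proof.
move=> [c [uc vc]]; rewrite /level (nd_chamber uc) (nd_chamber vc).
have [U [h [a [_ _ _ L]]]] := lev_nd c; rewrite !L.
by case: (v.1 == _); case: (u.1 == _); case: (a == 1); lia.
Qed.

Lemma level_zero v : level v = 0 -> same (k0, 1) v.
Proof.
rewrite /level => l0; have [wN tN rN] := ndP v.1 v.2.
have eN : nd v.1 v.2 = Base by move: l0; case: (nd _ _).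
by rewrite eN /= in tN rN; split=> //=; rewrite invg1 mul1g.
Qed.

Lemma level_origin : level (k0, 1) = 0.
Proof. by rewrite /level /nd F_1 /node_of !eqxx. Qed.

Lemma level_descent v : 0 < level v -> exists2 u, joined u v & (level u).+1 = level v.
Proof.
rewrite /level => l0; have [wN tN rN] := ndP v.1 v.2; set N := nd v.1 v.2 in wN tN rN l0 *.
have neN : N <> Base by move=> e; rewrite e in l0.
have [i [q s]] := has_side wN neN; have [wV tV fq cq] := wf_parent wN s.
exists (third i v.1, q).
  exists q; split; rewrite /= ?mulVg; last first.
    by rewrite -tN; apply: residue_coset => //; apply: side_residue s.
  have iN := side_neq wN s.
  by apply: (@AX i); rewrite // eq_sym third_neql // -tN.
rewrite /= (lev_par wN s) /nd -(mulg1 q).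
have -> : F (q * 1) = (par N i, q, 1) by apply: (@F_chamber (par N i, q, 1)).
by rewrite /node_of tV tN !eqxx.
Qed.

Lemma lower_is_parent t t' c : (lev (nd t' c)).+1 = lev (nd t c) ->
  exists i, (exists q, side (nd t c) i q) /\ nd t' c = par (nd t c) i.
Proof.
have [U [h [a [e wU fh L]]]] := lev_nd c; rewrite !L.
have [_ _ Aa] := wfF c; rewrite e /= in Aa.
case: (eqVneq t' (ty U)) => [t'U|t'U]; case: (eqVneq t (ty U)) => [tU|tU].
- by case: ifP => _; lia.
- case: (eqVneq a 1) => [a1 _|_]; last by lia.
  have iU : third t (ty U) != ty U by rewrite third_neqr.
  have [wV tV pV sV] := wf_child wU fh iU.
  exists (third t (ty U)); rewrite /nd e /node_of (negPf tU) -t'U eqxx a1 eqxx t'U pV.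
  by split=> //; exists h.
- case: (eqVneq a 1) => [_|a1 _]; first by lia.
  have wN : wf (Tip U h a) by [].
  exists (third t' (ty U)); rewrite /nd e /node_of (negPf t'U) -tU eqxx (negPf a1) tU.
  split=> //; have [x Ax x1] := A_nontrivial (third t' (ty U)).
  by exists (h * a * x); apply: centerM => //=; rewrite third_neqr.
- by lia.
Qed.

Lemma F_free U h : wf U -> free U h -> F h = (U, h, 1).
Proof.
by move=> wU fh; rewrite -{1}(mulg1 h); apply: (@F_chamber (U, h, 1)).
Qed.

(** Two different sides exist only at a tip. The two lower neighbours are then the upper vertices of
    the free chamber [g] of [T], and this chamber joins them. *)
Lemma lower_neighbors_joined u u' v : joined u v -> joined u' v ->
  (level u).+1 = level v -> (level u').+1 = level v -> joined u u'.
Proof.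
move=> [c [uc vc]] [c' [uc' vc']]; rewrite /level (nd_chamber uc) (nd_chamber uc').
move=> e e'; have ec : nd v.1 v.2 = nd v.1 c by exact: nd_chamber.
have ec' : nd v.1 v.2 = nd v.1 c' by exact: nd_chamber.
rewrite ec in e; rewrite ec' in e'.
have [i [[q s] p]] := lower_is_parent e; have [j [[q' s'] p']] := lower_is_parent e'.
rewrite -ec in s p; rewrite -ec' in s' p'; have [wN tN rN] := ndP v.1 v.2.
set N := nd v.1 v.2 in wN tN rN s s' p p'.
have [_ tu _] := ndP u.1 c; have [_ tu' _] := ndP u'.1 c'.
have joint g : nd u.1 g = par N i -> nd u'.1 g = par N j -> joined u u'.
  move=> h1 h2; exists g; split; apply: nd_inj; rewrite ?h1 ?h2.
    by rewrite (nd_chamber uc).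
  by rewrite (nd_chamber uc').
have [ij|ij] := eqVneq i j.
  apply: (joint c); first by [].
  by rewrite -{}ij in p' *; have -> : u'.1 = u.1 by rewrite -tu' p' -p tu.
have [d [x [y [cd Ax Ay _ _]]]] := side_pair wN s s' ij.
have iN := side_neq wN s; have jN := side_neq wN s'.
have [_ ti _ _] := wf_parent wN s; have [_ tj _ _] := wf_parent wN s'.
move: wN iN jN p p' joint ti tj cd {rN tN s s'}; case: N => // T g a wN iN jN p p' joint ti tj _.
rewrite p in tu; rewrite p' in tu'; rewrite tu in ti; rewrite tu' in tj.
have [wT fg _ _] := wN; rewrite /= in iN jN ti tj.
apply: (joint g); rewrite /nd (F_free wT fg) /node_of ?ti ?tj (negPf (third_neqr _)) //.
  by rewrite thirdKl.
by rewrite thirdKl.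
Qed.

(** The levels in a chamber, computed in [lev_nd], show that a flat edge faces the lowest vertex [U]
    of the first chamber [h] on it; there [U] is a common lower neighbour. *)
Lemma flat_edge_lower v v' : joined v v' -> ~ same v v' -> level v = level v' ->
  exists U h, [/\ wf U, free U h, v.1 != ty U, v'.1 != ty U & v.1 != v'.1] /\
    [/\ nd v.1 v.2 = child U (third v.1 (ty U)) h,
        nd v'.1 v'.2 = child U (third v'.1 (ty U)) h,
        joined (ty U, h) v, joined (ty U, h) v' & (level (ty U, h)).+1 = level v].
Proof.
move=> [c [vc vc']] ns el; rewrite /level (nd_chamber vc) (nd_chamber vc') in el.
have [U [h [a [e wU fh L]]]] := lev_nd c.
have nv : v.1 != v'.1.
  apply/eqP => e1; apply: ns; split=> //; rewrite -e1 in vc'.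
  by have := XM vc (XV vc'); rewrite invMg invgK -mulgA mulKVg.
rewrite !L in el.
have vU : v.1 != ty U.
  apply: contraNneq nv => vU; move: el; rewrite vU eqxx.
  by case: (eqVneq v'.1 (ty U)) => // _; case: (a == 1); lia.
have vU' : v'.1 != ty U.
  by apply/eqP => vU'; move: el; rewrite vU' eqxx (negPf vU); case: (a == 1); lia.
have ev : nd v.1 c = child U (third v.1 (ty U)) h by rewrite /nd e /node_of (negPf vU).
have ev' : nd v'.1 c = child U (third v'.1 (ty U)) h by rewrite /nd e /node_of (negPf vU').
have ev1 : nd v.1 h = nd v.1 v.2.
  by rewrite (nd_chamber vc) ev /nd (F_free wU fh) /node_of (negPf vU).
have ev1' : nd v'.1 h = nd v'.1 v'.2.
  by rewrite (nd_chamber vc') ev' /nd (F_free wU fh) /node_of (negPf vU').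
have Xh : X (ty U) (h^-1 * h).
  by rewrite mulVg; apply: (AX (third_neqr vU)).
exists U, h; split=> //; split.
- by rewrite (nd_chamber vc).
- by rewrite (nd_chamber vc').
- by exists h; split=> //; apply: nd_inj.
- by exists h; split=> //; apply: nd_inj.
- by rewrite /level (nd_chamber vc) /= ev lev_child ?third_neqr // /nd (F_free wU fh) /node_of !eqxx.
Qed.

Lemma two_lower_tip u u' v : joined u v -> joined u' v ->
  (level u).+1 = level v -> (level u').+1 = level v -> ~ same u' u ->
  exists T g a, nd v.1 v.2 = Tip T g a.
Proof.
move=> [c [uc vc]] [c' [uc' vc']]; rewrite /level (nd_chamber uc) (nd_chamber uc').
move=> e e'; have ec : nd v.1 v.2 = nd v.1 c by exact: nd_chamber.
have ec' : nd v.1 v.2 = nd v.1 c' by exact: nd_chamber.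
rewrite ec in e; rewrite ec' in e'.
have [i [[q s] p]] := lower_is_parent e; have [j [[q' s'] p']] := lower_is_parent e'.
rewrite -ec in s p; rewrite -ec' in s' p' => ns; case eN: (nd v.1 v.2) => [|T C k|T g a].
- by rewrite eN in s.
- case: ns; rewrite eN /= in p p'; have [_ tu _] := ndP u.1 c; have [_ tu' _] := ndP u'.1 c'.
  have eu : u'.1 = u.1 by rewrite -tu' p' -p tu.
  split=> //; apply: nd_inj; rewrite (nd_chamber uc') p' -p eu; apply/esym.
  exact: nd_chamber.
- by exists T, g, a.
Qed.

(** If both ends were tips, both edges at [U] of the free chamber [h] would be near, on different
    sides of [U]. Then [U] is itself a tip, and the two routes from its center to [h] close a
    circuit of length 6 in the link. *)
Lemma not_both_tips v v' u u0 u2 : joined v v' -> ~ same v v' -> level v = level v' ->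
  joined u v -> joined u v' -> joined u0 v -> joined u2 v' ->
  (level u).+1 = level v -> (level u0).+1 = level v -> (level u2).+1 = level v ->
  same u0 u \/ same u2 u.
Proof.
move=> jv ns el ju ju' j0 j2 l l0 l2.
have [|n0] := pselect (same u0 u); first by left.
have [|n2] := pselect (same u2 u); first by right.
have [T [g [a e]]] := two_lower_tip ju j0 l l0 n0.
rewrite el in l l2; have [T' [g' [a' e']]] := two_lower_tip ju' j2 l l2 n2.
have [U [h [[wU fh vU vU' nv] [cv cv' _ _ _]]]] := flat_edge_lower jv ns el.
rewrite e in cv; rewrite e' in cv'.
set i := third v.1 (ty U) in cv; set j := third v'.1 (ty U) in cv'.
have iU : i != ty U by rewrite third_neqr.
have jU : j != ty U by rewrite third_neqr.
have ij : i != j by apply: contraNneq nv => ij; rewrite -(thirdKl v.1 (ty U)) -/i ij thirdKl.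
have [[q [b n]]|far] := near_or_far U i h; last by move: cv; rewrite child_far.
have [[q' [b' n']]|far] := near_or_far U j h; last by move: cv'; rewrite child_far.
have [/= s Ab b1 h1] := n; have [/= s' Ab' b1' h1'] := n'.
have eij : third i (ty U) = j by apply/esym/third_uniq.
have eji : third j (ty U) = i by apply/esym/third_uniq; rewrite // eq_sym.
rewrite eij in Ab; rewrite eji in Ab'.
have [d [x [y [cd Ax Ay eq eq']]]] := side_pair wU s s' ij.
have [x' [_ x1 ex]] := center_side cd s; have {ex} ex : x = x' by move: ex; rewrite eq => /mulgI.
subst x'; set z := (q * b)^-1 * h in h1; set z' := (q' * b')^-1 * h in h1'.
have eh : h = q * b * z by rewrite mulKVg.
have eh' : h = q' * b' * z' by rewrite mulKVg.
clearbody z z'; have z1 : z <> 1.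
  move=> z1; case: fh => _; apply; left; exists i, q, b; rewrite eij; split=> //.
  by rewrite eh z1 mulg1.
have : x * b * z = y * b' * z'.
  by apply: (mulgI d); rewrite !mulgA -eq -eq' -eh.
by case/(girth ij Ax Ab h1 Ay Ab' h1') => // /eqP; [rewrite (negPf x1)|rewrite (negPf b1)].
Qed.

Lemma level_functionP : level_function X k0 level.
Proof.
split; [exact: level_coset|exact: level_step|exact: level_zero|exact: level_origin|exact: level_descent|
        exact: lower_neighbors_joined| |exact: not_both_tips].
move=> v v' jv ns el; have [U [h [_ [_ _ h1 h2 h3]]]] := flat_edge_lower jv ns el.
by exists (ty U, h).
Qed.
End Unfolding.

Lemma exists_level : exists level, level_function X k0 level.
Proof.
have w0 : wfc (Base, 1, 1).
  split=> //=; split=> /=; last by case=> [[i [q [b []]]]|].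
  have [i +] := other_index k0; rewrite eq_sym => ik.
  by apply: (AX ik).
(* By the universal property the group acts on well-formed chambers; [F] is the orbit map of the
   base chamber. *)
have [F [F1 FX]] := tri_action tri (fun k y x wy Xx => let: And3 w _ _ := actP wy Xx in w)
  act1 (fun k y x x' wy Xx _ => actM x' wy Xx) act_agree w0.
by exists (level F); apply: level_functionP.
Qed.
End Development.

(** * The graph of cosets and the word metric *)

Section Distance.
Local Open Scope group_scope.
Variables (G : groupType) (A X : 'I_3 -> G -> Prop).
Hypothesis tri : triangle_of_groups A X.
Let XM := tri_XM tri.
Let XV := tri_XV tri.
Local Notation vertex := ('I_3 * G)%type.
Local Notation same := (same_vertex X).
Local Notation joined := (joined X).
Implicit Types u v w : vertex.

Lemma X1 k : X k 1.
Proof.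
have [i +] := other_index k; rewrite eq_sym => ik.
exact: (tri_AX tri ik (tri_A1 tri i)).
Qed.

Lemma X_shift k (x y z : G) : X k (x^-1 * y) -> X k (y^-1 * z) -> X k (x^-1 * z).
Proof. by move=> h1 h2; have := XM h1 h2; rewrite -mulgA mulKVg. Qed.

Lemma X_flip k (x y : G) : X k (x^-1 * y) -> X k (y^-1 * x).
Proof. by move=> /XV; rewrite invMg invgK. Qed.

Lemma same_refl u : same u u. Proof. by split=> //; rewrite mulVg; apply: X1. Qed.

Lemma same_sym u v : same u v -> same v u.
Proof. by case=> e h; split=> //; rewrite -e; apply: X_flip. Qed.

Lemma same_joinedl u v w : same u v -> joined v w -> joined u w.
Proof. by move=> [e h] [c [h1 h2]]; exists c; split=> //; apply: X_shift h _; rewrite e. Qed.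

Lemma joined_sym u v : joined u v -> joined v u.
Proof. by case=> c [h1 h2]; exists c. Qed.

Lemma joined_refl u : joined u u.
Proof. by exists u.2; rewrite mulVg; split; apply: X1. Qed.

(** As [joined] is reflexive a walk may pause, so this expresses distance at most [n]. *)
Fixpoint walk n u v : Prop :=
  if n is m.+1 then exists2 w, joined u w & walk m w v else same u v.

Lemma same_walk n u v w : same u v -> walk n v w -> walk n u w.
Proof.
case: n => [|n] /= s.
  by move: s => [e h] [e' h']; split; [rewrite e|apply: X_shift h _; rewrite e].
by case=> x j ww; exists x => //; apply: same_joinedl j.
Qed.

Lemma walk_cat m n u v w : walk m u v -> walk n v w -> walk (m + n) u w.
Proof.
elim: m u => [|m IH] u /=; first exact: same_walk.
by case=> x j h1 h2; exists x => //; apply: IH.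
Qed.

Lemma joined_walk u v : joined u v -> walk 1 u v.
Proof. by move=> j; exists v => //; apply: same_refl. Qed.

Lemma walk_rev n u v : walk n u v -> walk n v u.
Proof.
elim: n u => [|n IH] u /=; first exact: same_sym.
by case=> x j /IH h; have := walk_cat h (joined_walk (joined_sym j)); rewrite addn1.
Qed.

Lemma walk_leq m n u v : m <= n -> walk m u v -> walk n u v.
Proof.
move=> /subnK <-; elim: (n - m)%N => [//|k IH] h; rewrite addSn.
by exists u; [exact: joined_refl|exact: IH].
Qed.

Definition shift (g : G) u : vertex := (u.1, g * u.2).

Lemma same_shift g u v : same u v <-> same (shift g u) (shift g v).
Proof. by rewrite /same_vertex /= invMg -mulgA mulKg. Qed.

Lemma joined_shift g u v : joined u v -> joined (shift g u) (shift g v).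
Proof. by case=> c h; exists (g * c); rewrite /= !invMg -!mulgA !mulKg. Qed.

Lemma walk_shift g n u v : walk n u v -> walk n (shift g u) (shift g v).
Proof.
elim: n u => [|n IH] u /=; first by move/(same_shift g).
by case=> x j /IH h; exists (shift g x) => //; apply: joined_shift.
Qed.

(** Levels are available only from base vertices [(k, 1)]; translation by [u.2^-1] brings [u] there.
    The choice of the level function is immaterial by [distP]. *)
Definition dist u v : nat := sval (cid (exists_level tri u.1)) (shift u.2^-1 v).

Lemma dist_level o : exists2 lv, level_function X o.1 lv & forall v, dist o v = lv (shift o.2^-1 v).
Proof. by rewrite /dist; case: cid => lv h; exists lv. Qed.

Lemma distP n u v : dist u v <= n <-> walk n u v.
Proof.
have [lv L e] := dist_level u; rewrite e.
have wsh m : walk m (u.1, 1) (shift u.2^-1 v) -> walk m u v.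
  move=> /(walk_shift u.2); rewrite /shift /= mulg1 mulKVg.
  by case: (u) (v) => ? ? [].
split=> [le_n|w].
- apply: (walk_leq le_n); apply: wsh; move: (erefl (lv (shift u.2^-1 v))).
  move: {2 3}(lv _) => m; elim: m (shift _ v) => [|m IH] w lw; first exact: (level0 L).
  have [|x jx lx] := level_down L (v := w); first by rewrite lw.
  have {}IH : walk m (u.1, 1) x by apply: IH; apply/eqP; rewrite -eqSS lx lw.
  by have := walk_cat IH (joined_walk jx); rewrite addn1.
- have : lv (shift u.2^-1 v) <= lv (shift u.2^-1 u) + n.
    suff lip m a b : walk m a b -> lv b <= lv a + m by apply: lip (walk_shift _ w).
    elim: m a => [|m IH] a /=; first by move/(level_same L) => ->; rewrite addn0.
    by case=> x /(level_lip L) h1 /IH h2; lia.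
  have -> : shift u.2^-1 u = (u.1, 1) by rewrite /shift mulVg.
  by rewrite (level_base L).
Qed.

Lemma dist_tri u v w : dist u w <= dist u v + dist v w.
Proof. by apply/distP; apply: walk_cat; apply/distP. Qed.

Lemma distC u v : dist u v = dist v u.
Proof.
by apply/eqP; rewrite eqn_leq; apply/andP; split; apply/distP; apply: walk_rev; apply/distP.
Qed.

Lemma dist_same u v : dist u v = 0 <-> same u v.
Proof.
split=> [e|s]; first by have : walk 0 u v by apply/distP; rewrite e.
by apply/eqP; rewrite -leqn0; apply/distP.
Qed.

Lemma dist_joined u v : dist u v <= 1 <-> joined u v.
Proof.
split=> [/distP [w j s]|j]; last by apply/distP; apply: joined_walk.
by apply: joined_sym; apply: same_joinedl (same_sym s) (joined_sym j).
Qed.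

Lemma dist_geodesic u v : exists z : nat -> vertex,
  [/\ geodesic dist z (dist u v), z 0 = u & dist (z (dist u v)) v = 0].
Proof.
have [z [zj z0 zn]] : exists z : nat -> vertex, [/\ forall i, i < dist u v ->
    joined (z i) (z i.+1), z 0 = u & same (z (dist u v)) v].
  have := (distP (dist u v) u v).1 (leqnn _); move: (dist u v) => n.
  elim: n u => [|n IH] u /=; first by move=> s; exists (fun=> u).
  case=> w j /IH[z [zj z0 zn]]; exists (fun i => if i is k.+1 then z k else u).
  by split=> // -[|i] h; [rewrite z0|apply: zj].
exists z; split=> //; last by apply/dist_same.
set L := dist u v in zj zn *.
have up i k : i + k <= L -> dist (z i) (z (i + k)) <= k.
  elim: k => [|k IH] h; first by rewrite addn0 leqn0; apply/eqP/dist_same/same_refl.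
  have := dist_tri (z i) (z (i + k)) (z (i + k.+1)).
  have h1 : dist (z (i + k)) (z (i + k.+1)) <= 1.
    by rewrite addnS; apply/dist_joined; apply: zj; lia.
  by have := IH ltac:(lia); lia.
move=> i j ij; have zL : dist (z L) v = 0 by apply/dist_same.
have := up 0 i; have := up i (j - i); have := up j (L - j).
rewrite !add0n !subnKC; try lia.
have := dist_tri u (z i) v; have := dist_tri (z i) (z j) v; have := dist_tri (z j) (z L) v.
by rewrite z0 -/L zL; lia.
Qed.

Lemma dist_four_point o x y w :
  dist x o + dist y o + dist x w <= dist x o + dist w o + dist x y + 15 \/
  dist y o + dist w o + dist x w <= dist x o + dist w o + dist y w + 15.
Proof.
have jn u v : dist u v = 1%N -> joined u v /\ ~ same u v.
  move=> e; split; first by apply/dist_joined; rewrite e.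
  by move/dist_same; rewrite e.
apply: (four_point (d := dist)) => {x y w o}.
- exact: distC.
- exact: dist_tri.
- move=> o v u u' /jn[ju _] /jn[ju' _]; have [lv L e] := dist_level o; rewrite !e => l l'.
  apply/dist_joined; have := lower_joined L (joined_shift _ ju) (joined_shift _ ju') l l'.
  by move/(joined_shift o.2); rewrite /shift !mulKVg; case: (u) (u') => ? ? [].
- move=> o v v' /jn[jv ns]; have [lv L e] := dist_level o; rewrite !e => l.
  have [|u [h1 h2 h3]] := flat_lower L (joined_shift o.2^-1 jv) _ l.
    by move=> /(same_shift o.2^-1 v v').2.
  exists (shift o.2 u); rewrite e.
  have eu : shift o.2^-1 (shift o.2 u) = u by rewrite /shift mulKg; case: (u).
  have ev t : shift o.2 (shift o.2^-1 t) = t by rewrite /shift mulKVg; case: (t).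
  have d1 t : joined (shift o.2 u) t -> lv (shift o.2^-1 t) = (lv u).+1 -> dist (shift o.2 u) t = 1%N.
    move=> /dist_joined; rewrite leq_eqVlt ltnS leqn0 => /orP[/eqP//|/eqP/dist_same].
    by move=> /(same_shift o.2^-1); rewrite eu => /(level_same L) -> /n_Sn.
  split; last by rewrite eu.
    by apply: d1 => //; rewrite -(ev v); apply: joined_shift.
  by apply: d1; rewrite -?l // -(ev v'); apply: joined_shift.
- move=> o v v' u u0 u2 /jn[jv ns] + /jn[ju _] /jn[ju' _] /jn[j0 _] /jn[j2 _].
  have [lv L e] := dist_level o; rewrite !e => l h1 h2 h3.
  have ns' : ~ same (shift o.2^-1 v) (shift o.2^-1 v') by move=> /(same_shift o.2^-1 v v').2.
  have := flat_narrow L (joined_shift _ jv) ns' l (joined_shift _ ju) (joined_shift _ ju')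
    (joined_shift _ j0) (joined_shift _ j2) h1 h2 h3.
  by case=> /(same_shift _ _ _).2 h; [left|right]; apply/dist_same.
- exact: dist_geodesic.
Qed.

Variable S : seq G.
Hypothesis inS : forall x, x \in S <-> exists k, X k x.

Lemma letterP x : letter S x -> exists k, X k x.
Proof.
by case/orP => /inS [k h]; exists k => //; rewrite -(invgK x); apply: XV.
Qed.

Lemma X_spelled k x g n : X k x -> spelled_in S g n -> spelled_in S (x * g) n.+1.
Proof.
move=> Xx /asboolP[w [al e]]; apply/asboolP; exists (cons_tuple x w); split.
  by rewrite /= al andbT /letter; apply/orP; left; apply/inS; exists k.
by rewrite /= big_cons e.
Qed.

Lemma spelled1 : spelled_in S 1 0.
Proof. by apply/asboolP; exists (nil_tuple G); rewrite /= big_nil. Qed.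

(** Two chambers at a common vertex differ by one letter, and a walk of length [n] visits [n.+1]
    vertices. *)
Lemma walk_spelled n u v c c' : walk n u v -> X u.1 (u.2^-1 * c) -> X v.1 (v.2^-1 * c') ->
  spelled_in S (c^-1 * c') n.+1.
Proof.
elim: n u c => [|n IH] u c /=.
  move=> [e s] h h'; rewrite -[_ * c']mulg1; apply: (@X_spelled u.1); last exact: spelled1.
  by apply: X_shift (X_flip h) _; apply: X_shift s _; rewrite e.
case=> w [b [ub wb]] ww uc vc.
have -> : c^-1 * c' = c^-1 * b * (b^-1 * c') by rewrite -mulgA mulKVg.
apply: (@X_spelled u.1); last exact: IH ww wb vc.
by apply: X_shift (X_flip uc) ub.
Qed.

Lemma spelled_walk g n k k' c : spelled_in S g n -> walk n.+1 (k, c) (k', c * g).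
Proof.
move=> /asboolP[[w /= /eqP <-] /= [al <-]] {n}.
elim: w k c al => [|x w IH] k c /= al.
  by apply: joined_walk; exists c; rewrite /= big_nil mulg1 mulVg; split; apply: X1.
case/andP: al => /letterP[j Xx] al.
exists (j, c); first by exists c; rewrite /= mulVg; split; apply: X1.
have s : same (j, c) (j, c * x) by split=> //=; rewrite mulKg.
by apply: (@same_walk (size w).+1 _ _ _ s); rewrite big_cons mulgA; apply: IH.
Qed.

Lemma spelled_generates : generates S.
Proof.
move=> g.
suff h : exists n, walk n (ord0, 1) (ord0, g).
  have [n w] := h; exists n.+1; have := @walk_spelled n _ _ 1 g w.
  by rewrite /= !invg1 !mul1g mulVg; apply; apply: X1.
by exists (dist (ord0, 1) (ord0, g)); apply/distP.
Qed.

Lemma word_length_dist g h : 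
  word_length spelled_generates (g^-1 * h) <= (dist (ord0, g) (ord0, h)).+1 /\
  dist (ord0, g) (ord0, h) <= (word_length spelled_generates (g^-1 * h)).+1.
Proof.
rewrite /word_length; case: ex_minnP => n sp mn; split.
  apply: mn; apply: (@walk_spelled _ (ord0, g) (ord0, h)); rewrite /= ?mulVg; try exact: X1.
  by apply/distP.
by apply/distP; have := spelled_walk ord0 ord0 g sp; rewrite mulKVg.
Qed.

Lemma triangle_hyperbolic (R : realType) : hyperbolic_group R G.
Proof.
(* The constant 15 for vertices and an error of at most 1 in each of six distances give 21, and half
   of 21 is below 11. *)
exists S, spelled_generates, 11%R => o x y z.
rewrite /gromov_product /word_metric.
have := dist_four_point (ord0, o) (ord0, x) (ord0, y) (ord0, z).
have [a1 a2] := word_length_dist x o; have [b1 b2] := word_length_dist y o.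
have [c1 c2] := word_length_dist z o; have [d1 d2] := word_length_dist x y.
have [e1 e2] := word_length_dist y z; have [f1 f2] := word_length_dist x z.
move: (word_length _ (x^-1 * o)) (word_length _ (y^-1 * o)) (word_length _ (z^-1 * o))
  (word_length _ (x^-1 * y)) (word_length _ (y^-1 * z)) (word_length _ (x^-1 * z))
  a1 a2 b1 b2 c1 c2 d1 d2 e1 e2 f1 f2 => a b c d e f.
pose D := fun g h => dist (ord0, g) (ord0, h).
rewrite -/(D x o) -/(D y o) -/(D z o) -/(D x y) -/(D y z) -/(D x z).
move: (D x o) (D y o) (D z o) (D x y) (D y z) (D x z) => a' b' c' d' e' f' *.
have [h|h] : a + b + f <= a + c + d + 21 \/ b + c + f <= a + c + e + 21 by lia.
- have : ((a + b + f)%:R <= (a + c + d + 21)%:R :> R)%R by rewrite ler_nat.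
  by rewrite !natrD => h'; rewrite lerBlDr ge_min; apply/orP; left; lra.
- have : ((b + c + f)%:R <= (a + c + e + 21)%:R :> R)%R by rewrite ler_nat.
  by rewrite !natrD => h'; rewrite lerBlDr ge_min; apply/orP; right; lra.
Qed.
End Distance.

(** * A triangle of unipotent groups *)

Section Words.
Local Open Scope ring_scope.
Local Open Scope quotient_scope.
Variable F : finFieldType.

Definition wletter := ('I_3 * 'rV[F]_3)%type.
Definition word := seq wletter.
Definition quad := (F * F * F * F)%type.

(* The edge groups are [F] for the indices 0 and 1, where only the coordinate
   [v 0 0] counts, and [F^3] for the index 2. The vertex group [k] is the image of
   its words under the unipotent representations [run k b] on [F^4]. *)
Definition coord (i b : 'I_3) (v : 'rV[F]_3) : F := if i == ord_max then v 0 b else v 0 0.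

Definition lo (k : 'I_3) : 'I_3 := if k == 0 then 1 else 0.
Definition hi (k : 'I_3) : 'I_3 := if k == ord_max then 1 else ord_max.

(** Up to signs, [step_lo] and [step_hi] are the simple root groups of [Sp_4(F)], with matrices
    [1 + t (E_10 + E_32)] and [1 + s E_21] on columns. The last coordinate of the image of
    [(1, 0, 0, 0)] collects the subwords lo, hi, lo; it is the cubic coordinate that a Heisenberg
    group lacks. *)
Definition step_lo (t : F) (x : quad) : quad :=
  let: (x0, x1, x2, x3) := x in (x0, x1 + t * x0, x2, x3 + t * x2).
Definition step_hi (s : F) (x : quad) : quad :=
  let: (x0, x1, x2, x3) := x in (x0, x1, x2 + s * x1, x3).

Definition step (k b : 'I_3) (x : quad) (l : wletter) : quad :=
  if l.1 == lo k then step_lo (coord l.1 b l.2) x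
  else if l.1 == hi k then step_hi (coord l.1 b l.2) x else x.

Definition run (k b : 'I_3) (x : quad) (w : word) : quad := foldl (step k b) x w.

Definition avoids (k : 'I_3) (w : word) : bool := all (fun l : wletter => l.1 != k) w.

Definition vertex_rel (k : 'I_3) (u v : word) : Prop :=
  [/\ avoids k u, avoids k v & forall b x, run k b x u = run k b x v].

Inductive eqw : word -> word -> Prop :=
| eqw_rel k u v : vertex_rel k u v -> eqw u v
| eqw_refl u : eqw u u
| eqw_sym u v : eqw u v -> eqw v u
| eqw_trans u v w : eqw u v -> eqw v w -> eqw u w
| eqw_cat u v u' v' : eqw u v -> eqw u' v' -> eqw (u ++ u') (v ++ v').

Definition eqwb (u v : word) : bool := `[< eqw u v >].

Lemma eqwb_equiv : equiv_class_of eqwb.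
Proof.
split=> [u|u v|v u w].
- by apply/asboolP; apply: eqw_refl.
- by apply/asboolP/asboolP; apply: eqw_sym.
- by move=> /asboolP h1 /asboolP h2; apply/asboolP; apply: eqw_trans h1 h2.
Qed.

Canonical eqwb_equiv_rel := EquivRelPack eqwb_equiv.

Definition tgroup := {eq_quot eqwb}.
HB.instance Definition _ := Choice.on tgroup.

Definition class (w : word) : tgroup := \pi_tgroup w.

Lemma class_eq u v : class u = class v <-> eqw u v.
Proof.
split=> [/eqP|h]; last by apply/eqP; rewrite eqmodE; apply/asboolP.
by rewrite eqmodE => /asboolP.
Qed.

Lemma class_repr g : class (repr g) = g.
Proof. exact: reprK. Qed.

Definition invw (w : word) : word := rev [seq (l.1, - l.2) | l <- w].

Lemma lo_neq k : lo k != k. Proof. by case: k => [[|[|[|//]]] ?]. Qed.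
Lemma hi_neq k : hi k != k. Proof. by case: k => [[|[|[|//]]] ?]. Qed.
Lemma lo_hi k : lo k != hi k. Proof. by case: k => [[|[|[|//]]] ?]. Qed.
Lemma lo_not_max k : lo k != ord_max. Proof. by case: k => [[|[|[|//]]] ?]. Qed.
Lemma lo_or_hi i k : i != k -> i = lo k \/ i = hi k.
Proof.
by move: i k => [[|[|[|//]]] ?] [[|[|[|//]]] ?] // _;
  ((left; apply: val_inj; done) || (right; apply: val_inj; done)).
Qed.

Lemma step0 k b x i v : (forall b, coord i b v = 0) -> step k b x (i, v) = x.
Proof.
move=> v0; rewrite /step /= v0 /step_lo /step_hi; case: x => [[[x0 x1] x2] x3].
by rewrite !mul0r !addr0; case: ifP => _ //; case: ifP.
Qed.

Lemma stepD k b x i v w : step k b (step k b x (i, v)) (i, w) = step k b x (i, v + w).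
Proof.
rewrite /step /=; have -> : coord i b (v + w) = coord i b v + coord i b w.
  by rewrite /coord; case: ifP => _; rewrite mxE.
case: (i == lo k); [|case: (i == hi k) => //]; rewrite /step_lo /step_hi; case: x => [[[x0 x1] x2] x3].
  by rewrite /= !mulrDl !addrA.
by rewrite /= !mulrDl !addrA.
Qed.

Lemma eqw_trivial i v : (forall b, coord i b v = 0) -> eqw [:: (i, v)] [::].
Proof.
move=> v0; have [k ik] := other_index i; apply: (@eqw_rel k); split=> //=; first by rewrite ik.
by move=> b x; rewrite step0.
Qed.

Lemma eqwD i v w : eqw [:: (i, v); (i, w)] [:: (i, v + w)].
Proof.
have [k ik] := other_index i; apply: (@eqw_rel k); split=> /=; rewrite ?ik //.
by move=> b x; rewrite stepD.
Qed.

Lemma coord0 i b : coord i b 0 = 0.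
Proof. by rewrite /coord; case: ifP => _; rewrite mxE. Qed.

Lemma eqw_invl w : eqw (invw w ++ w) [::].
Proof.
elim: w => [|[i v] w IH]; first exact: eqw_refl.
rewrite /invw /= rev_cons cat_rcons -/(invw w); apply: eqw_trans IH.
rewrite -[(i, - v) :: _]/([:: (i, - v); (i, v)] ++ w).
apply: eqw_cat; first exact: eqw_refl.
rewrite -[X in eqw _ X]cat0s; apply: eqw_cat; last exact: eqw_refl.
apply: eqw_trans (eqwD _ _ _) _; rewrite addNr; apply: eqw_trivial => b.
exact: coord0.
Qed.

Lemma invwK : involutive invw.
Proof.
move=> w; rewrite /invw map_rev revK -map_comp -[RHS]map_id.
by apply: eq_map => -[i v] /=; rewrite opprK.
Qed.

Definition tmul (g h : tgroup) : tgroup := class (repr g ++ repr h).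
Definition tinv (g : tgroup) : tgroup := class (invw (repr g)).

Lemma tmul_class u v : tmul (class u) (class v) = class (u ++ v).
Proof. by apply/class_eq; apply: eqw_cat; apply/class_eq; rewrite class_repr. Qed.

Lemma tmulA : associative tmul.
Proof.
by move=> x y z; rewrite -(class_repr x) -(class_repr y) -(class_repr z) !tmul_class catA.
Qed.

Lemma tmul1 : left_id (class [::]) tmul.
Proof. by move=> x; rewrite -(class_repr x) tmul_class. Qed.

Lemma t1mul : right_id (class [::]) tmul.
Proof. by move=> x; rewrite -(class_repr x) tmul_class cats0. Qed.

Lemma tmulV : left_inverse (class [::]) tinv tmul.
Proof. by move=> x; rewrite /tinv -{2}(class_repr x) tmul_class; apply/class_eq/eqw_invl. Qed.

Lemma tmulVr : right_inverse (class [::]) tinv tmul.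
Proof.
move=> x; rewrite /tinv -{1}(class_repr x) tmul_class; apply/class_eq.
by have := eqw_invl (invw (repr x)); rewrite invwK.
Qed.

HB.instance Definition _ := isGroup.Build tgroup tmulA tmul1 t1mul tmulV tmulVr.

Local Open Scope group_scope.

Lemma class_cat u v : class (u ++ v) = class u * class v.
Proof. by rewrite -tmul_class. Qed.

Lemma class_nil : class [::] = 1. Proof. by []. Qed.

Lemma class_invw w : class (invw w) = (class w)^-1.
Proof.
apply: (mulgI (class w)); rewrite mulgV -class_cat -class_nil; apply/class_eq.
by have := eqw_invl (invw w); rewrite invwK.
Qed.

Definition edge (i : 'I_3) (v : 'rV[F]_3) : tgroup := class [:: (i, v)].

Lemma class_cons i v w : class ((i, v) :: w) = edge i v * class w.
Proof. by rewrite -class_cat. Qed.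

Lemma edgeD i v w : edge i v * edge i w = edge i (v + w)%R.
Proof. by rewrite -class_cat; apply/class_eq/eqwD. Qed.

Lemma edge_trivial i v : (forall b, coord i b v = 0%R) -> edge i v = 1.
Proof. by move=> v0; apply/class_eq/eqw_trivial. Qed.

Lemma edgeN i v : edge i (- v)%R = (edge i v)^-1.
Proof. by rewrite -class_invw. Qed.

Definition Agrp (i : 'I_3) (g : tgroup) : Prop := exists v, g = edge i v.
Definition Xgrp (k : 'I_3) (g : tgroup) : Prop := exists2 w, avoids k w & g = class w.

Lemma class_vertex k u v : avoids k u -> avoids k v ->
  (forall b x, run k b x u = run k b x v) -> class u = class v.
Proof. by move=> h1 h2 h3; apply/class_eq; apply: (@eqw_rel k). Qed.

Definition total (i b : 'I_3) (w : word) : F :=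
  (\sum_(l <- w | l.1 == i) coord l.1 b l.2)%R.

Lemma run_lo_only k b x w : avoids (hi k) w -> run k b x w = step_lo (total (lo k) b w) x.
Proof.
elim: w x => [|[i v] w IH] x; rewrite /total ?big_nil ?big_cons /=.
  by case: x => [[[x0 x1] x2] x3]; rewrite /step_lo !mul0r !addr0.
move=> /andP[ih aw]; rewrite IH // /step /= (negPf ih).
case: eqP => [_|_] //; case: x => [[[x0 x1] x2] x3]; rewrite /step_lo /total.
by rewrite !mulrDl !addrA.
Qed.

Lemma run_hi_only k b x w : avoids (lo k) w -> run k b x w = step_hi (total (hi k) b w) x.
Proof.
elim: w x => [|[i v] w IH] x; rewrite /total ?big_nil ?big_cons /=.
  by case: x => [[[x0 x1] x2] x3]; rewrite /step_hi !mul0r !addr0.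
move=> /andP[ih aw]; rewrite IH // /step /= (negPf ih).
case: eqP => [_|_] //; case: x => [[[x0 x1] x2] x3]; rewrite /step_hi /total.
by rewrite !mulrDl !addrA.
Qed.

Lemma run_lo_total k b w x1 x2 x3 :
  (run k b (1, x1, x2, x3)%R w).1.1.2 = (x1 + total (lo k) b w)%R.
Proof.
elim: w x1 x2 x3 => [|[i v] w IH] x1 x2 x3; rewrite /total ?big_nil ?big_cons ?addr0 //=.
rewrite [step _ _ _ _]/step /=; case: (i == lo k); first by rewrite IH mulr1 -addrA.
by case: (i == hi k); rewrite IH.
Qed.

Lemma run_hi_total k b w x2 x3 :
  (run k b (0, 1, x2, x3)%R w).1.2 = (x2 + total (hi k) b w)%R.
Proof.
elim: w x2 x3 => [|[i v] w IH] x2 x3; rewrite /total ?big_nil ?big_cons ?addr0 //=.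
rewrite [step _ _ _ _]/step /=; have [->|_] := eqVneq i (lo k).
  by rewrite (negPf (lo_hi k)) mulr0 addr0 IH.
by case: (i == hi k); rewrite IH // mulr1 -addrA.
Qed.

(** These sums are entries of [run]. In [eqw_run] they are all that remains of a relation once the
    letters of one of its indices are deleted. *)
Lemma eqw_total u v : eqw u v -> forall i b, total i b u = total i b v.
Proof.
elim=> {u v} [k u v [au av e]|//|u v _ IH|u v w _ IH1 _ IH2|u v u' v' _ IH1 _ IH2] i0 b0 //.
- have [ik|ik] := eqVneq i0 k.
    have z w : avoids k w -> total i0 b0 w = 0%R.
      move=> aw; rewrite /total big_seq_cond big_pred0 // => l.
      by apply/andP => -[/(allP aw) /= /negPf]; rewrite ik => ->.
    by rewrite !z.
  case: (lo_or_hi ik) => ->.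
    by apply: (@addrI _ 0%R); rewrite -!(run_lo_total k b0 _ 0 0 0) e.
  by apply: (@addrI _ 0%R); rewrite -!(run_hi_total k b0 _ 0 0) e.
- by rewrite IH1 IH2.
- by rewrite /total !big_cat -!/(total _ _ _) IH1 IH2.
Qed.

Lemma run_cat k b x u v : run k b x (u ++ v) = run k b (run k b x u) v.
Proof. exact: foldl_cat. Qed.

(* Deleting the letters of index [k'] is compatible with the relations of the
   other two vertex groups, so [run] is defined on the whole group. *)
Lemma eqw_run k u v : eqw u v -> forall b x, run k b x u = run k b x v.
Proof.
move=> h; elim: h (eqw_total h) => {u v} [k' u v [au av e] tot b x|//|u v h IH tot b x|
  u v w h1 IH1 h2 IH2 tot b x|u v u' v' h1 IH1 h2 IH2 tot b x].
- have [->|kk'] := eqVneq k k'; first exact: e.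
  have kk : k' != k by rewrite eq_sym.
  case: (lo_or_hi kk) => ek; subst k'.
    by rewrite !run_hi_only // tot.
  by rewrite !run_lo_only // tot.
- by rewrite IH //; apply: eqw_total.
- by rewrite (IH1 (eqw_total h1)) (IH2 (eqw_total h2)).
- by rewrite !run_cat (IH1 (eqw_total h1)) (IH2 (eqw_total h2)).
Qed.

Lemma class_run k u v : class u = class v -> forall b x, run k b x u = run k b x v.
Proof. by move/class_eq; apply: eqw_run. Qed.

Lemma coord_lo k b (v : 'rV[F]_3) : coord (lo k) b v = v 0%R 0%R.
Proof. by rewrite /coord (negPf (lo_not_max k)). Qed.

Lemma run_lo1 k b x (v : 'rV[F]_3) w : run k b x ((lo k, v) :: w) = run k b (step_lo (v 0%R 0%R) x) w.
Proof. by rewrite /= /step /= eqxx coord_lo. Qed.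

Lemma run_hi1 k b x v w :
  run k b x ((hi k, v) :: w) = run k b (step_hi (coord (hi k) b v) x) w.
Proof. by rewrite /= /step /= eqxx eq_sym (negPf (lo_hi k)). Qed.

Lemma edge_lo_trivial k (v : 'rV[F]_3) : v 0%R 0%R = 0%R -> edge (lo k) v = 1.
Proof. by move=> v0; apply: edge_trivial => b; rewrite coord_lo. Qed.

Lemma Agrp1 i : Agrp i 1.
Proof. by exists 0%R; rewrite edge_trivial // => b; apply: coord0. Qed.

Lemma AgrpM i x y : Agrp i x -> Agrp i y -> Agrp i (x * y).
Proof. by move=> [v ->] [w ->]; exists (v + w)%R; rewrite edgeD. Qed.

Lemma AgrpV i x : Agrp i x -> Agrp i x^-1.
Proof. by move=> [v ->]; exists (- v)%R; rewrite edgeN. Qed.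

Lemma XgrpM k x y : Xgrp k x -> Xgrp k y -> Xgrp k (x * y).
Proof.
move=> [u au ->] [v av ->]; exists (u ++ v); last by rewrite class_cat.
by rewrite /avoids all_cat; apply/andP.
Qed.

Lemma XgrpV k x : Xgrp k x -> Xgrp k x^-1.
Proof.
move=> [u au ->]; exists (invw u); last by rewrite class_invw.
by rewrite /avoids all_rev all_map.
Qed.

Lemma AgrpX i k x : i != k -> Agrp i x -> Xgrp k x.
Proof. by move=> ik [v ->]; exists [:: (i, v)]; rewrite //= ik. Qed.

Lemma edge_nontrivial i v b : coord i b v != 0%R -> edge i v != 1.
Proof.
have [k ik] := other_index i; case: (lo_or_hi ik) => ei; rewrite {}ei; apply: contra_neq;
  rewrite -class_nil => /(class_run k)/(_ b).
- by move/(_ (1, 0, 0, 0)%R); rewrite run_lo1 coord_lo /= => -[]; rewrite mulr1 add0r.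
- by move/(_ (0, 1, 0, 0)%R); rewrite run_hi1 /= => -[]; rewrite mulr1 add0r.
Qed.

Lemma Agrp_nontrivial i : exists2 x, Agrp i x & x != 1.
Proof.
exists (edge i (const_mx 1%R)); first by exists (const_mx 1%R).
by apply: (@edge_nontrivial _ _ 0%R); rewrite /coord; case: ifP; rewrite mxE oner_eq0.
Qed.

Lemma pair_index (i j : 'I_3) : i != j -> exists k, i = lo k /\ j = hi k \/ i = hi k /\ j = lo k.
Proof.
move=> ij; exists (third i j).
have ik : i != third i j by rewrite eq_sym third_neql.
have jk : j != third i j by rewrite eq_sym third_neqr.
case: (lo_or_hi ik) (lo_or_hi jk) => [e1|e1] [e2|e2]; try by [left|right].
all: by case/eqP: ij; apply: (etrans e1 (esym e2)).
Qed.

Lemma lo_hi_disjoint k v w : edge (lo k) v = edge (hi k) w -> edge (lo k) v = 1.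
Proof.
move=> /(class_run k) /(_ 0%R (1, 0, 0, 0)%R) /(congr1 (fun q : quad => q.1.1.2)).
by rewrite run_lo1 run_hi1 /= mulr1 add0r => /edge_lo_trivial.
Qed.

Lemma Agrp_disjoint i j x : i != j -> Agrp i x -> Agrp j x -> x = 1.
Proof.
move=> /pair_index[k [[-> ->]|[-> ->]]] [v ->] [w e]; first exact: lo_hi_disjoint e.
by rewrite e; apply: lo_hi_disjoint (esym e).
Qed.

(** The only route from [(1, 0, 0, 0)] to the last coordinate is lo, hi, lo, so this entry is
    [v1 w1 v2] on the left and 0 on the right. *)
Lemma girth_lo k v1 w1 v2 w2 v3 w3 :
  class [:: (lo k, v1); (hi k, w1); (lo k, v2)] = class [:: (hi k, w2); (lo k, v3); (hi k, w3)] ->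
  [\/ edge (lo k) v1 = 1, edge (hi k) w1 = 1 | edge (lo k) v2 = 1].
Proof.
move=> /(class_run k) e.
have [v10|v10] := eqVneq (v1 0%R 0%R) 0%R; first by constructor 1; apply: edge_lo_trivial.
have [v20|v20] := eqVneq (v2 0%R 0%R) 0%R; first by constructor 3; apply: edge_lo_trivial.
constructor 2; apply: edge_trivial => b.
move: (congr1 (fun q : quad => q.2) (e b (1, 0, 0, 0)%R)); rewrite !(run_lo1, run_hi1) /=.
rewrite !(mulr1, mulr0, add0r, addr0) => /eqP; rewrite !mulf_eq0 (negPf v10) (negPf v20) orbF.
by move/eqP.
Qed.

Lemma girth_hi k v1 w1 w2 v2 w3 v3 :
  class [:: (hi k, w1); (lo k, v1); (hi k, w2)] = class [:: (lo k, v2); (hi k, w3); (lo k, v3)] ->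
  [\/ edge (hi k) w1 = 1, edge (lo k) v1 = 1 | edge (hi k) w2 = 1].
Proof.
move=> /(class_run k) e.
have [v10|v10] := eqVneq (v1 0%R 0%R) 0%R; first by constructor 2; apply: edge_lo_trivial.
have [/forallP h|/forallPn[b w2b]] := boolP [forall b, coord (hi k) b w2 == 0%R].
  by constructor 3; apply: edge_trivial => b; apply/eqP.
constructor 1; apply: edge_trivial => b'.
(* The last two entries of the image of [(1, 0, 0, 0)] give [v1 w2 = v2 w3] and [v2 w3 v3 = 0], so
   [v3] vanishes. The last entry of the image of [(0, 1, 0, 0)] then reads [v1 w1 = 0]. *)
have v30 : v3 0%R 0%R = 0%R.
  have := congr1 (fun q : quad => q.1.2) (e b (1, 0, 0, 0)%R).
  have := congr1 (fun q : quad => q.2) (e b (1, 0, 0, 0)%R).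
  rewrite !(run_lo1, run_hi1) /= !(mulr1, mulr0, add0r, addr0) => /esym/eqP + e1.
  by rewrite -e1 !mulf_eq0 (negPf v10) (negPf w2b) !orbF => /eqP.
move: (congr1 (fun q : quad => q.2) (e b' (0, 1, 0, 0)%R)); rewrite !(run_lo1, run_hi1) /=.
rewrite v30 !(mulr1, mulr0, mul0r, add0r, addr0) => /eqP.
by rewrite mulf_eq0 (negPf v10) /= => /eqP.
Qed.

Lemma tgroup_girth i j a b a' b' c b'' : i != j ->
  Agrp i a -> Agrp j b -> Agrp i a' -> Agrp j b' -> Agrp i c -> Agrp j b'' ->
  a * b * a' = b' * c * b'' -> [\/ a = 1, b = 1 | a' = 1].
Proof.
have e3 i1 i2 i3 v1 v2 v3 : edge i1 v1 * edge i2 v2 * edge i3 v3 = class [:: (i1, v1); (i2, v2); (i3, v3)].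
  by rewrite !class_cons class_nil mulg1 mulgA.
move=> /pair_index[k ij] [v1 ->] [w1 ->] [v2 ->] [w2 ->] [v3 ->] [w3 ->]; rewrite !e3.
by case: ij => [[-> ->]|[-> ->]]; [apply: girth_lo|apply: girth_hi].
Qed.

Lemma tgroup_generation (P : tgroup -> Prop) : P 1 ->
  (forall g k x, P g -> Xgrp k x -> P (g * x)) -> forall g, P g.
Proof.
move=> P1 PX g; rewrite -(class_repr g); elim/last_ind: (repr g) => [//|w [i v] IH].
rewrite -cats1 class_cat; have [k ik] := other_index i; apply: (PX _ k) => //.
by apply: (AgrpX ik); exists v.
Qed.

Section Action.
Variables (Y : Type) (W : Y -> Prop) (act : 'I_3 -> Y -> tgroup -> Y).
Hypothesis actW : forall k y x, W y -> Xgrp k x -> W (act k y x).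
Hypothesis act1 : forall k y, W y -> act k y 1 = y.
Hypothesis actM : forall k y x x', W y -> Xgrp k x -> Xgrp k x' ->
  act k (act k y x) x' = act k y (x * x').
Hypothesis act_edge : forall i k k' y a, W y -> i != k -> i != k' -> Agrp i a ->
  act k y a = act k' y a.

(** A letter of index [i] acts through the vertex group [i + 1]; by [act_edge] the other vertex
    group containing it would give the same. *)
Definition act_word (y : Y) (w : word) : Y :=
  foldl (fun y (l : wletter) => act (l.1 + 1)%R y (edge l.1 l.2)) y w.

Lemma act_wordP k y w : W y -> avoids k w ->
  act_word y w = act k y (class w) /\ W (act_word y w).
Proof.
elim/last_ind: w => [|w [i v] IH] Wy; first by rewrite /= class_nil act1.
rewrite /avoids all_rcons /= => /andP[ik aw]; have [IH1 IH2] := IH Wy aw.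
have Ai : Agrp i (edge i v) by exists v.
rewrite /act_word foldl_rcons -/(act_word y w) /= (act_edge IH2 (succ_neq i) ik Ai).
split; last by apply: actW => //; apply: AgrpX Ai.
rewrite {1}IH1 actM //; [|by exists w|exact: AgrpX Ai].
by rewrite -class_cat cats1.
Qed.

Lemma act_wordW y w : W y -> W (act_word y w).
Proof.
move=> Wy; elim/last_ind: w => [//|w [i v] IH].
rewrite /act_word foldl_rcons -/(act_word y w) /=; apply: actW => //.
by apply: (AgrpX (succ_neq i)); exists v.
Qed.

Lemma act_word_eqw u v : eqw u v -> forall y, W y -> act_word y u = act_word y v.
Proof.
elim=> {u v} [k u v [au av e] y Wy|//|u v _ IH y Wy|u v w _ IH1 _ IH2 y Wy|u v u' v' _ IH1 _ IH2 y Wy].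
- have [-> _] := act_wordP Wy au; have [-> _] := act_wordP Wy av.
  by rewrite (class_vertex au av e).
- by rewrite IH.
- by rewrite IH1 // IH2.
- by rewrite /act_word !foldl_cat -!/(act_word _ _) IH1 // IH2 //; apply: act_wordW.
Qed.

Lemma tgroup_action y0 : W y0 -> exists F0 : tgroup -> Y,
  F0 1 = y0 /\ forall g k x, Xgrp k x -> F0 (g * x) = act k (F0 g) x.
Proof.
move=> W0; exists (fun g => act_word y0 (repr g)).
have e w : act_word y0 (repr (class w)) = act_word y0 w.
  by apply: act_word_eqw W0; apply/class_eq; rewrite class_repr.
split=> [|g k x [w aw ->]]; first by rewrite -class_nil e.
rewrite -{1}(class_repr g) -class_cat e /act_word foldl_cat -!/(act_word _ _).
by have [-> _] := act_wordP (act_wordW (repr g) W0) aw.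
Qed.
End Action.

Lemma tgroup_triangle : triangle_of_groups Agrp Xgrp.
Proof.
split; [exact: Agrp1|exact: AgrpM|exact: AgrpV|exact: XgrpM|exact: XgrpV|exact: AgrpX|
  exact: Agrp_nontrivial|exact: Agrp_disjoint|exact: tgroup_girth|exact: tgroup_generation|].
exact: tgroup_action.
Qed.

(** An element is determined by its action on the finite set [F^4] in each of the three coordinates.
    On maps that do not occur, [rep] takes the value 1, which is in the group anyway. *)
Lemma finite_vertex_group k : exists s : seq tgroup, uniq s /\ forall x, x \in s <-> Xgrp k x.
Proof.
pose sig (w : word) := [ffun bx : 'I_3 * quad => run k bx.1 bx.2 w].
pose rep (f : {ffun 'I_3 * quad -> quad}) :=
  if pselect (exists w, avoids k w /\ sig w = f) is left ex then class (sval (cid ex)) else 1.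
exists (undup [seq rep f | f : {ffun 'I_3 * quad -> quad}]); split; first exact: undup_uniq.
move=> x; rewrite mem_undup; split.
  move=> /mapP[f _ ->]; rewrite /rep; case: pselect => [ex|_]; last by exists [::].
  by case: (cid ex) => w [aw _] /=; exists w.
move=> [w aw ->]; apply/mapP; exists (sig w); first by rewrite mem_enum.
rewrite /rep; case: pselect => [ex|]; last by case; exists w.
case: (cid ex) => w' [aw' e] /=; apply: (class_vertex aw aw') => b y.
by move/ffunP: e => /(_ (b, y)); rewrite !ffunE => ->.
Qed.
End Words.

(** * Property (T) *)

Definition finite_subgroup (G : groupType) (s : seq G) : Prop :=
  [/\ uniq s, 1%g \in s & forall g h, g \in s -> h \in s -> (g * h)%g \in s].

(** * Averages over finite subgroups in a unitary representation *)

Section RealForm.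
Local Open Scope ring_scope.
Variables (R : realType) (G : groupType) (H : lmodType R[i]) (ip : {dot H for Num.conj}).
Variable pi : G -> {linear H -> H}.
Hypothesis piM : forall g h v, pi (g * h)%g v = pi g (pi h v).
Hypothesis pi_unitary : forall g u v, ip (pi g u) (pi g v) = ip u v.
Implicit Types (u v w x y : H) (g h : G) (s : seq G).

Definition re_ip u v : R := complex.Re (ip u v).
Definition sqnorm v : R := re_ip v v.

Lemma BDl u v w : re_ip (u + v) w = re_ip u w + re_ip v w.
Proof. by rewrite /re_ip linearDl raddfD. Qed.

Lemma BC u v : re_ip u v = re_ip v u.
Proof.
have Re_conj (z : R[i]) : complex.Re (Num.conj z) = complex.Re z by case: z.
by rewrite /re_ip (hermC ip u v) expr0 mul1r; exact: Re_conj.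
Qed.

Lemma BDr u v w : re_ip u (v + w) = re_ip u v + re_ip u w.
Proof. by rewrite ![re_ip u _]BC BDl. Qed.

Lemma BNl u v : re_ip (- u) v = - re_ip u v.
Proof. by rewrite /re_ip linearNl raddfN. Qed.

Lemma BNr u v : re_ip u (- v) = - re_ip u v.
Proof. by rewrite ![re_ip u _]BC BNl. Qed.

Lemma B0l v : re_ip 0 v = 0.
Proof. by rewrite -(subrr v) BDl BNl subrr. Qed.

Lemma BZl (a : R) u v : re_ip (a%:C%C *: u) v = a * re_ip u v.
Proof.
rewrite /re_ip linearZl_LR /=; case: (ip u v) => c d /=.
by rewrite mul0r subr0.
Qed.

Lemma BZr (a : R) u v : re_ip u (a%:C%C *: v) = a * re_ip u v.
Proof. by rewrite BC BZl BC. Qed.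

Lemma B_suml (I : Type) (r : seq I) (f : I -> H) v :
  re_ip (\sum_(i <- r) f i) v = \sum_(i <- r) re_ip (f i) v.
Proof.
by elim: r => [|i r IH]; rewrite ?big_nil ?B0l // !big_cons BDl IH.
Qed.

Lemma B_sumr (I : Type) (r : seq I) (f : I -> H) v :
  re_ip v (\sum_(i <- r) f i) = \sum_(i <- r) re_ip v (f i).
Proof. by rewrite BC B_suml; apply: eq_bigr => i _; rewrite BC. Qed.

Lemma ipN v : ip v v = (sqnorm v)%:C%C.
Proof.
have [->|v0] := eqVneq v 0; first by rewrite /sqnorm B0l linear0l.
have /ltW := neq0_dnorm_gt0 (s := ip) v v0; rewrite /sqnorm /re_ip.
by case: (ip v v) => a b; rewrite lecE /= => /andP[/eqP ->].
Qed.

Lemma N_ge0 v : 0 <= sqnorm v.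
Proof.
have [->|v0] := eqVneq v 0; first by rewrite /sqnorm B0l.
by have /ltW := neq0_dnorm_gt0 (s := ip) v v0; rewrite ipN lecR.
Qed.

Lemma N_eq0 v : sqnorm v = 0 -> v = 0.
Proof.
move=> n0; apply: contraTeq isT => /(neq0_dnorm_gt0 (s := ip) v).
by rewrite ipN n0 ltcR ltxx.
Qed.

Lemma ND u v : sqnorm (u + v) = sqnorm u + sqnorm v + 2 * re_ip u v.
Proof. by rewrite /sqnorm !(BDl, BDr) (BC v u); ring. Qed.

Lemma NN u : sqnorm (- u) = sqnorm u.
Proof. by rewrite /sqnorm BNl BNr opprK. Qed.

Lemma NB u v : sqnorm (u - v) = sqnorm u + sqnorm v - 2 * re_ip u v.
Proof. by rewrite ND NN BNr; ring. Qed.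

Lemma AMGM (c : R) u v : 0 < c -> 2 * re_ip u v <= c * sqnorm u + c^-1 * sqnorm v.
Proof.
move=> c0; have := N_ge0 (c%:C%C *: u - v); rewrite NB /sqnorm !(BZl, BZr) -!/(sqnorm _) => h.
rewrite -(ler_pM2l c0) mulrDr mulVKf ?gt_eqF //; lra.
Qed.

Lemma B_pi g u v : re_ip (pi g u) (pi g v) = re_ip u v.
Proof. by rewrite /re_ip pi_unitary. Qed.

Lemma N_pi g u : sqnorm (pi g u) = sqnorm u. Proof. exact: B_pi. Qed.

Definition fixed s v : Prop := forall g, g \in s -> pi g v = v.

(** For a finite subgroup, the orthogonal projection onto its invariant vectors. *)
Definition avg s v : H := ((size s)%:R^-1)%:C%C *: \sum_(g <- s) pi g v.

Lemma avg_fixed s v : finite_subgroup s -> fixed s (avg s v).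
Proof.
move=> [us s1 sM] g gs; rewrite /avg linearZ linear_sum /=; congr (_ *: _).
have ps : perm_eq [seq (g * h)%g | h <- s] s.
  have um : uniq [seq (g * h)%g | h <- s] by rewrite map_inj_uniq //; apply: mulgI.
  have sub : {subset [seq (g * h)%g | h <- s] <= s} by move=> _ /mapP[h hs ->]; apply: sM.
  apply: uniq_perm => //; apply: (uniq_min_size um sub _).2.
  by rewrite size_map.
rewrite -[RHS](perm_big _ ps) big_map; apply: eq_bigr => h _.
by rewrite piM.
Qed.

Lemma size_neq0 s : finite_subgroup s -> (size s)%:R != 0 :> R.
Proof. by move=> [_ + _]; case: s => // g s _; rewrite pnatr_eq0. Qed.

Lemma avg_id s v : finite_subgroup s -> fixed s v -> avg s v = v.
Proof.
move=> fs fv; rewrite /avg (eq_big_seq (fun=> v)) //.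
rewrite big_const_seq count_predT iter_addr_0 -scaler_nat scalerA.
rewrite -[X in _ * X](rmorph_nat (real_complex R)) -rmorphM mulVf ?scale1r //.
exact: size_neq0.
Qed.

Lemma B_avgl s u w : finite_subgroup s -> fixed s w -> re_ip (avg s u) w = re_ip u w.
Proof.
move=> fs fw; rewrite BZl B_suml (eq_big_seq (fun=> re_ip u w)); last first.
  by move=> g gs; rewrite -{1}(fw g gs) B_pi.
rewrite big_const_seq count_predT iter_addr_0 -[X in _ * X]mulr_natl mulrA mulVf ?mul1r //.
exact: size_neq0.
Qed.

Lemma B_avg s u v : finite_subgroup s -> re_ip (avg s u) v = re_ip u (avg s v).
Proof.
move=> fs; rewrite -(B_avgl _ fs (avg_fixed v fs)) BC.
by rewrite -(B_avgl v fs (avg_fixed u fs)) BC.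
Qed.

Lemma avg_orthogonal s u w : finite_subgroup s -> fixed s w -> re_ip (u - avg s u) w = 0.
Proof. by move=> fs fw; rewrite BDl BNl B_avgl // subrr. Qed.

Lemma avg_commute s s' v : (forall g h, g \in s -> h \in s' -> (g * h = h * g)%g) ->
  avg s (avg s' v) = avg s' (avg s v).
Proof.
move=> c; rewrite /avg.
under eq_bigr do rewrite linearZ linear_sum.
under [in RHS]eq_bigr do rewrite linearZ linear_sum.
rewrite -!scaler_sumr !scalerA mulrC; congr (_ *: _).
rewrite exchange_big /=; apply: eq_big_seq => h hs'; apply: eq_big_seq => g gs.
by rewrite -!piM c.
Qed.
End RealForm.

(** * Conjugates of the short subgroup under the long one *)

Section ConjugateRelations.
Local Open Scope ring_scope.
Variables (F : finFieldType) (k : 'I_3).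
Local Notation vec := ('rV[F]_3).
Local Open Scope group_scope.

Definition long (t : F) : tgroup F := edge (lo k) (const_mx t).
Definition short (w : vec) : tgroup F := edge (hi k) w.
Definition conj_short (t : F) (w : vec) : tgroup F := long t * short w * (long t)^-1.

Definition conj_word (tw : F * vec) : word F :=
  [:: (lo k, const_mx tw.1); (hi k, tw.2); (lo k, - const_mx tw.1)%R].

Lemma conj_shortE t w : conj_short t w = class (conj_word (t, w)).
Proof. by rewrite /conj_word !class_cons class_nil mulg1 edgeN mulgA. Qed.

Lemma prod_conj_short (s : seq (F * vec)) :
  class (flatten (map conj_word s)) = \prod_(tw <- s) conj_short tw.1 tw.2.
Proof.
elim: s => [|[t w] s IH]; first by rewrite big_nil.
by rewrite big_cons -IH conj_shortE -class_cat.
Qed.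

Definition moment (n : nat) b (s : seq (F * vec)) : F :=
  (\sum_(tw <- s) tw.1 ^+ n * coord (hi k) b tw.2)%R.

Lemma run_conj b s x0 x1 x2 x3 : run k b (x0, x1, x2, x3) (flatten (map conj_word s)) =
  (x0, x1, x2 + (moment 0 b s * x1 + moment 1 b s * x0),
   x3 - (moment 1 b s * x1 + moment 2 b s * x0))%R.
Proof.
have one t w y2 y3 : run k b (x0, x1, y2, y3) (conj_word (t, w)) = (x0, x1,
    y2 + coord (hi k) b w * (x1 + t * x0), y3 - t * coord (hi k) b w * (x1 + t * x0))%R.
  rewrite /conj_word run_lo1 run_hi1 run_lo1 /= !mxE.
  by congr (_, _, _, _); ring.
rewrite /moment; elim: s x2 x3 => [|[t w] s IH] x2 x3.
  by rewrite /= !big_nil !mul0r !addr0 subr0.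
rewrite -[flatten _]/(conj_word (t, w) ++ flatten (map conj_word s)) run_cat one IH !big_cons /=.
by congr (_, _, _, _); ring.
Qed.

Lemma avoids_conj s : avoids k (flatten (map conj_word s)).
Proof. by elim: s => [//|[t w] s IH]; rewrite /= lo_neq hi_neq. Qed.

(** By [run_conj] only the moments of order 0, 1, 2 matter. They are symmetric in the factors, so
    the conjugates commute, and they are quadratic in the nodes, so three nodes suffice for
    interpolation. *)
Lemma prod_conj_eq (s s' : seq (F * vec)) :
  (forall n b, (n <= 2)%N -> moment n b s = moment n b s') ->
  \prod_(tw <- s) conj_short tw.1 tw.2 = \prod_(tw <- s') conj_short tw.1 tw.2.
Proof.
move=> e; rewrite -!prod_conj_short; apply: (class_vertex (avoids_conj s) (avoids_conj s')).
by move=> b [[[x0 x1] x2] x3]; rewrite !run_conj !e.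
Qed.

Lemma coordZ i b (c : F) (w : vec) : coord i b (c *: w)%R = (c * coord i b w)%R.
Proof. by rewrite /coord; case: ifP => _; rewrite mxE. Qed.

Lemma conj_short_commute t t' w w' :
  conj_short t w * conj_short t' w' = conj_short t' w' * conj_short t w.
Proof.
have := @prod_conj_eq [:: (t, w); (t', w')] [:: (t', w'); (t, w)].
rewrite !big_cons !big_nil !mulg1; apply=> n b _.
by rewrite /moment !big_cons !big_nil !addr0 addrC.
Qed.

Lemma conj_shortD t w w' : conj_short t w * conj_short t w' = conj_short t (w + w')%R.
Proof.
by rewrite /conj_short -!mulgA mulKg (mulgA (short w)) /short edgeD.
Qed.

Lemma long0 : long 0%R = 1.
Proof. by apply: edge_trivial => b; rewrite coord_lo mxE. Qed.

Lemma conj_short0 w : conj_short 0%R w = short w.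
Proof.
by rewrite /conj_short long0 mul1g invg1 mulg1.
Qed.

(* Lagrange interpolation at the nodes [0, t1, t2]: [w -> conj_short t w] is
   quadratic in [t]. *)
Lemma conj_short_interpolation t1 t2 : t1 != 0%R -> t2 != 0%R -> t1 != t2 -> forall t w,
  exists w0 w1 w2, conj_short t w = conj_short 0%R w0 * conj_short t1 w1 * conj_short t2 w2.
Proof.
move=> t10 t20 t12 t w.
pose l1 := (t * (t - t2) / (t1 * (t1 - t2)))%R; pose l2 := (t * (t - t1) / (t2 * (t2 - t1)))%R.
exists ((1 - l1 - l2) *: w)%R, (l1 *: w)%R, (l2 *: w)%R.
have := @prod_conj_eq [:: (t, w)] [:: (0%R, (1 - l1 - l2) *: w)%R; (t1, l1 *: w)%R; (t2, l2 *: w)%R].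
rewrite !big_cons !big_nil !mulg1 mulgA; apply=> n b n2.
rewrite /moment !big_cons !big_nil !addr0 /= !coordZ /l1 /l2.
have d1 : (t1 - t2 != 0)%R by rewrite subr_eq0.
have d2 : (t2 - t1 != 0)%R by rewrite subr_eq0 eq_sym.
case: n n2 => [|[|[|//]]] _; rewrite ?expr0 ?expr1 ?expr0n /=; field.
all: by rewrite d1 d2 t10 t20.
Qed.

Lemma longD t t' : long t * long t' = long (t + t')%R.
Proof. by rewrite /long edgeD; congr edge; apply/rowP => j; rewrite !mxE. Qed.

Lemma longN t : long (- t)%R = (long t)^-1.
Proof. by rewrite /long -edgeN; congr edge; apply/rowP => j; rewrite !mxE. Qed.

Lemma conj_short_long s t w : conj_short s w * long t = long t * conj_short (s - t)%R w.
Proof. by rewrite /conj_short addrC -longD longN invMg invgK -!mulgA mulKVg. Qed.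

Lemma long_inj : injective long.
Proof.
move=> t t' /(class_run k) /(_ 0%R (1, 0, 0, 0)%R) /(congr1 (fun q : quad F => q.1.1.2)).
by rewrite !run_lo1 /= !mxE !mulr1 !add0r.
Qed.

Definition longs : seq (tgroup F) := [seq long t | t <- enum F].
Definition conjs (t : F) : seq (tgroup F) := undup [seq conj_short t w | w : vec].

Lemma longs_subgroup : finite_subgroup longs.
Proof.
split; first by rewrite map_inj_uniq ?enum_uniq //; apply: long_inj.
  apply/mapP; exists 0%R; rewrite ?mem_enum //; apply/esym/edge_trivial => b.
  by rewrite coord_lo mxE.
move=> _ _ /mapP[t _ ->] /mapP[t' _ ->]; rewrite longD.
by apply/map_f; rewrite mem_enum.
Qed.

Lemma mem_longs t : long t \in longs. Proof. by apply/map_f; rewrite mem_enum. Qed.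

Lemma mem_conjs t g : reflect (exists w, g = conj_short t w) (g \in conjs t).
Proof.
rewrite mem_undup; apply: (iffP mapP) => [[w _ ->]|[w ->]]; first by exists w.
by exists w; rewrite ?mem_enum.
Qed.

Lemma conjs_subgroup t : finite_subgroup (conjs t).
Proof.
split; first exact: undup_uniq.
  apply/mem_conjs; exists 0%R; rewrite /conj_short /short edge_trivial ?mulg1 ?mulgV //.
  by move=> b; rewrite coord0.
by move=> _ _ /mem_conjs[w ->] /mem_conjs[w' ->]; apply/mem_conjs; exists (w + w')%R; rewrite conj_shortD.
Qed.
End ConjugateRelations.

(** * The angle between the invariants of two edge groups *)

Section Angle.
Local Open Scope ring_scope.
Variables (F : finFieldType) (k : 'I_3) (R : realType) (H : lmodType R[i]).
Variables (ip : {dot H for Num.conj}) (pi : tgroup F -> {linear H -> H}).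
Hypothesis pi1 : forall v, pi 1%g v = v.
Hypothesis piM : forall g h v, pi (g * h)%g v = pi g (pi h v).
Hypothesis pi_unitary : forall g u v, ip (pi g u) (pi g v) = ip u v.
Hypothesis F_large : (103 <= #|F|)%N.
Local Notation B := (re_ip ip).
Local Notation N := (sqnorm ip).
Local Notation long := (long k).
Local Notation conj_short := (@conj_short F k).
Local Notation Q t := (avg pi (conjs k t)).
Local Notation PA := (avg pi (longs F k)).

Definition long_fixed v := forall t, pi (long t) v = v.
Definition closure_fixed v := forall t w, pi (conj_short t w) v = v.
Definition short_fixed v := forall w, pi (conj_short 0 w) v = v.

Lemma PA_fixed v : long_fixed (PA v).
Proof. by move=> t; apply: (avg_fixed piM v (longs_subgroup F k)); apply: mem_longs. Qed.

Lemma B_PA u v : long_fixed v -> B (PA u) v = B u v.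
Proof.
move=> fv; apply: (B_avgl pi_unitary _ (longs_subgroup F k)).
by move=> _ /mapP[t _ ->].
Qed.

Lemma Q_fixed t v w : pi (conj_short t w) (Q t v) = Q t v.
Proof. by apply: (avg_fixed piM v (conjs_subgroup k t)); apply/mem_conjs; exists w. Qed.

Lemma B_Q t u v : B (Q t u) v = B u (Q t v).
Proof. exact: (B_avg piM pi_unitary _ _ (conjs_subgroup k t)). Qed.

Lemma Q_id t v : (forall w, pi (conj_short t w) v = v) -> Q t v = v.
Proof.
move=> fv; apply: (avg_id (conjs_subgroup k t)) => _ /mem_conjs[w ->]; exact: fv.
Qed.

Lemma Q_commute t t' v : Q t (Q t' v) = Q t' (Q t v).
Proof.
apply: (avg_commute piM) => _ _ /mem_conjs[w ->] /mem_conjs[w' ->].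
exact: conj_short_commute.
Qed.

(** The three projections commute, so their product is fixed by all three conjugates, and by
    interpolation these generate the others. *)
Lemma Q_closure t1 t2 v : t1 != 0 -> t2 != 0 -> t1 != t2 ->
  closure_fixed (Q 0 (Q t1 (Q t2 v))).
Proof.
move=> t10 t20 t12 t w.
have [w0 [w1 [w2 ->]]] := conj_short_interpolation k t10 t20 t12 t w.
have f2 : pi (conj_short t2 w2) (Q 0 (Q t1 (Q t2 v))) = Q 0 (Q t1 (Q t2 v)).
  by rewrite (Q_commute t1) (Q_commute 0) Q_fixed.
have f1 : pi (conj_short t1 w1) (Q 0 (Q t1 (Q t2 v))) = Q 0 (Q t1 (Q t2 v)).
  by rewrite (Q_commute 0) Q_fixed.
by rewrite 2!piM f2 f1 Q_fixed.
Qed.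

Lemma B_closure_Q t u v : closure_fixed v -> B (Q t u) v = B u v.
Proof. by move=> fv; rewrite B_Q Q_id. Qed.

Lemma closure_long t v : closure_fixed v -> closure_fixed (pi (long t) v).
Proof. by move=> fv s w; rewrite -piM conj_short_long piM fv. Qed.

Lemma closure_PA v : closure_fixed v -> closure_fixed (PA v).
Proof.
move=> fv t w; rewrite /avg linearZ linear_sum /=; congr (_ *: _).
by apply: eq_big_seq => _ /mapP[s _ ->]; apply: closure_long.
Qed.

Lemma exists_nodes : exists t1 t2 : F, [/\ t1 != 0, t2 != 0 & t1 != t2].
Proof.
have c : (2 < #|F|)%N by apply: leq_trans F_large.
have : ~~ ([set: F] \subset [set 0; 1]).
  apply: contraL c => /subset_leq_card; rewrite cardsT -leqNgt => /leq_trans -> //.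
  by rewrite cards2; case: (_ != _).
case/subsetPn => t _; rewrite !inE negb_or => /andP[t0 t1].
by exists 1, t; split=> //; [exact: oner_neq0|rewrite eq_sym].
Qed.

(* The vectors [Q t y], [t != 0], are pairwise orthogonal, because
   [Q s (Q t y)] is invariant under the normal closure of the short subgroup;
   Bessel's inequality bounds the correlations of [y] with its translates. *)
Lemma PA_contracts x : short_fixed x ->
  (forall z, long_fixed z -> short_fixed z -> B x z = 0) -> 9 * N (PA x) <= N x.
Proof.
move=> fx orth; have [t1 [t2 [t10 t20 t12]]] := exists_nodes.
(* [x0] is the projection of [x] to the invariants of the normal closure of the short subgroup.
   Averaging over the long subgroup stays in this space, so [PA x0] is invariant under both
   subgroups; being orthogonal to [x], it vanishes. *)
pose x0 := Q 0 (Q t1 (Q t2 x)); have cx0 : closure_fixed x0 by apply: Q_closure.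
have Bx0 z : closure_fixed z -> B x0 z = B x z by move=> cz; rewrite !B_closure_Q.
have PA0 : PA x0 = 0.
  apply: (@N_eq0 _ _ ip); rewrite /sqnorm B_PA; last exact: PA_fixed.
  have cz := closure_PA cx0; rewrite Bx0 //; apply: orth; first exact: PA_fixed.
  by move=> w; apply: cz.
pose y := x - x0.
have fy : short_fixed y by move=> w; rewrite linearB fx cx0.
have By z : closure_fixed z -> B y z = 0 by move=> cz; rewrite BDl BNl Bx0 // subrr.
have -> : PA x = PA y.
  by rewrite -[x](subrK x0) -/y /avg; under eq_bigr do rewrite linearD; 
     rewrite big_split scalerDr -!/(avg _ _ _) PA0 addr0.
have Nx : N y <= N x.
  have -> : N x = N y + N x0.
    by rewrite -[in LHS](subrK x0 x) -/y ND By // mulr0 addr0.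
  rewrite lerDl; exact: N_ge0.
have Qy0 : Q 0 y = y by apply: Q_id.
have QQ s t : s != 0 -> t != 0 -> s != t -> Q s (Q t y) = 0.
  move=> s0 t0 st; have cu := Q_closure y s0 t0 st.
  have -> : Q s (Q t y) = Q 0 (Q s (Q t y)).
    by rewrite -{1}Qy0 (Q_commute t 0) (Q_commute s 0).
  by apply: (@N_eq0 _ _ ip); rewrite /sqnorm !B_closure_Q // By.
pose E := [seq t <- enum F | t != 0].
have NQ t : B y (Q t y) = N (Q t y).
  by rewrite /sqnorm B_Q (Q_id (@Q_fixed t y)).
have bessel : \sum_(t <- E) N (Q t y) <= N y.
  pose S := \sum_(t <- E) Q t y.
  have NS : N S = \sum_(t <- E) N (Q t y).
    rewrite /sqnorm B_suml; apply: eq_big_seq => t tE; rewrite B_sumr.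
    have uE : uniq E by rewrite filter_uniq ?enum_uniq.
    rewrite (bigD1_seq t tE uE) /= [X in _ + X]big_seq_cond [X in _ + X]big1 ?addr0 // => s.
    rewrite mem_filter in tE; rewrite mem_filter => /andP[/andP[s0 _] st].
    by case/andP: tE => t0 _; rewrite B_Q QQ // 1?eq_sym // BC B0l.
  have BS : B y S = \sum_(t <- E) N (Q t y) by rewrite B_sumr; apply: eq_bigr.
  by have := N_ge0 ip (y - S); rewrite NB NS BS; lra.
have NPA : N (PA y) = #|F|%:R^-1 * \sum_(t <- enum F) B (pi (long t) y) y.
  rewrite /sqnorm B_PA; last exact: PA_fixed.
  by rewrite BC /avg size_map -cardE BZl B_suml big_map.
(* Since [y] is fixed by the short subgroup, its translate by [long t] is fixed by the conjugate at
   [t], and only the component [Q t y] of [y] contributes. *)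
have corr t : 2 * B (pi (long t) y) y <= 8^-1 * N y + 8 * N (Q t y).
  have e : B (pi (long t) y) y = B (pi (long t) y) (Q t y).
    rewrite -B_Q Q_id // => w; rewrite -[in LHS]piM conj_short_long subrr piM.
    by rewrite fy.
  have := AMGM ip (c := 8^-1) (pi (long t) y) (Q t y).
  by rewrite -e invrK (N_pi pi_unitary); apply; rewrite invr_gt0.
have pl0 : pi (long 0) y = y.
  by rewrite long0.
(* The 10 is 2 from [t = 0] plus 8 from Bessel's inequality; every other [t] adds 1/8. *)
have sum_le : 2 * \sum_(t <- enum F) B (pi (long t) y) y <= (10 + #|F|%:R / 8) * N y.
  rewrite (bigD1_seq 0) ?mem_enum ?enum_uniq //= pl0 -big_filter -/E.
  have : \sum_(t <- E) 2 * B (pi (long t) y) y <= \sum_(t <- E) (8^-1 * N y + 8 * N (Q t y)).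
    by apply: ler_sum.
  rewrite big_split -!mulr_sumr /= big_const_seq count_predT iter_addr_0.
  have sE : (size E)%:R <= #|F|%:R :> R.
    by rewrite ler_nat cardE size_filter count_size.
  have : N y *+ size E <= #|F|%:R * N y.
    by rewrite -[N y *+ _]mulr_natl ler_wpM2r // N_ge0.
  by rewrite -/(sqnorm _ y); lra.
(* The factor 1/9 requires [10 + q / 8 <= 2 q / 9], that is [q >= 720 / 7]; the least such integer
   is 103. *)
have q0 : 103 <= #|F|%:R :> R by rewrite (ler_nat _ 103).
rewrite NPA; apply: le_trans Nx; have Ny := N_ge0 ip y.
move: sum_le; set T := \sum_(t <- _) _; set q := #|F|%:R : R => h.
have q1 : 0 < q by lra.
rewrite -(ler_pM2l q1) mulrCA (mulrA q) divff ?gt_eqF // mul1r.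
have : (103 - q) * N y <= 0 by rewrite mulr_le0_ge0 // subr_le0.
by lra.
Qed.

Lemma angle r x : long_fixed r -> short_fixed x ->
  (forall z, long_fixed z -> short_fixed z -> B x z = 0) ->
  2 * B r x <= 3^-1 * (N r + N x).
Proof.
move=> fr fx orth; have h := PA_contracts fx orth.
have -> : B r x = B r (PA x) by rewrite -[RHS]BC B_PA // BC.
have := AMGM ip (c := 3^-1) r (PA x); rewrite invrK => /(_ _); lra.
Qed.
End Angle.

(** * Limits of geometrically convergent sequences *)

Section GeometricLimit.
Import numFieldNormedType.Exports.
Local Open Scope ring_scope.
Local Open Scope classical_set_scope.
Variables (R : realType) (H : completeNormedModType R[i]) (z : nat -> H) (c : R).
Hypothesis c_ge0 : 0 <= c.
Hypothesis z_step : forall n, `|z n.+1 - z n| <= (c * (7 / 8) ^+ n)%:C%C.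

Lemma geometric_tail n m : `|z (n + m)%N - z n| <= (8 * c * (7 / 8) ^+ n)%:C%C.
Proof.
(* The exact partial sum of the geometric series makes the induction work; [8 = 1 / (1 - 7/8)]. *)
suff h : `|z (n + m)%N - z n| <= (8 * c * ((7 / 8) ^+ n - (7 / 8) ^+ (n + m)))%:C%C.
  apply: le_trans h _; rewrite lecR ler_wpM2l ?mulr_ge0 // lerBlDr lerDl.
  by rewrite exprn_ge0 // divr_ge0.
elim: m => [|m IH]; first by rewrite addn0 !subrr normr0 mulr0 lecR.
rewrite addnS -(subrKA (z (n + m)%N)).
apply: le_trans (ler_normD _ _) _; apply: le_trans (lerD (z_step _) IH) _.
by rewrite -rmorphD lecR exprS; lra.
Qed.

Lemma geometric_small (e : R) : 0 < e -> exists n, 8 * c * (7 / 8) ^+ n < e.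
Proof.
move=> e0; have h : (fun n => 8 * c * (7 / 8) ^+ n : R) @ \oo --> (0 : R).
  have := @cvg_geometric R (8 * c) (7 / 8); apply.
  by rewrite ger0_norm ?divr_ge0 //; lra.
have := h; move/cvgrPdist_lt => /(_ e e0) [n _ hn].
exists n; have := hn n (leqnn n); rewrite /= sub0r normrN ger0_norm //.
by rewrite !mulr_ge0 // exprn_ge0 // divr_ge0.
Qed.

Lemma complex_eps (e : R[i]) : 0 < e -> exists2 r : R, 0 < r & e = r%:C%C.
Proof.
case: e => a b; rewrite ltcE /= => /andP[/eqP -> a0]; by exists a.
Qed.

Lemma geometric_limit : exists l : H, forall n, `|l - z n| <= (8 * c * (7 / 8) ^+ n)%:C%C.
Proof.
have cz : cauchy (z @ \oo).
  apply/cauchyP => e /complex_eps[r r0 ->].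
  have [n hn] := geometric_small r0; exists (z n); exists n => // m /= nm.
  rewrite -ball_normE /ball_ /= distrC -(subnKC nm).
  by apply: le_lt_trans (geometric_tail n _) _; rewrite ltcR.
have /cvg_ex[l hl] : cvg (z @ \oo) by apply: cauchy_cvg.
exists l => n; apply/ler_addgt0Pl => e e0.
have /cvgrPdist_lt /(_ e e0) [m _ hm] := hl.
have := hm (n + m)%N (leq_addl _ _) => /= h.
rewrite -(subrKA (z (n + m)%N)); apply: le_trans (ler_normD _ _) _.
by apply: lerD (ltW h) (geometric_tail _ _).
Qed.
End GeometricLimit.

(** * Alternating projections onto the invariants of the vertex groups *)

Section PropertyT.
Import numFieldNormedType.Exports.
Local Open Scope ring_scope.
Variables (F : finFieldType) (R : realType).
Hypothesis F_large : (103 <= #|F|)%N.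

Lemma edge_lo_long k (v : 'rV[F]_3) : edge (lo k) v = long k (v 0 0).
Proof.
have -> : edge (lo k) v = (long k (v 0 0) * edge (lo k) (v - const_mx (v 0 0)))%g.
  by rewrite edgeD addrC subrK.
by rewrite edge_lo_trivial ?mulg1 // !mxE subrr.
Qed.

Definition vgroup (k : 'I_3) : seq (tgroup F) := sval (cid (finite_vertex_group F k)).

Lemma mem_vgroup k g : g \in vgroup k <-> Xgrp k g.
Proof. by rewrite /vgroup; case: cid => s [us h] /=; apply: h. Qed.

Lemma vgroup_subgroup k : finite_subgroup (vgroup k).
Proof.
split; first by rewrite /vgroup; case: cid => s [].
  by apply/mem_vgroup; exists [::].
by move=> g h /mem_vgroup Xg /mem_vgroup Xh; apply/mem_vgroup/XgrpM.
Qed.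

Section Representation.
Variables (H : completeNormedModType R[i]) (ip : {dot H for Num.conj}).
Variable pi : tgroup F -> {linear H -> H}.
Hypothesis ip_norm : induces_norm ip.
Hypothesis rep : unitary_representation ip pi.
Let pi1 : forall v, pi 1%g v = v. Proof. by case: rep. Qed.
Let piM : forall g h v, pi (g * h)%g v = pi g (pi h v). Proof. by case: rep. Qed.
Let pi_unitary : forall g u v, ip (pi g u) (pi g v) = ip u v. Proof. by case: rep. Qed.
Local Notation B := (re_ip ip).
Local Notation N := (sqnorm ip).
Local Notation P k := (avg pi (vgroup k)).
Local Notation invariant k := (fixed pi (vgroup k)).

Definition nrm (v : H) : R := Num.sqrt (N v).

Lemma normE v : `|v| = (nrm v)%:C%C.
Proof.
have h : 0 <= (nrm v)%:C%C by rewrite ler0c sqrtr_ge0.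
apply/eqP; rewrite -(eqrXn2 (n := 2) isT (normr_ge0 v) h) ip_norm ipN.
by rewrite -rmorphXn sqr_sqrtr // N_ge0.
Qed.

Lemma nrm_tri u v : nrm (u + v) <= nrm u + nrm v.
Proof. by have := ler_normD u v; rewrite !normE -rmorphD lecR. Qed.

Lemma nrmN u : nrm (- u) = nrm u. Proof. by rewrite /nrm NN. Qed.

Lemma nrm_pi g u : nrm (pi g u) = nrm u. Proof. by rewrite /nrm N_pi. Qed.

Lemma nrm_le (a : R) u : 0 <= a -> N u <= a ^+ 2 -> nrm u <= a.
Proof. by move=> a0 h; rewrite -(ger0_norm a0) -sqrtr_sqr ler_wsqrtr. Qed.

Lemma N_nrm u : N u = nrm u ^+ 2. Proof. by rewrite sqr_sqrtr // N_ge0. Qed.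

Lemma invariant_edge k i v u : invariant k u -> i != k -> pi (edge i v) u = u.
Proof.
by move=> iu ik; apply: iu; apply/mem_vgroup/(AgrpX ik); exists v.
Qed.

Lemma invariant_of_edges k u : long_fixed k pi u -> short_fixed k pi u -> invariant k u.
Proof.
move=> lu su g /mem_vgroup[w aw ->]; elim: w aw => [_|[i v] w IH /andP[/= ik aw]].
  by rewrite class_nil pi1.
rewrite class_cons piM IH //; case: (lo_or_hi ik) => ->; first by rewrite edge_lo_long.
by have := su v; rewrite conj_short0.
Qed.

Lemma P_invariant k u : invariant k (P k u).
Proof. exact: avg_fixed (vgroup_subgroup k). Qed.

Lemma residual_orthogonal k u z : invariant k z -> B (u - P k u) z = 0.
Proof. exact: avg_orthogonal (vgroup_subgroup k). Qed.

Lemma residual_edge k s i v u : invariant s u -> i != s -> i != k ->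
  pi (edge i v) (u - P k u) = u - P k u.
Proof.
move=> iu is_ ik; rewrite linearB (invariant_edge _ iu is_).
by rewrite (invariant_edge _ (@P_invariant k u) ik).
Qed.

(** The residual of [u] is fixed by the edge group [t], common to the vertex groups [s] and [r], and
    that of [v] by the edge group [s]. Both are orthogonal to the invariants of [r], so [angle]
    applies. *)
Lemma residual_angle s t r u v : s != t -> r = third s t -> invariant s u -> invariant t v ->
  2 * B (u - P r u) (v - P r v) <= 3^-1 * (N (u - P r u) + N (v - P r v)).
Proof.
move=> st er iu iv; have sr : s != r by rewrite er eq_sym third_neql.
have tr : t != r by rewrite er eq_sym third_neqr.
have ts : t != s by rewrite eq_sym.
have orth x z : long_fixed r pi z -> short_fixed r pi z -> B (x - P r x) z = 0.
  by move=> lz sz; apply/residual_orthogonal/invariant_of_edges.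
case: (lo_or_hi sr) (lo_or_hi tr) => [es|es] [et|et].
- by case/eqP: st; apply: (etrans es (esym et)).
- have long_v : long_fixed r pi (v - P r v) by move=> x; rewrite /long -es; apply: (residual_edge _ iv).
  have short_u : short_fixed r pi (u - P r u).
    by move=> w; rewrite conj_short0 /short -et; apply: (residual_edge _ iu).
  have := angle pi1 piM pi_unitary F_large long_v short_u (orth u).
  by rewrite BC [N _ + _]addrC.
- have long_u : long_fixed r pi (u - P r u) by move=> x; rewrite /long -et; apply: (residual_edge _ iu).
  have short_v : short_fixed r pi (v - P r v).
    by move=> w; rewrite conj_short0 /short -es; apply: (residual_edge _ iv).
  exact: (angle pi1 piM pi_unitary F_large long_u short_v (orth v)).
- by case/eqP: st; apply: (etrans es (esym et)).
Qed.

(** The difference of the projections is orthogonal to that of the residuals, and for the residuals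
    cosine 1/3 gives [N (u - v) >= (1 - 1/3)] times the sum of their square norms. *)
Lemma residual_bound s t u v : s != t -> invariant s u -> invariant t v ->
  N (u - P (third s t) u) + N (v - P (third s t) v) <= 3 / 2 * N (u - v).
Proof.
move=> st iu iv; have := residual_angle st erefl iu iv; set r := third s t => h.
have -> : u - v = (P r u - P r v) + ((u - P r u) - (v - P r v)).
  by rewrite [RHS]addrC [RHS]addrACA subrK -opprD subrK.
have orth : B (P r u - P r v) ((u - P r u) - (v - P r v)) = 0.
  have i : invariant r (P r u - P r v).
    by move=> g gr; rewrite linearB !P_invariant.
  by rewrite BC BDl BNl !residual_orthogonal // subrr.
by rewrite (ND ip (P r u - P r v)) orth (NB ip (u - P r u)); have := N_ge0 ip (P r u - P r v); lra.
Qed.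

Definition pairing := ('I_3 * 'I_3 * H * H)%type.

Definition pairing_ok (p : pairing) : Prop :=
  let: (s, t, u, v) := p in [/\ s != t, invariant s u & invariant t v].

Definition gap (p : pairing) : R := let: (s, t, u, v) := p in N (u - v).

(* Alternating projection: one of the two vectors is replaced by the projection of
   the other onto the invariants of the third vertex group. *)
Definition refine (p : pairing) : pairing :=
  let: (s, t, u, v) := p in let r := third s t in
  if N (u - P r u) <= N (v - P r v) then (s, r, u, P r u) else (t, r, v, P r v).

Lemma refine_ok p : pairing_ok p -> pairing_ok (refine p).
Proof.
case: p => [[[s t] u] v] /= [st iu iv]; case: ifP => _; split=> //.
- by rewrite eq_sym third_neql.
- exact: P_invariant.
- by rewrite eq_sym third_neqr.
- exact: P_invariant.
Qed.

Lemma gap_refine p : pairing_ok p -> gap (refine p) <= 3 / 4 * gap p.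
Proof.
case: p => [[[s t] u] v] /= [st iu iv]; have := residual_bound st iu iv.
case: (leP (N (u - P (third s t) u)) (N (v - P (third s t) v))) => /= h1 h2; lra.
Qed.

Lemma point_refine p : N ((refine p).1.2 - p.1.2) <= gap p.
Proof.
case: p => [[[s t] u] v] /=; case: ifP => _ /=.
  by rewrite subrr /sqnorm B0l N_ge0.
by rewrite -NN opprB.
Qed.

Lemma NB_le2 u v w : N (u - w) <= 2 * (N (u - v) + N (v - w)).
Proof.
have -> : u - w = (u - v) + (v - w) by rewrite addrA subrK.
by move: (u - v) (v - w) => a b; have := N_ge0 ip (a - b); rewrite NB ND; lra.
Qed.

Lemma near_invariant p k : pairing_ok p -> exists2 w, invariant k w & N (p.1.2 - w) <= 4 * gap p.
Proof.
case: p => [[[s t] u] v] /= [st iu iv]; have g0 := N_ge0 ip (u - v).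
have [->|ks] := eqVneq k s.
  by exists u => //; rewrite subrr {1}/sqnorm B0l; lra.
have [->|kt] := eqVneq k t; first by exists v => //; lra.
have ts : t != s by rewrite eq_sym.
have -> : k = third s t by apply: third_uniq => //; rewrite eq_sym.
have := residual_bound st iu iv; set r := third s t => h.
have := N_ge0 ip (u - P r u); have := N_ge0 ip (v - P r v) => h1 h2.
by exists (P r u); [exact: P_invariant|lra].
Qed.

Lemma move_bound p k g : pairing_ok p -> g \in vgroup k -> N (pi g p.1.2 - p.1.2) <= 16 * gap p.
Proof.
move=> ok gk; have [w iw h] := near_invariant k ok.
have := NB_le2 (pi g p.1.2) w p.1.2; rewrite -{1}(iw g gk) -linearB N_pi //.
by rewrite -(NN _ (w - _)) opprB; lra.
Qed.

Lemma invariant_limit (c : R) (p0 : pairing) : pairing_ok p0 -> 0 <= c -> gap p0 <= c ^+ 2 ->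
  exists l, (forall g, pi g l = l) /\ nrm (l - p0.1.2) <= 8 * c.
Proof.
move=> ok0 c0 gap0; pose p n := iter n refine p0; pose z n := (p n).1.2.
have ok n : pairing_ok (p n) by elim: n => // n IH; apply: refine_ok.
(* The ratio comes from [3/4 <= (7/8)^2]. *)
have gapn n : gap (p n) <= (c * (7 / 8) ^+ n) ^+ 2.
  elim: n => [|n IH]; first by rewrite mulr1.
  apply: le_trans (gap_refine (ok n)) _.
  have -> : c * (7 / 8) ^+ n.+1 = 7 / 8 * (c * (7 / 8) ^+ n) by rewrite exprS mulrCA.
  rewrite exprMn; have : 0 <= (c * (7 / 8) ^+ n) ^+ 2 by apply: sqr_ge0.
  by move: IH; set q := (c * _) ^+ 2; lra.
have cn n : 0 <= c * (7 / 8) ^+ n by rewrite mulr_ge0 // exprn_ge0 // divr_ge0.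
have z_step n : `|z n.+1 - z n| <= (c * (7 / 8) ^+ n)%:C%C.
  by rewrite normE lecR; apply: nrm_le => //; apply: le_trans (point_refine (p n)) (gapn n).
have [l hl] := geometric_limit c0 z_step.
have hl' n : nrm (l - z n) <= 8 * c * (7 / 8) ^+ n by have := hl n; rewrite normE lecR.
exists l; split; last by have := hl' 0; rewrite mulr1.
have inv k g : g \in vgroup k -> pi g l = l.
  move=> gk; apply/eqP; rewrite -subr_eq0; apply/eqP/(@N_eq0 _ _ ip).
  (* The 20 is 8 twice, for the distance from [l] to [z n], plus 4, the square root of 16, for the
     motion of [z n]. *)
  have small n : nrm (pi g l - l) <= 20 * c * (7 / 8) ^+ n.
    have -> : pi g l - l = pi g (l - z n) + ((pi g (z n) - z n) + (z n - l)).
      by rewrite linearB !subrKA.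
    have h2 : nrm (pi g (z n) - z n) <= 4 * (c * (7 / 8) ^+ n).
      apply: nrm_le; first by rewrite mulr_ge0.
      apply: le_trans (move_bound (ok n) gk) _; rewrite exprMn; have := gapn n; lra.
    apply: le_trans (nrm_tri _ _) _; rewrite nrm_pi; have := nrm_tri (pi g (z n) - z n) (z n - l).
    by have := hl' n; rewrite -(nrmN (z n - l)) opprB; lra.
  have [e0|e0] := leP (nrm (pi g l - l)) 0.
    have n0 : nrm (pi g l - l) = 0 by apply/eqP; rewrite eq_le e0 sqrtr_ge0.
    by rewrite N_nrm n0 expr0n.
  have [n hn] := geometric_small (mulr_ge0 (ler0n R 4) c0) e0.
  by have := small n; have := cn n; move: hn; lra.
move=> g; rewrite -(class_repr g); elim: (generic_quotient.repr g) => [|[i v] w IH].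
  by rewrite class_nil pi1.
rewrite class_cons piM IH; have [k ik] := other_index i; apply: (inv k).
by apply/mem_vgroup/(AgrpX ik); exists v.
Qed.

Lemma avg_near k v (e : R) : (forall g, g \in vgroup k -> nrm (pi g v - v) <= e) ->
  nrm (P k v - v) <= e.
Proof.
move=> h; have fs := vgroup_subgroup k; have s0 := size_neq0 R fs.
have h0 : 0 <= e by apply: le_trans (h 1%g _); [exact: sqrtr_ge0|case: fs].
have -> : P k v - v = ((size (vgroup k))%:R^-1)%:C%C *: \sum_(g <- vgroup k) (pi g v - v).
  rewrite sumrB scalerBr; congr (_ - _); rewrite big_const_seq count_predT iter_addr_0.
  rewrite -[v *+ _]scaler_nat scalerA -[X in _ * X](rmorph_nat (real_complex R)) -rmorphM mulVf //.
  by rewrite scale1r.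
have : `|\sum_(g <- vgroup k) (pi g v - v)| <= ((size (vgroup k))%:R * e)%:C%C.
  apply: le_trans (ler_norm_sum _ _ _) _.
  apply: (@le_trans _ _ (\sum_(g <- vgroup k) e%:C%C)).
    by rewrite big_seq [leRHS]big_seq; apply: ler_sum => g gk; rewrite normE lecR h.
  by rewrite big_const_seq count_predT iter_addr_0 rmorphM rmorph_nat mulr_natl.
rewrite -lecR -normE normrZ => h1.
have n0 : 0 <= (size (vgroup k))%:R^-1 :> R by rewrite invr_ge0.
rewrite ger0_norm ?ler0c //.
apply: le_trans (ler_wpM2l _ h1) _; first by rewrite ler0c.
by rewrite -rmorphM lecR mulrA mulVf // mul1r.
Qed.

Lemma almost_invariant_invariant v : v != 0 ->
  (forall k g, g \in vgroup k -> nrm (pi g v - v) <= 20^-1 * nrm v) ->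
  exists2 l, l != 0 & forall g, pi g l = l.
Proof.
move=> v0 h; set e := 20^-1 * nrm v in h.
have nv : 0 < nrm v.
  by have := normr_gt0 v; rewrite v0 normE (ltcR 0).
pose p0 : pairing := (0, 1, P 0 v, P 1 v).
have h0 := avg_near (h 0); have h1 := avg_near (h 1).
have e0 : 0 < e by rewrite mulr_gt0 // invr_gt0.
have ok0 : pairing_ok p0 by split=> //; apply: P_invariant.
have [||l [inv near]] := @invariant_limit (2 * e) p0 ok0.
- by rewrite mulr_ge0 // ltW.
- have le2 : nrm (P 0 v - P 1 v) <= 2 * e.
    have -> : P 0 v - P 1 v = (P 0 v - v) - (P 1 v - v) by rewrite opprB addrA subrK.
    by apply: le_trans (nrm_tri _ _) _; rewrite nrmN; lra.
  rewrite /gap /= N_nrm; apply: lerXn2r => //; rewrite nnegrE ?sqrtr_ge0 //.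
  by rewrite mulr_ge0 // ltW.
exists l => //; apply/eqP => l0; rewrite l0 sub0r nrmN /= in near.
have := nrm_tri (P 0 v) (- (P 0 v - v)); rewrite nrmN opprB addrC subrK.
by rewrite /e in e0 near h0 h1; lra.
Qed.
End Representation.

Lemma tgroup_property_T : kazhdan_property_T R (tgroup F).
Proof.
exists (flatten [seq vgroup k | k : 'I_3]), 20^-1; split; first by rewrite invr_gt0.
move=> H ip pi nip rep [v v0 h]; apply: (almost_invariant_invariant nip rep v0) => k g gk.
have /h : g \in flatten [seq vgroup k | k : 'I_3].
  by apply/flattenP; exists (vgroup k) => //; apply/map_f; rewrite mem_enum.
by rewrite !(normE nip) -rmorphM ltcR => /ltW.
Qed.
End PropertyT.

(** * Finite simple quotients *)

Section Shears.
Local Open Scope group_scope.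
Local Open Scope ring_scope.
Variables (F : finFieldType) (m : nat).
Local Notation n := m.+1.
Local Notation mat := 'M[F]_n.
(** Matrices over [M_n(F)] act on this finite set, so the image of the group lies in a finite
    permutation group. *)
Definition space := {ffun 'I_3 -> 'cV[F]_n}.

Definition shear_fun (i j : 'I_3) (x : mat) (w : space) : space :=
  [ffun k => if k == i then w k + x *m w j else w k].

Lemma shear_funD i j x y w : i != j ->
  shear_fun i j y (shear_fun i j x w) = shear_fun i j (x + y) w.
Proof.
move=> ij; apply/ffunP => k; rewrite !ffunE (eq_sym j i) (negPf ij).
by case: (k == i); rewrite // mulmxDl addrA.
Qed.

Lemma shear_fun0 i j w : shear_fun i j 0 w = w.
Proof. by apply/ffunP => k; rewrite ffunE mul0mx addr0 if_same. Qed.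

Lemma shear_inj i j x (ij : i != j) : injective (shear_fun i j x).
Proof.
by apply: (can_inj (g := shear_fun i j (- x))) => w; rewrite shear_funD // subrr shear_fun0.
Qed.

(* For [i = j] the junk value is the identity. *)
Definition shear (i j : 'I_3) (x : mat) : {perm space} :=
  if pselect (i != j) is left ij then perm (@shear_inj i j x ij) else 1%g.

Lemma shearE i j x w : i != j -> shear i j x w = shear_fun i j x w.
Proof. by move=> ij; rewrite /shear; case: pselect => // h; rewrite permE. Qed.

Lemma shearD i j x y : i != j -> (shear i j x * shear i j y)%g = shear i j (x + y).
Proof. by move=> ij; apply/permP => w; rewrite permM !shearE // shear_funD. Qed.

Lemma shear0 i j : i != j -> shear i j 0 = 1%g.
Proof. by move=> ij; apply/permP => w; rewrite shearE // perm1 shear_fun0. Qed.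

Lemma shearN i j x : i != j -> shear i j (- x) = (shear i j x)^-1%g.
Proof. by move=> ij; apply: (mulgI (shear i j x)); rewrite mulgV shearD // subrr shear0. Qed.

(** The sign comes from composing permutations from left to right. *)
Lemma shearR i j k x y : i != j -> j != k -> i != k ->
  [~ shear i j x, shear j k y]%g = shear i k (- (x *m y)).
Proof.
move=> ij jk ik; rewrite /commg /conjg -!shearN //; apply/permP => w.
rewrite !permM !shearE //; apply/ffunP => l; rewrite !ffunE !eqxx.
rewrite (eq_sym j i) (negPf ij) (eq_sym k j) (negPf jk) (eq_sym k i) (negPf ik) /=.
have [->|li] := eqVneq l i; first rewrite (negPf ij).
  by rewrite !mulNmx mulmxDr mulmxN !mulmxA addrA subrK.
by case: eqP => // ->; rewrite mulNmx subrK.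
Qed.

Section Normal.
Variables (Q M : {group {perm space}}).
Hypothesis nMQ : Q \subset 'N(M).
Hypothesis Q1 : forall i j, i != j -> shear i j 1 \in Q.

Lemma commM x y : x \in M -> y \in Q -> [~ x, y]%g \in M.
Proof.
move=> xM yQ; rewrite commgEl groupM ?groupV // memJ_norm //.
exact: (subsetP nMQ).
Qed.

Lemma commQ x y : x \in Q -> y \in M -> [~ x, y]%g \in M.
Proof. by move=> xQ yM; rewrite -invg_comm groupV commM. Qed.

Lemma shearNM i j x : i != j -> (shear i j (- x) \in M) = (shear i j x \in M).
Proof. by move=> ij; rewrite shearN // groupV. Qed.

(** Commutators with unit shears carry the coefficient to another position, changing one index at a
    time. *)
Lemma shear_spread i j x : i != j -> shear i j x \in M ->
  forall i' j', i' != j' -> shear i' j' x \in M.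
Proof.
have right a b c z : a != b -> b != c -> a != c -> shear a b z \in M -> shear a c z \in M.
  move=> ab bc ac zM; rewrite -shearNM // -[z]mulmx1 -(shearR z 1 ab bc ac).
  by apply: commM => //; apply: Q1.
have left a b c z : a != b -> b != c -> a != c -> shear b c z \in M -> shear a c z \in M.
  move=> ab bc ac zM; rewrite -shearNM // -[z]mul1mx -(shearR 1 z ab bc ac).
  by apply: commQ => //; apply: Q1.
move=> ij xM; set k := third i j.
have ki : k != i by apply: third_neql.
have kj : k != j by apply: third_neqr.
have ji : j != i by rewrite eq_sym.
have ik : i != k by rewrite eq_sym.
have jk : j != k by rewrite eq_sym.
have h_ik := right _ _ _ _ ij jk ik xM; have h_kj := left _ _ _ _ ki ij kj xM.
have h_ki := right _ _ _ _ kj ji ki h_kj; have h_jk := left _ _ _ _ ji ik jk h_ik.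
have h_ji := right _ _ _ _ jk ki ji h_jk.
have cases l : l = i \/ l = j \/ l = k.
  have [->|li] := eqVneq l i; first by left.
  have [->|lj] := eqVneq l j; first by right; left.
  by right; right; apply: third_uniq => //; rewrite eq_sym.
move=> i' j'; case: (cases i') => [|[]] ->; case: (cases j') => [|[]] -> // ne;
  by rewrite eqxx in ne.
Qed.
End Normal.

(** Multiplying [corner] by powers of the shift [upper] on both sides gives every matrix unit. *)
Definition upper : mat := \matrix_(i, j) (j == i.+1 :> nat)%:R.
Definition corner : mat := delta_mx ord_max ord0.

Lemma upper_delta (i : 'I_n) (j : 'I_n) (i' : 'I_n) : i = i'.+1 :> nat ->
  upper *m delta_mx i j = delta_mx i' j.
Proof.
move=> ii'; apply/matrixP => a b; rewrite !mxE (bigD1 i) //= big1 => [|c ci].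
  by rewrite !mxE eqxx addr0 ii' eqSS andTb; case: (b == j); rewrite ?andbT ?andbF ?mulr1 ?mulr0 // eq_sym.
by rewrite !mxE (negPf ci) mulr0.
Qed.

Lemma delta_upper (i : 'I_n) (j : 'I_n) (j' : 'I_n) : j' = j.+1 :> nat ->
  delta_mx i j *m upper = delta_mx i j'.
Proof.
move=> jj'; apply/matrixP => a b; rewrite !mxE (bigD1 j) //= big1 => [|c cj].
  by rewrite !mxE eqxx addr0 -jj' andbT; case: (a == i); rewrite ?mul1r ?mul0r.
by rewrite !mxE (negPf cj) andbF mul0r.
Qed.

(* [upper] and [corner] generate the matrix algebra; the three coordinates of the
   letters of index 2 carry [1], [upper] and [corner]. *)
Definition basis_mx (i b : 'I_3) : mat :=
  if i == ord_max then (if b == 0 then 1 else if b == 1 then upper else corner)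
  else (if b == 0 then 1 else 0).

Definition letter_mx (i : 'I_3) (v : 'rV[F]_3) : mat := \sum_b coord i b v *: basis_mx i b.

Definition lshear (l : wletter F) : {perm space} := shear l.1 (l.1 + 1) (letter_mx l.1 l.2).

Definition wshear (w : word F) : {perm space} := (\prod_(l <- w) lshear l)%g.

(* The blocks of the product of the shears along a word, read off from [run]. *)
Definition Thi k (w : word F) : mat := \sum_b (run k b (0, 1, 0, 0) w).1.2 *: basis_mx (hi k) b.
Definition Tlo k (w : word F) : F := (run k 0 (1, 0, 0, 0) w).1.1.2.
Definition Thilo k (w : word F) : mat := \sum_b (run k b (0, 1, 0, 0) w).2 *: basis_mx (hi k) b.
Definition Tlohi k (w : word F) : mat := \sum_b (run k b (1, 0, 0, 0) w).1.2 *: basis_mx (hi k) b.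

Lemma letter_mx_lo k v : letter_mx (lo k) v = (v 0 0)%:M.
Proof.
rewrite /letter_mx /basis_mx (negPf (lo_not_max k)) (bigD1 0) //= big1 => [|b b0].
  by rewrite coord_lo addr0 scalemx1.
by rewrite (negPf b0) scaler0.
Qed.

Lemma run_rcons k b x (w : word F) l : run k b x (rcons w l) = step k b (run k b x w) l.
Proof. exact: foldl_rcons. Qed.

Lemma run_shape1 k b (w : word F) : exists s u, run k b (0, 1, 0, 0) w = (0, 1, s, u).
Proof.
elim/last_ind: w => [|w [i v] [s [u e]]]; first by exists 0, 0.
rewrite run_rcons e /step; case: ifP => _; [|case: ifP => _].
- by rewrite /step_lo mulr0 addr0; exists s, (u + coord i b v * s).
- by rewrite /step_hi; exists (s + coord i b v * 1), u.
- by exists s, u.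
Qed.

Lemma run_shape2 k b b' (w : word F) : exists s u s' u' t,
  run k b (1, 0, 0, 0) w = (1, t, s, u) /\ run k b' (1, 0, 0, 0) w = (1, t, s', u').
Proof.
elim/last_ind: w => [|w [i v] [s [u [s' [u' [t [e e']]]]]]]; first by exists 0, 0, 0, 0, 0.
rewrite !run_rcons e e' /step; case: eqP => [->|_]; [|case: ifP => _].
- by rewrite !coord_lo /=; do 5!eexists; split; reflexivity.
- by rewrite /step_hi; do 5!eexists; split; reflexivity.
- by do 5!eexists; split; reflexivity.
Qed.

Lemma fold_lshear w x : wshear w x = foldl (fun x l => lshear l x) x w.
Proof.
rewrite /wshear; elim: w x => [|l w IH] x; first by rewrite big_nil perm1.
by rewrite big_cons permM IH.
Qed.

Lemma wshear_rcons w l x : wshear (rcons w l) x = lshear l (wshear w x).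
Proof. by rewrite !fold_lshear foldl_rcons. Qed.

Lemma lshearE i v x : lshear (i, v) x = shear_fun i (i + 1) (letter_mx i v) x.
Proof. by rewrite /lshear shearE // succ_neq. Qed.

Lemma Thi_rcons_lo k w v : Thi k (rcons w (lo k, v)) = Thi k w.
Proof.
apply: eq_bigr => b _; rewrite run_rcons; have [s [u ->]] := run_shape1 k b w.
by rewrite /step eqxx.
Qed.

Lemma Thi_rcons_hi k w v : Thi k (rcons w (hi k, v)) = Thi k w + letter_mx (hi k) v.
Proof.
rewrite /Thi /letter_mx -big_split /=; apply: eq_bigr => b _; rewrite run_rcons.
have [s [u ->]] := run_shape1 k b w.
by rewrite /step /= eqxx eq_sym (negPf (lo_hi k)) /= mulr1 scalerDl.
Qed.

Lemma Thilo_rcons_lo k w v : Thilo k (rcons w (lo k, v)) = Thilo k w + (v 0 0) *: Thi k w.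
Proof.
rewrite /Thilo /Thi scaler_sumr -big_split /=; apply: eq_bigr => b _; rewrite run_rcons.
have [s [u ->]] := run_shape1 k b w.
by rewrite /step eqxx coord_lo /= scalerDl scalerA.
Qed.

Lemma Thilo_rcons_hi k w v : Thilo k (rcons w (hi k, v)) = Thilo k w.
Proof.
apply: eq_bigr => b _; rewrite run_rcons; have [s [u ->]] := run_shape1 k b w.
by rewrite /step /= eqxx eq_sym (negPf (lo_hi k)).
Qed.

Lemma Tlo_rcons_lo k w v : Tlo k (rcons w (lo k, v)) = Tlo k w + v 0 0.
Proof.
rewrite /Tlo run_rcons; have [s [u [s' [u' [t [-> _]]]]]] := run_shape2 k 0 0 w.
by rewrite /step eqxx coord_lo /= mulr1.
Qed.

Lemma Tlo_rcons_hi k w v : Tlo k (rcons w (hi k, v)) = Tlo k w.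
Proof.
rewrite /Tlo run_rcons; have [s [u [s' [u' [t [-> _]]]]]] := run_shape2 k 0 0 w.
by rewrite /step /= eqxx eq_sym (negPf (lo_hi k)).
Qed.

Lemma Tlohi_rcons_lo k w v : Tlohi k (rcons w (lo k, v)) = Tlohi k w.
Proof.
apply: eq_bigr => b _; rewrite run_rcons; have [s [u [s' [u' [t [-> _]]]]]] := run_shape2 k b 0 w.
by rewrite /step eqxx.
Qed.

Lemma Tlohi_rcons_hi k w v :
  Tlohi k (rcons w (hi k, v)) = Tlohi k w + Tlo k w *: letter_mx (hi k) v.
Proof.
rewrite /Tlohi /letter_mx scaler_sumr -big_split /=; apply: eq_bigr => b _; rewrite run_rcons.
have [s [u [s' [u' [t [e e0]]]]]] := run_shape2 k b 0 w.
rewrite /Tlo e e0 /step /= eqxx eq_sym (negPf (lo_hi k)) /= scalerDl scalerA.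
by rewrite (mulrC t).
Qed.

(* For cotypes [0] and [2] the long shears [lo k -> lo k + 1] are followed by the short
   ones; for cotype [1] it is the other way round. *)
Lemma wshear_chain k w x : hi k = lo k + 1 -> avoids k w ->
  wshear w x = [ffun l => if l == lo k then x l + Tlo k w *: x (hi k) + Thilo k w *m x (hi k + 1)
                          else if l == hi k then x l + Thi k w *m x (hi k + 1) else x l].
Proof.
move=> hk; have h1 : hi k + 1 != lo k by rewrite hk; move: (k) => [[|[|[|//]]] ?].
have h2 : hi k + 1 != hi k by rewrite eq_sym succ_neq.
elim/last_ind: w => [|w [i v] IH] aw.
  rewrite fold_lshear /Tlo /Thilo /Thi /=; apply/ffunP => l; rewrite !ffunE.
  rewrite !big1 => [|b _]; rewrite ?scale0r // !mul0mx !addr0.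
  by rewrite !if_same.
move: aw; rewrite /avoids all_rcons => /andP[/= ik aw].
rewrite wshear_rcons IH // lshearE; case: (lo_or_hi ik) => ->.
  rewrite Tlo_rcons_lo Thilo_rcons_lo Thi_rcons_lo -hk letter_mx_lo; apply/ffunP => l; rewrite !ffunE.
  rewrite (eq_sym (hi k)) (negPf (lo_hi k)) eqxx; case: eqP => // ->.
  rewrite mul_scalar_mx scalerDl scalerDr mulmxDl -scalemxAl !addrA; congr (_ + _).
  exact: addrAC.
rewrite Tlo_rcons_hi Thilo_rcons_hi Thi_rcons_hi; apply/ffunP => l; rewrite !ffunE.
rewrite (negPf h1) (negPf h2); case: (eqVneq l (lo k)) => [->|_]; first by rewrite (negPf (lo_hi k)).
by case: eqP => // _; rewrite mulmxDl addrA.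
Qed.

Lemma wshear_antichain k w x : lo k = hi k + 1 -> avoids k w ->
  wshear w x = [ffun l => if l == hi k then x l + Thi k w *m x (lo k) + Tlohi k w *m x (lo k + 1)
                          else if l == lo k then x l + Tlo k w *: x (lo k + 1) else x l].
Proof.
move=> hk; have h1 : lo k + 1 != hi k by rewrite hk; move: (hi k) => [[|[|[|//]]] ?].
have h2 : lo k + 1 != lo k by rewrite eq_sym succ_neq.
elim/last_ind: w => [|w [i v] IH] aw.
  rewrite fold_lshear /Tlo /Tlohi /Thi /=; apply/ffunP => l; rewrite !ffunE.
  rewrite !big1 => [|b _]; rewrite ?scale0r // !mul0mx !addr0.
  by rewrite !if_same.
move: aw; rewrite /avoids all_rcons => /andP[/= ik aw].
rewrite wshear_rcons IH // lshearE; case: (lo_or_hi ik) => ->.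
  rewrite Tlo_rcons_lo Tlohi_rcons_lo Thi_rcons_lo letter_mx_lo; apply/ffunP => l; rewrite !ffunE.
  rewrite (negPf h1) (negPf h2); case: (eqVneq l (lo k)) => [->|_].
    by rewrite (negPf (lo_hi k)) mul_scalar_mx scalerDl addrA.
  by [].
rewrite Tlo_rcons_hi Tlohi_rcons_hi Thi_rcons_hi -hk; apply/ffunP => l; rewrite !ffunE.
rewrite (negPf (lo_hi k)) eqxx; case: (eqVneq l (hi k)) => [->|_] //.
rewrite !mulmxDl mulmxDr -scalemxAr -scalemxAl !addrA; congr (_ + _).
exact: addrAC.
Qed.

(** The shears see only entries of [run] other than the cubic one, that is, the Heisenberg quotient
    of the vertex group. *)
Lemma wshear_vertex k u v : vertex_rel k u v -> wshear u = wshear v.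
Proof.
move=> [au av e]; apply/permP => x.
have e1 : Tlo k u = Tlo k v by rewrite /Tlo e.
have e2 : Thi k u = Thi k v by apply: eq_bigr => b _; rewrite e.
have e3 : Thilo k u = Thilo k v by apply: eq_bigr => b _; rewrite e.
have e4 : Tlohi k u = Tlohi k v by apply: eq_bigr => b _; rewrite e.
have [hk|hk] : hi k = lo k + 1 \/ lo k = hi k + 1.
  by case: (k) => [[|[|[|//]]] ?]; ((left; apply: val_inj; reflexivity) || (right; apply: val_inj; reflexivity)).
  by rewrite !(wshear_chain _ hk) // e1 e2 e3.
by rewrite !(wshear_antichain _ hk) // e1 e2 e4.
Qed.

Lemma wshear_cat u v : wshear (u ++ v) = (wshear u * wshear v)%g.
Proof. by rewrite /wshear big_cat. Qed.

Lemma wshear_eqw u v : eqw u v -> wshear u = wshear v.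
Proof.
elim=> {u v} [k u v|//|u v _ ->//|u v w _ -> _ ->//|u v u' v' _ IH1 _ IH2].
  exact: wshear_vertex.
by rewrite !wshear_cat IH1 IH2.
Qed.

Definition rho (g : tgroup F) : {perm space} := wshear (repr g).

Lemma rho_class w : rho (class w) = wshear w.
Proof. by apply: wshear_eqw; apply/class_eq; rewrite class_repr. Qed.

Lemma rhoM g h : rho (g * h)%g = (rho g * rho h)%g.
Proof. by rewrite -(class_repr g) -(class_repr h) -class_cat !rho_class wshear_cat. Qed.

Definition image_group : {group {perm space}} := [group of <<[set lshear l | l : wletter F]>>%g].
Local Notation Q := image_group.

Lemma rho_image g : rho g \in Q.
Proof.
rewrite /rho; elim: (repr g) => [|l w IH]; first by rewrite /wshear big_nil group1.
rewrite /wshear big_cons groupM // mem_gen //; exact: imset_f.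
Qed.

Lemma image_rho x : x \in Q -> exists g, rho g = x.
Proof.
move=> /gen_prodgP[N [c cA ->]]; elim: N c cA => [|N IH] c cA.
  by exists 1%g; rewrite big_ord0 -class_nil rho_class /wshear big_nil.
have [g eg] := IH (fun i => c (widen_ord (leqnSn N) i)) (fun i => cA _).
have /imsetP[l _ el] := cA ord_max.
exists (g * class [:: l])%g; rewrite rhoM eg rho_class big_ord_recr /= el.
by rewrite /wshear big_seq1.
Qed.
End Shears.

(** * The elementary group and its normal subgroups *)

Section Elementary.
Local Open Scope group_scope.
Local Open Scope ring_scope.
Variables (F : finFieldType) (m : nat).
Local Notation n := m.+1.
Local Notation mat := 'M[F]_n.
Local Notation Q := (image_group F m).
Local Notation shear := (@shear F m).
Implicit Types x y : mat.

Lemma lshear_in i v : shear i (i + 1) (letter_mx m i v) \in Q.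
Proof. by rewrite mem_gen //; apply/imsetP; exists (i, v). Qed.

Lemma letter_mx_scalar i (a : F) : letter_mx m i (a *: delta_mx 0 0) = a%:M.
Proof.
rewrite /letter_mx (bigD1 0) //= big1 => [|b b0]; last first.
  rewrite /coord /basis_mx !mxE (negPf b0) !eqxx /= mulr1 mulr0.
  by case: ifP => _; rewrite ?scale0r // scaler0.
rewrite addr0 /coord !mxE !eqxx /= mulr1 if_same /basis_mx eqxx if_same.
by rewrite scalemx1.
Qed.

Lemma shear_scalar_succ i a : shear i (i + 1) a%:M \in Q.
Proof. by rewrite -(letter_mx_scalar i a) lshear_in. Qed.

Lemma shearM_in i j k x y : i != j -> j != k -> i != k ->
  shear i j x \in Q -> shear j k y \in Q -> shear i k (x *m y) \in Q.
Proof.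
move=> ij jk ik xQ yQ; rewrite -[x *m y]opprK shearN // -(shearR x y ij jk ik) groupV.
exact: groupR.
Qed.

Lemma index_cases (i j : 'I_3) : i != j -> j = i + 1 \/ j = i + 1 + 1.
Proof.
by move: i j => [[|[|[|//]]] ?] [[|[|[|//]]] ?] // _;
  ((left; apply: val_inj; reflexivity) || (right; apply: val_inj; reflexivity)).
Qed.

Lemma shear_scalar_in i j a : i != j -> shear i j a%:M \in Q.
Proof.
move=> ij; case: (index_cases ij) => ej; rewrite ej; first exact: shear_scalar_succ.
rewrite ej in ij; rewrite -[a%:M]mulmx1 -[1%:M]/(1%:M : mat).
by apply: (@shearM_in i (i + 1)); rewrite ?succ_neq // shear_scalar_succ.
Qed.

Lemma shear1_in i j : i != j -> shear i j 1 \in Q.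
Proof. exact: shear_scalar_in. Qed.

(** Such coefficients form a subalgebra, products coming from commutators through the third index;
    it contains [upper] and [corner], hence everything. *)
Definition everywhere x : Prop := forall i j, i != j -> shear i j x \in Q.

Lemma everywhere_of i j x : i != j -> shear i j x \in Q -> everywhere x.
Proof. exact: (shear_spread (normG Q) shear1_in). Qed.

Lemma everywhereD x y : everywhere x -> everywhere y -> everywhere (x + y).
Proof. by move=> hx hy i j ij; rewrite -shearD // groupM ?hx ?hy. Qed.

Lemma everywhereM x y : everywhere x -> everywhere y -> everywhere (x *m y).
Proof.
move=> hx hy i j ij; apply: (@shearM_in i (third i j)) => //.
- by rewrite eq_sym third_neql.
- exact: third_neqr.
- by apply: hx; rewrite eq_sym third_neql.
- by apply: hy; apply: third_neqr.
Qed.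

Lemma everywhere_upper : everywhere (upper F m).
Proof.
have := lshear_in ord_max (delta_mx 0 1).
have -> : letter_mx m ord_max (delta_mx 0 1) = upper F m.
  rewrite /letter_mx (bigD1 1) //= big1 => [|b b1].
    by rewrite /coord !mxE !eqxx /= scale1r addr0.
  by rewrite /coord !mxE (negPf b1) scale0r.
by apply: everywhere_of.
Qed.

Lemma everywhere_corner : everywhere (corner F m).
Proof.
have := lshear_in ord_max (delta_mx 0 (1 + 1)).
have -> : letter_mx m ord_max (delta_mx 0 (1 + 1)) = corner F m.
  rewrite /letter_mx (bigD1 (1 + 1)) //= big1 => [|b b1].
    by rewrite /coord !mxE !eqxx /= scale1r addr0.
  by rewrite /coord !mxE (negPf b1) scale0r.
by apply: everywhere_of.
Qed.

Lemma everywhere_delta a b : everywhere (delta_mx a b).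
Proof.
have row t (a' : 'I_n) : (a' + t)%N = m -> everywhere (delta_mx a' 0).
  elim: t a' => [|t IH] a' e.
    have -> : a' = ord_max by apply: val_inj; move: e; rewrite addn0.
    exact: everywhere_corner.
  have a'm : (a'.+1 < n)%N by lia.
  rewrite -(@upper_delta _ _ (Ordinal a'm)) //; apply: everywhereM; first exact: everywhere_upper.
  by apply: IH; rewrite /= addSnnS.
case: b => b bn; elim: b bn => [|b IH] bn.
  have -> : Ordinal bn = 0 by apply: val_inj.
  by apply: (row (m - a)%N); rewrite subnKC // -ltnS.
have bn' : (b < n)%N by apply: ltnW.
rewrite -(@delta_upper _ _ _ (Ordinal bn')) //; apply: everywhereM => //.
exact: everywhere_upper.
Qed.

Lemma everywhere_all x : everywhere x.
Proof.
have sumE (I : Type) (r : seq I) (f : I -> mat) :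
    (forall i, everywhere (f i)) -> everywhere (\sum_(i <- r) f i).
  move=> h; elim: r => [|i r IH]; last by rewrite big_cons; apply: everywhereD.
  by rewrite big_nil => i j ij; rewrite shear0 // group1.
rewrite [x]matrix_sum_delta; apply: (sumE) => a; apply: (sumE) => b.
by rewrite -mul_scalar_mx; apply: everywhereM; [move=> i j; apply: shear_scalar_in|exact: everywhere_delta].
Qed.

Definition block_fun (s : 'S_n) (w : space F m) : space F m :=
  [ffun k => if k == 0 then perm_mx s^-1 *m w k else w k].

Lemma block_funM s t w : block_fun t (block_fun s w) = block_fun (s * t)%g w.
Proof.
apply/ffunP => k; rewrite !ffunE; case: eqP => // _.
by rewrite mulmxA -perm_mxM invMg.
Qed.

Lemma block_fun1 w : block_fun 1%g w = w.
Proof. by apply/ffunP => k; rewrite ffunE invg1 perm_mx1 mul1mx if_same. Qed.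

Lemma block_inj s : injective (block_fun s).
Proof.
by apply: (can_inj (g := block_fun s^-1%g)) => w; rewrite block_funM mulgV block_fun1.
Qed.

Definition block s : {perm space F m} := perm (@block_inj s).

Lemma blockM : {in [set: 'S_n] &, {morph block : s t / (s * t)%g}}.
Proof. by move=> s t _ _; apply/permP => w; rewrite permM !permE block_funM. Qed.

Canonical block_morphism := Morphism blockM.

(* Whitehead's lemma: [diag(g, g^-1)] is a product of shears. *)
Definition diag_shears (s : 'S_n) : {perm space F m} :=
  let w01 x := shear 0 1 x in let w10 x := shear 1 0 x in
  let g := perm_mx s^-1 in let h := perm_mx s in
  (w01 g * w10 (- h)%R * w01 g * (w01 (- 1)%R * w10 1%R * w01 (- 1)%R))%g.

Lemma diag_shears_in s : diag_shears s \in Q.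
Proof.
have e i j x : i != j -> shear i j x \in Q by exact: everywhere_all.
by rewrite /diag_shears !groupM ?e.
Qed.

Lemma diag_shearsE s w : diag_shears s w = [ffun k => if k == 0 then perm_mx s *m w 0
   else if k == 1 then perm_mx s^-1 *m w 1 else w k].
Proof.
have ss : perm_mx s *m perm_mx s^-1 = 1%:M :> mat by rewrite -perm_mxM mulgV perm_mx1.
have ss' : perm_mx s^-1 *m perm_mx s = 1%:M :> mat by rewrite -perm_mxM mulVg perm_mx1.
rewrite /diag_shears !permM !shearE //; apply/ffunP => k; rewrite !ffunE /=.
case: (eqVneq k 0) => [->|k0] /=.
  rewrite !mulmxDr !mulNmx !mulmxN !mul1mx !mulmxA ss ss' !mul1mx.
  move: (perm_mx s *m w 0) (perm_mx s^-1 *m w 1) (w 0) (w 1) => a b c d.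
  by apply/matrixP => i j; rewrite !mxE; ring.
case: (eqVneq k 1) => [->|k1] /=; last by rewrite ?(negPf k0) ?(negPf k1).
rewrite !(mulmxDr, mulNmx, mulmxN, mul1mx, mulmxA, ss, ss').
set a := perm_mx s *m w 0; set b := perm_mx s^-1 *m w 1.
by move: a b (w 0) (w 1) => a b c d; apply/matrixP => i j; rewrite !mxE; ring.
Qed.

(** In the second block the three diagonal factors cancel; in the first they leave the
    commutator. *)
Lemma block_commutator s t : block [~ s, t]%g \in Q.
Proof.
suff -> : block [~ s, t]%g = (diag_shears s * diag_shears t * diag_shears (t^-1 * s^-1))%g.
  by apply: groupM; [apply: groupM|]; apply: diag_shears_in.
apply/permP => w.
rewrite (permM (diag_shears s * _)%g) (permM (diag_shears s)) permE !diag_shearsE.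
 apply/ffunP => k; rewrite !ffunE /=.
case: (eqVneq k 0) => [->|k0].
  by rewrite !mulmxA -!perm_mxM invg_comm /commg /conjg !mulgA.
case: (eqVneq k 1) => [->|k1] //=.
by rewrite !mulmxA -!perm_mxM invMg !invgK -!mulgA mulKVg mulgV perm_mx1 mul1mx.
Qed.

Hypothesis n5 : (5 <= n)%N.

Lemma Alt_perfect : ('Alt_('I_n))^`(1)%g = 'Alt_('I_n)%g.
Proof.
have card5 : (5 <= #|'I_n|)%N by rewrite card_ord.
have /simpleP[_ simA] := simple_Alt5 card5.
case: (simA _ (der_normal 1 _)) => // e.
have := solvable_AltF card5.
by rewrite abelian_sol // (sameP derG1P eqP) e.
Qed.

Lemma block_Alt s : s \in 'Alt_('I_n)%g -> block s \in Q.
Proof.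
have sub : ('Alt_('I_n) \subset block @*^-1 Q)%g.
  rewrite -Alt_perfect derg1 gen_subG; apply/subsetP => _ /imset2P[x y _ _ ->].
  by rewrite !inE /=; apply: block_commutator.
by move=> /(subsetP sub); rewrite !inE.
Qed.

Lemma block_shear s x :
  [~ block s, shear 0 1%R x]%g = shear 0 1 (x - perm_mx s^-1 *m x).
Proof.
have bV : (block s)^-1%g = block s^-1 by rewrite (morphV block_morphism) ?inE.
apply/permP => w; rewrite /commg /conjg -shearN // bV !permM !permE !shearE //.
have ss : perm_mx s^-1 *m perm_mx s = 1%:M :> mat by rewrite -perm_mxM mulVg perm_mx1.
apply/ffunP => k; rewrite !ffunE /=; case: (eqVneq k 0) => [->|//] /=.
rewrite invgK !mulmxDr mulNmx mulmxN !mulmxA ss mul1mx mulmxBl.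
move: (perm_mx s^-1 *m x *m w 1) (x *m w 1) (w 0) => a b c.
by apply/matrixP => i j; rewrite !mxE; ring.
Qed.

Section NormalClosure.
Variable M : {group {perm space F m}}.
Hypothesis nM : (M <| Q)%g.

(** Commutators of [block s] with shears have the coefficients [x - s^-1 x]; multiplied by arbitrary
    matrices on the left these yield all matrix units. *)
Lemma normal_of_block (s : 'S_n) : s != 1%g -> block s \in M -> (Q \subset M)%g.
Proof.
move=> s1 sM; have nMQ := normal_norm nM.
have h01 x : shear 0 1 (x - perm_mx s^-1 *m x) \in M.
  by rewrite -block_shear (commM nMQ) //; apply: everywhere_all.
have h21 x y : shear ord_max 1 (y *m (x - perm_mx s^-1 *m x)) \in M.
  rewrite -[_ *m _]opprK shearN // -(@shearR _ _ ord_max 0 1) // groupV.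
  by apply: (commQ nMQ); [apply: everywhere_all|apply: h01].
have [i si] : exists i, s^-1%g i != i.
  apply/existsP; apply: contraNT s1 => /existsPn h; rewrite -invg_eq1; apply/eqP/permP => i.
  by rewrite perm1; apply/eqP; have := h i; rewrite negbK.
(* As [s^-1] moves [i], the matrices [E_ib - s^-1 E_ib] and [E_ib] have the same row [i], which
   [E_ai] extracts. *)
have hd a b c : shear ord_max 1 (c *: delta_mx a b) \in M.
  have -> : c *: delta_mx a b =
    (c *: delta_mx a i) *m (delta_mx i b - perm_mx s^-1 *m delta_mx i b) :> mat.
    rewrite -scalemxAl mulmxBr mul_delta_mx; congr (_ *: _).
    rewrite -row_permE; apply/matrixP => a' b'; rewrite !mxE.
    rewrite (bigD1 i) //= big1 => [|k ki]; rewrite !mxE ?(negPf ki) ?andbF ?mul0r //.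
    by rewrite (negPf si) mulr0 addr0 subr0.
  exact: h21.
have all21 x : shear ord_max 1 x \in M.
  have sumM (I : Type) (r : seq I) (f : I -> mat) :
      (forall i, shear ord_max 1 (f i) \in M) -> shear ord_max 1 (\sum_(i <- r) f i) \in M.
    move=> h; elim: r => [|k r IH]; first by rewrite big_nil shear0 // group1.
    by rewrite big_cons -shearD //; apply: groupM; [apply: h|apply: IH].
  by rewrite [x]matrix_sum_delta; apply: (sumM) => a; apply: (sumM) => b; apply: hd.
rewrite gen_subG; apply/subsetP => _ /imsetP[l _ ->].
by apply: (shear_spread nMQ shear1_in _ (all21 _)) => //; apply: succ_neq.
Qed.
End NormalClosure.
End Elementary.

(** * Simple quotients containing alternating groups *)

Section FiniteQuotients.
Local Open Scope group_scope.
Local Open Scope ring_scope.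
Variable F : finFieldType.

(** For small [d] the group [Alt(d)] need not be perfect; adding fixed points, which keeps the
    parity, embeds it in [Alt(k + d)]. *)
Lemma lift_perm_even d k : exists f : 'S_d -> 'S_(k + d),
  [/\ {morph f : s t / (s * t)%g}, forall s, f s = 1%g -> s = 1%g
    & forall s, f s = s :> bool].
Proof.
elim: k => [|k [f [fM f1 fo]]]; first by exists id.
exists (fun s => lift_perm ord0 ord0 (f s)); split=> [s t|s e|s].
- by rewrite lift_permM fM.
- apply: f1; apply/permP => i; apply: (@lift_inj _ ord0).
  by rewrite -(lift_perm_lift ord0 ord0) e !perm1.
- by rewrite odd_lift_perm fo addbb.
Qed.

Lemma image_group_neq1 m : (image_group F m : {set _}) != 1%g.
Proof.
apply/eqP => Q1; have : shear 0 1 (1 : 'M[F]_m.+1) \in image_group F m by apply: shear1_in.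
rewrite Q1 => /set1P/permP/(_ [ffun=> const_mx 1]).
rewrite perm1 shearE // => /ffunP/(_ 0); rewrite !ffunE eqxx mul1mx.
move/(canRL (addKr _)); rewrite addrC subrr => /matrixP/(_ 0 0); rewrite !mxE.
by move/eqP; rewrite oner_eq0.
Qed.

Lemma tgroup_simple_quotients : simple_quotients_of_large_rank (tgroup F).
Proof.
(* The matrices have size [m + 1 = 5 + d]. *)
move=> d; pose m := (4 + d)%N; pose Q := image_group F m.
have n5 : (5 <= m.+1)%N by rewrite ltnS leq_addr.
have [f [fM f1 fo]] := lift_perm_even d 5.
have [M maxM] := ex_maxnormal_ntrivg (image_group_neq1 m).
have nM := maxnormal_normal maxM; have nMQ := normal_norm nM.
have simQM : simple (Q / M)%g by rewrite quotient_simple.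
pose gT := subg_of (Q / M)%G.
have subgM : {in (Q / M)%g &, {morph subg (Q / M) : x y / (x * y)%g}} by apply: subgM.
have projM : {in Q &, {morph (fun x => subg (Q / M) (coset M x) : gT) : x y / (x * y)%g}}.
  move=> x y xQ yQ /=; rewrite morphM ?(subsetP nMQ) //.
  by rewrite subgM // mem_quotient.
pose h s : gT := subg (Q / M) (coset M (block F (f s))).
have fA s : s \in 'Alt_('I_d)%g -> block F (f s) \in Q.
  by move=> sA; apply: block_Alt => //; rewrite Alt_even fo -Alt_even.
have hM : {in 'Alt_('I_d)%g &, {morph h : s t / (s * t)%g}}.
  move=> s t sA tA; rewrite /h fM (morphM (block_morphism F m)) ?inE //.
  exact: projM (fA _ sA) (fA _ tA).
pose hm := Morphism hM.
have hI : ('injm hm)%g.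
  apply/subsetP => s /morphpreP[sA /set1P hs]; apply/set1P/f1/eqP.
  have bQ := fA _ sA.
  have : coset M (block F (f s)) = 1%g.
    by rewrite -(@subgK _ (Q / M)%G _ (mem_quotient M bQ)) -[subg _ _]/(hm s) hs.
  move/coset_idr => /(_ (subsetP nMQ _ bQ)) bM.
  apply: contraTT (maxnormal_proper maxM) => s1.
  by rewrite properE (normal_of_block nM s1 bM) andbF.
exists gT; split; first split.
- by rewrite -(isog_simple (isog_subg (Q / M)%G)).
- by exists (hm @* 'Alt_('I_d))%G; apply: sub_isog.
pose q (g : tgroup F) : gT := subg (Q / M) (coset M (rho m g)).
have qM : {morph q : x y / (x * y)%g}.
  by move=> x y; rewrite /q rhoM; apply: projM; apply: rho_image.
exists (HB.pack_for {multiplicative tgroup F -> gT} q (isMultiplicative.Build _ _ q qM)).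
move=> y; have /morphimP[x _ xQ e] := subgP y; have [g eg] := image_rho xQ.
by exists g; rewrite /= /q eg -e sgvalK.
Qed.
End FiniteQuotients.

Theorem corollary1p5 (R : realType) :
  exists G : groupType,
    [/\ hyperbolic_group R G, kazhdan_property_T R G
      & simple_quotients_of_large_rank G].
Proof.
pose F : finFieldType := 'F_103; have F_large : (103 <= #|F|)%N by rewrite card_Fp.
exists (tgroup F); split.
- apply: (triangle_hyperbolic (tgroup_triangle F) (S := flatten [seq vgroup F k | k : 'I_3])) => x.
  split=> [/flattenP[_ /mapP[k _ ->] /mem_vgroup Xx]|[k Xx]]; first by exists k.
  by apply/flattenP; exists (vgroup F k); [apply/map_f; rewrite mem_enum|apply/mem_vgroup].
- exact: tgroup_property_T.
- exact: tgroup_simple_quotients.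
Qed.
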